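(* Let $n\ge1$ and $\alpha:\{0,1\}\to\{0,1\}$. The $\alpha$-$SU(2n)$ nonlinear Fourier transform $\mathcal{F}_\alpha$, defined on finitely supported sequences of contractive matrices, extends to a homeomorphism from $\ell^2(\mathbb{Z}_{\ge0};\mathcal{C})$ onto $\mathbf{H}_\alpha^+$.
   Context: $\mathbb{T}$ is the unit circle with uniform probability measure, $\mathbb{D}$ the open unit disc; measurable functions are identified if equal a.e. $\mathrm{Id}$ is the identity matrix, ${}^*$ the conjugate transpose. For a matrix, $\|\cdot\|_\infty$ is the operator norm and $\|\cdot\|_2$ the Hilbert--Schmidt norm. $\mathcal{C}$ is the set of complex $n\times n$ matrices $F$ with $\|F\|_\infty<1$ (contractive matrices). $\ell^2(\mathbb{Z}_{\ge0};\mathcal{C})$ is the set of sequences $(F_j)_{j\ge0}$ in $\mathcal{C}$ with $\sum_j\|F_j\|_2^2<\infty$, with the $\ell^2$ metric; such sequences are identified with sequences on $\mathbb{Z}$ vanishing for $j<0$. $\mathcal{G}_0$ ($\mathcal{G}_1$) is the group of upper (lower) triangular complex $n\times n$ matrices with positive diagonal entries. For $F\in\mathcal{C}$, $Y_\alpha(F)$ is the unique matrix $\begin{pmatrix} E & F \\ G & H \end{pmatrix}\in SU(2n)$ (with $n\times n$ blocks) with upper right block $F$, $E\in\mathcal{G}_{\alpha(0)}$, $H\in\mathcal{G}_{\alpha(1)}$. For $z\in\mathbb{T}$ put formally $Z=\begin{pmatrix} z^{1/2}\mathrm{Id} & 0 \\ 0 & z^{-1/2}\mathrm{Id} \end{pmatrix}$,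 so that $Z^j\begin{pmatrix} E & F \\ G & H \end{pmatrix}Z^{-j}=\begin{pmatrix} E & z^jF \\ z^{-j}G & H \end{pmatrix}$. For a finitely supported sequence $F=(F_j)_{j\in\mathbb{Z}}$ in $\mathcal{C}$, $\mathcal{F}_\alpha(F)(z)=\prod_{j\in\mathbb{Z}}Z^jY_\alpha(F_j)Z^{-j}$, the (finite) product being ordered with $j$ increasing from left to right. A matrix function is in $H^2(\mathbb{D})$ if each entry is; it is identified with its analytic extension to $\mathbb{D}$. If $A^*\in H^2(\mathbb{D})$, then $A(\infty):=(A^*(0))^*$. $\mathbf{H}_\alpha^+$ is the set of measurable functions $M=\begin{pmatrix} A & B \\ C & D \end{pmatrix}:\mathbb{T}\to SU(2n)$ such that: (1) $A^*,C^*,B,D\in H^2(\mathbb{D})$; (2) $A(\infty)\in\mathcal{G}_{\alpha(0)}$ and $D(0)\in\mathcal{G}_{\alpha(1)}$; (3) whenever $I_1^*,I_2\in H^2(\mathbb{D})$ are $n\times n$ matrix functions, both unitary a.e. on $\mathbb{T}$, and $M':\mathbb{T}\to SU(2n)$ satisfies (1) and (2) and $M=M'\begin{pmatrix} I_1 & 0 \\ 0 & I_2 \end{pmatrix}$, then $I_1=I_2=\mathrm{Id}$. It is equipped with the metric $$d(M,M')=\Big(\int_{\mathbb{T}}\|M-M'\|_2^2\Big)^{1/2}+|\log\det A(\infty)-\log\det A'(\infty)|.$$ *)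

(* Defs.v *)
From HB Require Import structures.
From mathcomp Require Import all_boot all_order all_algebra.
From mathcomp Require Import complex.
From mathcomp Require Import all_classical all_reals all_analysis.

Set Implicit Arguments.
Unset Strict Implicit.
Unset Printing Implicit Defensive.

Import Order.TTheory GRing.Theory Num.Theory.
Import numFieldNormedType.Exports.

Local Open Scope classical_set_scope.
Local Open Scope ring_scope.
Local Open Scope sesquilinear_scope.

Section Circle.
Variable R : realType.
Local Notation C := R[i].

Definition cmod (x : C) : R := complex.Re `|x|.

Definition circle := {z : C | `|z| == 1}.

Lemma cis_subproof (t : R) :
  `|Complex (cos (2 * pi * t)) (sin (2 * pi * t))| == 1 :> C.
Proof. by rewrite normc_def /= cos2Dsin2 sqrtr1. Qed.

Definition cis (t : R) : circle :=
  @exist C (fun z => `|z| == 1) _ (cis_subproof t).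

Definition I01 : set R := `[0, 1].

(* [cis] restricted to [0, 1[ is a Borel isomorphism onto the circle that
   carries Lebesgue measure to the uniform probability measure; measurability,
   "almost everywhere" and integration on the circle are pulled back along it
   (the endpoint 1 is a null set). *)
Definition circle_measurable (f : circle -> C) : Prop :=
  measurable_fun I01 (fun t : R => complex.Re (f (cis t))) /\
  measurable_fun I01 (fun t : R => complex.Im (f (cis t))).

Definition circle_ae (P : circle -> Prop) : Prop :=
  {ae (@lebesgue_measure R), forall t, I01 t -> P (cis t)}.

Definition ae_equal {T : Type} (f g : circle -> T) : Prop :=
  circle_ae (fun z => f z = g z).

Definition circle_int (h : circle -> R) : \bar R :=
  (\int[@lebesgue_measure R]_(t in I01) (h (cis t))%:E)%E.

Definition analytic_disc (g : C -> C) : Prop :=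
  exists a : nat -> C, forall w : C, `|w| < 1 ->
    (fun m : nat => \sum_(k < m) a k * w ^+ k : C^o) @ \oo --> (g w : C^o).

(* The Hardy space of functions on the disc, defined by bounded quadratic
   means on the circles of radius r < 1. *)
Definition hardy2 (g : C -> C) : Prop :=
  analytic_disc g /\
  exists K : R, forall r : R, 0 <= r < 1 ->
    (circle_int (fun z => cmod (g (r%:C%C * sval z)) ^+ 2)%R <= K%:E)%E.

(* [g] on the disc has boundary function [f] : the dilates
   z |-> g (r z) converge to [f] in L^2 as r tends to 1 from below. *)
Definition boundary_function (g : C -> C) (f : circle -> C) : Prop :=
  circle_int (fun z => cmod (g (r%:C%C * sval z) - f z) ^+ 2)
    @[r --> (1 : R)^'-] --> (0 : \bar R)%E.

Definition disc_extension (f : circle -> C) (g : C -> C) : Prop :=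
  hardy2 g /\ boundary_function g f.

Definition H2 (f : circle -> C) : Prop :=
  circle_measurable f /\ exists g, disc_extension f g.

(* Meaningful only for [f] in [H2] and inside the disc, where all the
   extensions of [f] agree. *)
Definition h2ext (f : circle -> C) : C -> C :=
  xget (fun=> 0) [set g | disc_extension f g].

Section Matrices.
Context {m n : nat}.

Definition mx_measurable (A : circle -> 'M[C]_(m, n)) : Prop :=
  forall i j, circle_measurable (fun z => A z i j).

Definition H2mx (A : circle -> 'M[C]_(m, n)) : Prop :=
  forall i j, H2 (fun z => A z i j).

Definition h2ext_mx (A : circle -> 'M[C]_(m, n)) (w : C) : 'M[C]_(m, n) :=
  \matrix_(i, j) h2ext (fun z => A z i j) w.

Definition hsnorm (A : 'M[C]_(m, n)) : R :=
  Num.sqrt (\sum_i \sum_j cmod (A i j) ^+ 2).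
End Matrices.

(* On column vectors [hsnorm] is the Euclidean norm. *)
Definition opnorm {n : nat} (F : 'M[C]_n) : R :=
  sup [set hsnorm (F *m v) | v in [set v : 'cV[C]_n | hsnorm v <= 1]].

Definition contractive {n : nat} (F : 'M[C]_n) : Prop := opnorm F < 1.

Definition SU {n : nat} (M : 'M[C]_n) : Prop :=
  M \is unitarymx /\ \det M = 1.

(* The booleans false, true stand for the indices 0, 1. In [C], 0 < x means
   that x is real and positive. *)
Definition triG {n : nat} (b : bool) (A : 'M[C]_n) : Prop :=
  (if b then is_trig_mx A else is_trig_mx A^T) /\ forall i, 0 < A i i.

End Circle.

Section NLFT.
Variables (R : realType) (n : nat) (alpha : bool -> bool).
Local Notation C := R[i].
Local Notation Mn := 'M[C]_n.
Local Notation M2n := 'M[C]_(n + n).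

Definition is_Y (F : Mn) (Y : M2n) : Prop :=
  [/\ SU Y, ursubmx Y = F,
      triG (alpha false) (ulsubmx Y) & triG (alpha true) (drsubmx Y)].

(* For contractive [F] there is exactly one such matrix. *)
Definition Y (F : Mn) : M2n := xget 0 [set Y | is_Y F Y].

(* Z^j M Z^-j *)
Definition Zconj (z : circle R) (j : int) (M : M2n) : M2n :=
  block_mx (ulsubmx M) (sval z ^ j *: ursubmx M)
           (sval z ^ (- j) *: dlsubmx M) (drsubmx M).

Definition supported_in (N : nat) (F : int -> Mn) : Prop :=
  forall j : int, (N < `|j|)%N -> F j = 0.

Definition nlft_window (N : nat) (F : int -> Mn) (z : circle R) : M2n :=
  \big[mulmx/1%:M]_(0 <= k < N.*2.+1)
    Zconj z (k%:Z - N%:Z) (Y (F (k%:Z - N%:Z))).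

(* The factors with F_j = 0 are identities, so that for finitely supported
   [F] any window that contains the support gives the same product. *)
Definition nlft (F : int -> Mn) : circle R -> M2n :=
  nlft_window (xget 0%N [set N | supported_in N F]) F.

Definition extend0 (F : nat -> Mn) (j : int) : Mn :=
  if j is Posz k then F k else 0.

Definition ell2C (F : nat -> Mn) : Prop :=
  (forall j, contractive (F j)) /\
  (\sum_(0 <= j <oo) (hsnorm (F j) ^+ 2)%:E < +oo)%E.

Definition ell2_dist (F G : nat -> Mn) : R :=
  Num.sqrt (fine (\sum_(0 <= j <oo) (hsnorm (F j - G j) ^+ 2)%:E)%E).

Definition A_infty (M : circle R -> M2n) : Mn :=
  (h2ext_mx (fun z => (ulsubmx (M z))^t*) 0)^t*.

Definition D_zero (M : circle R -> M2n) : Mn :=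
  h2ext_mx (fun z => drsubmx (M z)) 0.

Definition Hplus_cond1 (M : circle R -> M2n) : Prop :=
  [/\ H2mx (fun z => (ulsubmx (M z))^t*), H2mx (fun z => (dlsubmx (M z))^t*),
      H2mx (fun z => ursubmx (M z)) & H2mx (fun z => drsubmx (M z))].

Definition Hplus_cond2 (M : circle R -> M2n) : Prop :=
  triG (alpha false) (A_infty M) /\ triG (alpha true) (D_zero M).

Definition Hplus_cond3 (M : circle R -> M2n) : Prop :=
  forall (I1 I2 : circle R -> Mn) (M' : circle R -> M2n),
    H2mx (fun z => (I1 z)^t*) -> H2mx I2 ->
    circle_ae (fun z => I1 z \is unitarymx) ->
    circle_ae (fun z => I2 z \is unitarymx) ->
    mx_measurable M' -> circle_ae (fun z => SU (M' z)) ->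
    Hplus_cond1 M' -> Hplus_cond2 M' ->
    ae_equal M (fun z => M' z *m block_mx (I1 z) 0 0 (I2 z)) ->
    ae_equal I1 (fun=> 1%:M) /\ ae_equal I2 (fun=> 1%:M).

(* A set of representatives, invariant under a.e. equality. *)
Definition Hplus (M : circle R -> M2n) : Prop :=
  [/\ mx_measurable M, circle_ae (fun z => SU (M z)),
      Hplus_cond1 M, Hplus_cond2 M & Hplus_cond3 M].

(* On [Hplus] the determinants are real and positive. *)
Definition Hplus_dist (M M' : circle R -> M2n) : R :=
  Num.sqrt (fine (circle_int (fun z => hsnorm (M z - M' z) ^+ 2))) +
  `|ln (complex.Re (\det (A_infty M))) - ln (complex.Re (\det (A_infty M')))|.

End NLFT.

Section Homeomorphism.
Variables (R : realType) (X Y : Type).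

Definition metric_continuous (A : set X) (dX : X -> X -> R)
    (dY : Y -> Y -> R) (f : X -> Y) : Prop :=
  forall x, A x -> forall e : R, 0 < e -> exists2 d : R, 0 < d &
    forall x', A x' -> dX x x' < d -> dY (f x) (f x') < e.

Definition metric_inverse_continuous (A : set X) (dX : X -> X -> R)
    (dY : Y -> Y -> R) (f : X -> Y) : Prop :=
  forall x, A x -> forall e : R, 0 < e -> exists2 d : R, 0 < d &
    forall x', A x' -> dY (f x) (f x') < d -> dX x x' < e.

(* [f] induces a homeomorphism from (A, dX) onto the metric space of
   [eqY]-classes of elements of B with the metric dY. *)
Definition homeomorphism_onto (A : set X) (dX : X -> X -> R)
    (B : set Y) (eqY : Y -> Y -> Prop) (dY : Y -> Y -> R)
    (f : X -> Y) : Prop :=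
  [/\ (forall x, A x -> B (f x)),
      (forall x x', A x -> A x' -> eqY (f x) (f x') -> x = x'),
      (forall y, B y -> exists2 x, A x & eqY (f x) y),
      metric_continuous A dX dY f &
      metric_inverse_continuous A dX dY f].
End Homeomorphism.

(* Main.v *)
Require Import Defs.
From HB Require Import structures.
From mathcomp Require Import all_boot all_order all_algebra.
From mathcomp Require Import complex.
From mathcomp Require Import all_classical all_reals all_analysis.
From mathcomp Require Import measurable_realfun ring lra.

Set Implicit Arguments.
Unset Strict Implicit.
Unset Printing Implicit Defensive.

Import Order.TTheory GRing.Theory Num.Theory.
Import numFieldNormedType.Exports.

Local Open Scope sesquilinear_scope.
Local Open Scope classical_set_scope.
Local Open Scope ring_scope.

(** The transform is inverted by layer stripping. Let [M] be a function in the
    target space; its left block columns are boundary values of functions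
    analytic outside the disc, the right ones of functions analytic inside, and
    the values at infinity and at zero are the means over the circle. If [M]
    is [Y(F_0)] times a conjugate by [Z] of another such function, then
    [B(0) D(0)^-1 = F_0 H_0^-1], where [H_0] is the lower right block of
    [Y(F_0)]. The map [F |-> F H^-1] is a bijection from the contractive
    matrices onto all matrices ([Kof_surj], [Kof_inj]) with continuous inverse
    ([Kof_cvg]), because [H] is the triangular factor of [(1 + K^* K)^-1] for
    [K = F H^-1]. So every [M] determines a first coefficient [coef0], and
    removing the corresponding factor leaves a function of the same kind
    ([preH_strip]): the off-diagonal blocks of [Y(F_0)^* M] have mean zero, one
    by the choice of [F_0], the other by the orthogonality of the columns of
    [M] ([strip_offdiag]). Iteration yields all coefficients.

    Sizes are controlled by the diagonals at infinity and at zero, which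
    multiply under adding a factor. For one factor, the determinant [delta] of
    the upper left block of [Y(F)] satisfies
    [1 - |F|^2 <= delta] ([delta_ge]) and [|F|^2 <= - 2 ln delta]
    ([hs2_le_ln_delta]).
    The lower bound makes the partial products a Cauchy sequence in mean square:
    for unitary [M] the distance to the identity is read off from the trace of
    the mean ([mnrm_sub1], [MP_near1], [MP_cauchy]). This defines the transform
    [Phi] of a square-summable sequence, with nonvanishing diagonals
    ([preH_Phi]), and stripping recovers the sequence ([coef_Phi]), whence
    injectivity. The upper bound shows that the coefficients of any [M] are
    square-summable ([coef_sum_le]).

    For the maximality of [Phi F] ([Phi_maximal]), let
    [Phi F = M' diag(I_1, I_2)]. The inner factors do not change the
    coefficients ([inner_coef]), so the diagonals of [M'] are at most the
    infinite products, which are the diagonals of [Phi F]; hence the means of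
    [I_1] and [I_2] have diagonal entries at least one, and both are the
    identity. For surjectivity ([Phi_surj]), the quotient of [M] by the transform
    of its coefficients is the limit of [Z^k M_k Z^-k], where [M_k] is [M]
    without its first [k] factors. The off-diagonal blocks of these functions
    vanish to order [k], so those of the limit vanish ([lim_exp_zero]); the
    quotient is block diagonal with inner blocks, and maximality of [M] makes
    it trivial.

    Both continuity statements truncate at a fixed depth, where adding and
    removing factors are continuous ([unstrip_lim], [strip_lim]). The rest is
    small uniformly: for [Phi] by the rests of the series ([Phi_rate]), for the
    inverse by the determinants at infinity of the tails, which depend
    continuously on the function and tend to one with the depth
    ([detA_tail]). *)

(** * Squared modulus *)

Section SquaredModulus.
Variable R : realType.
Local Notation C := R[i].

Definition sq (x : C) : R := complex.Re x ^+ 2 + complex.Im x ^+ 2.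

Lemma cmod_sq (x : C) : cmod x ^+ 2 = sq x.
Proof.
by case: x => a b; rewrite /cmod normc_def /sq /= sqr_sqrtr // addr_ge0 ?sqr_ge0.
Qed.

Lemma sq_ge0 (x : C) : 0 <= sq x.
Proof. by rewrite addr_ge0 ?sqr_ge0. Qed.

Lemma ReM (x y : C) : complex.Re (x * y) =
  complex.Re x * complex.Re y - complex.Im x * complex.Im y.
Proof. by case: x => a b; case: y. Qed.

Lemma ImM (x y : C) : complex.Im (x * y) =
  complex.Re x * complex.Im y + complex.Im x * complex.Re y.
Proof. by case: x => a b; case: y. Qed.

Lemma ReD (x y : C) : complex.Re (x + y) = complex.Re x + complex.Re y.
Proof. by case: x => a b; case: y. Qed.

Lemma ImD (x y : C) : complex.Im (x + y) = complex.Im x + complex.Im y.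
Proof. by case: x => a b; case: y. Qed.

Lemma ReN (x : C) : complex.Re (- x) = - complex.Re x.
Proof. by case: x. Qed.

Lemma ImN (x : C) : complex.Im (- x) = - complex.Im x.
Proof. by case: x. Qed.

Lemma conjcE (x : C) : x^* = Complex (complex.Re x) (- complex.Im x).
Proof. by case: x. Qed.

Lemma ReJ (x : C) : complex.Re x^* = complex.Re x.
Proof. by rewrite conjcE. Qed.

Lemma ImJ (x : C) : complex.Im x^* = - complex.Im x.
Proof. by rewrite conjcE. Qed.

Definition ReImE := (ReM, ImM, ReD, ImD, ReN, ImN, ReJ, ImJ).

Lemma complex_eq (x y : C) :
  complex.Re x = complex.Re y -> complex.Im x = complex.Im y -> x = y.
Proof. by case: x => a b; case: y => c d /= -> ->. Qed.

Lemma sqM (x y : C) : sq (x * y) = sq x * sq y.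
Proof. by rewrite /sq !ReImE; ring. Qed.

Lemma sqN (x : C) : sq (- x) = sq x.
Proof. by rewrite /sq !ReImE; ring. Qed.

Lemma sqJ (x : C) : sq x^* = sq x.
Proof. by rewrite /sq !ReImE; ring. Qed.

Lemma sq0 : sq 0 = 0.
Proof. by rewrite /sq /=; ring. Qed.

Lemma sq1 : sq 1 = 1.
Proof. by rewrite /sq /=; ring. Qed.

Lemma sq_real (x : R) : sq x%:C%C = x ^+ 2.
Proof. by rewrite /sq /=; ring. Qed.

Lemma sqD_le (x y : C) : sq (x + y) <= 2 * sq x + 2 * sq y.
Proof.
have : 0 <= sq (x - y) by exact: sq_ge0.
by rewrite /sq !ReImE => h; nra.
Qed.

Lemma sq_eq0 (x : C) : sq x = 0 -> x = 0.
Proof.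
case: x => a b; rewrite /sq /= => /eqP; rewrite paddr_eq0 ?sqr_ge0 // !sqrf_eq0.
by case/andP => /eqP -> /eqP ->.
Qed.

Lemma mulcJ (x : C) : x * x^* = (sq x)%:C%C.
Proof. by apply: complex_eq; rewrite !ReImE /= /sq; ring. Qed.

Lemma sq_norm (x : C) : (`|x| ^+ 2 = (sq x)%:C%C)%R.
Proof. by rewrite normCK mulcJ. Qed.

Lemma norm_cmod (x : C) : `|x| = (cmod x)%:C%C.
Proof. by rewrite /cmod normc_def. Qed.

Lemma Re_le_sq (x : C) : complex.Re x ^+ 2 <= sq x.
Proof. by rewrite lerDl sqr_ge0. Qed.

Lemma Im_le_sq (x : C) : complex.Im x ^+ 2 <= sq x.
Proof. by rewrite lerDr sqr_ge0. Qed.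

Lemma sqX (x : C) k : sq (x ^+ k) = sq x ^+ k.
Proof. by elim: k => [|k ih]; rewrite ?expr0 ?sq1 // !exprS sqM ih. Qed.

Lemma sq_circle (z : circle R) : sq (sval z) = 1.
Proof.
case: z => z /= /eqP h; apply: (@complexI R).
by rewrite -sq_norm h expr1n.
Qed.

Lemma circle_mulJ (z : circle R) : sval z * (sval z)^* = 1.
Proof. by rewrite mulcJ sq_circle. Qed.

Lemma circle_neq0 (z : circle R) : sval z != 0.
Proof.
by apply/eqP => h; have := sq_circle z; rewrite h sq0 => /esym/eqP; rewrite oner_eq0.
Qed.

Lemma circle_inv (z : circle R) : (sval z)^-1 = (sval z)^*.
Proof. by apply: (mulfI (circle_neq0 z)); rewrite circle_mulJ divff // circle_neq0. Qed.

Lemma Re_sum (I : Type) (s : seq I) (P : pred I) (F : I -> C) :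
  complex.Re (\sum_(i <- s | P i) F i) = \sum_(i <- s | P i) complex.Re (F i).
Proof. by elim/big_rec2: _ => //= i x y _ <-; rewrite ReD. Qed.

Lemma Im_sum (I : Type) (s : seq I) (P : pred I) (F : I -> C) :
  complex.Im (\sum_(i <- s | P i) F i) = \sum_(i <- s | P i) complex.Im (F i).
Proof. by elim/big_rec2: _ => //= i x y _ <-; rewrite ImD. Qed.

End SquaredModulus.

(** * Integration over the circle *)

Section CircleIntegral.
Variable R : realType.
Local Notation C := R[i].
Local Notation mu := (@lebesgue_measure R).
Implicit Types (h k : circle R -> R) (f g : circle R -> C).

Definition rmeas h : Prop :=
  @measurable_fun _ _ (measurableTypeR R) R (@I01 R) (fun t => h (cis t)).

Definition integ h : Prop := mu.-integrable (@I01 R) (fun t => (h (cis t))%:E).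

Definition mean h : R := fine (circle_int h).

Lemma mI01 : @measurable _ (measurableTypeR R) (@I01 R).
Proof. exact: measurable_itv. Qed.

Lemma mu_I01 : mu (@I01 R) = 1%E.
Proof. by rewrite /I01 lebesgue_measure_itv /= lte_fin ltr01 oppr0 adde0. Qed.

Lemma meanE h : mean h = (\int[mu]_(t in @I01 R) h (cis t)).
Proof. by []. Qed.

Lemma integ_rmeas h : integ h -> rmeas h.
Proof. by move/integrableP => [/measurable_EFinP]. Qed.

Lemma integ_cst (c : R) : integ (fun=> c).
Proof.
apply/integrableP; split; first exact: measurable_cst.
rewrite (integral_cst mu mI01) [X in (_ * X)%E](_ : _ = 1%E) ?mule1 ?ltry //.
exact: mu_I01.
Qed.

Lemma mean_cst (c : R) : mean (fun=> c) = c.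
Proof. rewrite meanE (Rintegral_cst mu mI01) [X in fine X](_ : _ = 1%E) ?mulr1 //.
exact: mu_I01. Qed.

Lemma integD h k : integ h -> integ k -> integ (fun z => h z + k z).
Proof.
move=> ih ik; have := integrableD mI01 ih ik.
by apply: eq_integrable => //; exact: mI01.
Qed.

Lemma meanD h k : integ h -> integ k -> mean (fun z => h z + k z) = mean h + mean k.
Proof. by move=> ih ik; exact: (RintegralD mI01). Qed.

Lemma integZ (c : R) h : integ h -> integ (fun z => c * h z).
Proof.
move=> ih; have := integrableZl mI01 c ih.
by apply: eq_integrable => //; exact: mI01.
Qed.

Lemma meanZ (c : R) h : integ h -> mean (fun z => c * h z) = c * mean h.
Proof. move=> ih; rewrite !meanE.
exact: (@RintegralZl _ _ _ mu _ (fun t => h (cis t)) c mI01 ih). Qed.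

Lemma integN h : integ h -> integ (fun z => - h z).
Proof.
by move=> /(integZ (-1)); congr integ; apply/funext => z; rewrite mulN1r.
Qed.

Lemma meanN h : integ h -> mean (fun z => - h z) = - mean h.
Proof.
move=> /(meanZ (-1)); rewrite mulN1r => <-.
by congr mean; apply/funext => z; rewrite mulN1r.
Qed.

Lemma integB h k : integ h -> integ k -> integ (fun z => h z - k z).
Proof. by move=> ih ik; apply: integD => //; exact: integN. Qed.

Lemma meanB h k : integ h -> integ k -> mean (fun z => h z - k z) = mean h - mean k.
Proof. by move=> ih ik; rewrite meanD ?meanN //; exact: integN. Qed.

Lemma mean_ge0 h : (forall z, 0 <= h z) -> 0 <= mean h.
Proof. by move=> h0; rewrite meanE; apply: Rintegral_ge0. Qed.

Lemma le_mean h k : integ h -> integ k -> (forall z, h z <= k z) -> mean h <= mean k.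
Proof. by move=> ih ik hk; rewrite !meanE; apply: le_Rintegral => //; exact: mI01. Qed.

Lemma integ_sum (I : Type) (s : seq I) (P : pred I) (F : I -> circle R -> R) :
  (forall i, P i -> integ (F i)) -> integ (fun z => \sum_(i <- s | P i) F i z).
Proof.
move=> iF; elim: s => [|i s ih].
  by under eq_fun do rewrite big_nil; exact: integ_cst.
under eq_fun do rewrite big_cons.
by case: (boolP (P i)) => // Pi; apply: integD => //; exact: iF.
Qed.

Lemma mean_sum (I : Type) (s : seq I) (P : pred I) (F : I -> circle R -> R) :
  (forall i, P i -> integ (F i)) ->
  mean (fun z => \sum_(i <- s | P i) F i z) = \sum_(i <- s | P i) mean (F i).
Proof.
move=> iF; elim: s => [|i s ih].
  by under eq_fun do rewrite big_nil; rewrite big_nil mean_cst.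
under eq_fun do rewrite big_cons; rewrite big_cons.
case: (boolP (P i)) => // Pi; rewrite meanD ?ih //; first exact: iF.
exact: integ_sum.
Qed.

Lemma integ_le h k : rmeas h -> (forall z, `|h z| <= k z) -> integ k -> integ h.
Proof.
move=> mh hk; apply: le_integrable; first exact: mI01.
  exact/measurable_EFinP.
by move=> t _ /=; rewrite lee_fin (le_trans (hk _)) // ler_norm.
Qed.

Lemma ge0_integ h : rmeas h -> (forall z, 0 <= h z) ->
  (circle_int h < +oo)%E -> integ h.
Proof.
move=> mh h0 fin; apply/integrableP; split; first exact/measurable_EFinP.
suff -> : (fun t => `|(h (cis t))%:E|)%E = (fun t => (h (cis t))%:E) by [].
by apply/funext => t /=; rewrite ger0_norm.
Qed.

Lemma circle_int_mean h : integ h -> circle_int h = (mean h)%:E.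
Proof.
move=> ih; rewrite /mean fineK // /circle_int.
exact: (integrable_fin_num mI01 ih).
Qed.

(** * Properties that hold almost everywhere *)

Lemma circle_aeT (P : circle R -> Prop) : (forall z, P z) -> circle_ae P.
Proof. by move=> h; apply: aeW => t _; exact: h. Qed.

Lemma circle_aeI (P Q S : circle R -> Prop) : circle_ae P -> circle_ae Q ->
  (forall z, P z -> Q z -> S z) -> circle_ae S.
Proof.
rewrite /circle_ae => hP hQ imp.
have [A [mA A0 sA]] := hP; have [B [mB B0 sB]] := hQ.
exists (A `|` B); split; [exact: measurableU | exact: null_set_setU |].
move=> t /= /not_implyP [It nS]; apply: contrapT => /not_orP [nA nB].
apply: nS; apply: imp; apply: contrapT => h.
  by apply: nA; apply: sA => /= /(_ It).
by apply: nB; apply: sB => /= /(_ It).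
Qed.

Lemma circle_aeS (P Q : circle R -> Prop) : circle_ae P ->
  (forall z, P z -> Q z) -> circle_ae Q.
Proof. by move=> hP imp; apply: (circle_aeI hP hP) => z pz _; exact: imp. Qed.

Lemma ae_equalS (T : Type) (f g : circle R -> T) (Q : circle R -> Prop) :
  ae_equal f g -> (forall z, f z = g z -> Q z) -> circle_ae Q.
Proof. exact: circle_aeS. Qed.

Lemma rmeas_EFin h : rmeas h ->
  @measurable_fun _ _ (measurableTypeR R) _ (@I01 R) (fun t => (h (cis t))%:E).
Proof. by move=> mh; apply/measurable_EFinP. Qed.

Lemma circle_ae_eq h k : circle_ae (fun z => h z = k z) ->
  ae_eq mu (@I01 R) (fun t => (h (cis t))%:E) (fun t => (k (cis t))%:E).
Proof.
move=> [N [mN N0 sN]]; exists N; split => // t /= nt; apply: sN => /= ht.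
by apply: nt => It; rewrite ht.
Qed.

Lemma mean_ae h k : rmeas h -> rmeas k -> circle_ae (fun z => h z = k z) ->
  mean h = mean k.
Proof.
move=> mh mk hk; congr fine; apply: ae_eq_integral; first exact: mI01.
- exact: rmeas_EFin.
- exact: rmeas_EFin.
- exact: circle_ae_eq.
Qed.

Lemma integ_ae h k : rmeas k -> circle_ae (fun z => h z = k z) ->
  integ h -> integ k.
Proof.
move=> mk hk ih; have mh := integ_rmeas ih.
move/integrableP: ih => [m1 fin]; apply/integrableP; split; first exact/measurable_EFinP.
apply: le_lt_trans fin; rewrite le_eqVlt; apply/orP; left; apply/eqP.
apply: ae_eq_integral; first exact: mI01.
- by apply: measurableT_comp => //; exact: rmeas_EFin.
- by apply: measurableT_comp => //; exact: rmeas_EFin.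
- have [N [mN N0 sN]] := hk; exists N; split => // t /= nt; apply: sN => /= ht.
  by apply: nt => It; rewrite ht.
Qed.

Lemma mean_eq0 h : integ h -> (forall z, 0 <= h z) -> mean h = 0 ->
  circle_ae (fun z => h z = 0).
Proof.
move=> ih h0 m0; have := circle_int_mean ih; rewrite m0 => i0.
have : (\int[mu]_(t in @I01 R) `|(h (cis t))%:E|)%E = 0%E.
  rewrite -[RHS]i0; apply: eq_integral => t _ /=; by rewrite ger0_norm.
move/(ae_eq_integral_abs _ mI01).
move/(_ (rmeas_EFin (integ_rmeas ih))) => [N [mN N0 sN]].
exists N; split => // t /= nt; apply: sN => /= ht.
by apply: nt => It; have [] := ht It.
Qed.

End CircleIntegral.

(** * Square-integrable functions on the circle *)

Section L2.
Variable R : realType.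
Local Notation C := R[i].
Implicit Types (f g : circle R -> C).

Lemma measD f g : circle_measurable f -> circle_measurable g ->
  circle_measurable (fun z => f z + g z).
Proof.
move=> [f1 f2] [g1 g2]; split.
  by under eq_fun do rewrite ReD; exact: measurable_funD.
by under eq_fun do rewrite ImD; exact: measurable_funD.
Qed.

Lemma measM f g : circle_measurable f -> circle_measurable g ->
  circle_measurable (fun z => f z * g z).
Proof.
move=> [f1 f2] [g1 g2]; split.
  by under eq_fun do rewrite ReM; apply: measurable_funB; exact: measurable_funM.
by under eq_fun do rewrite ImM; apply: measurable_funD; exact: measurable_funM.
Qed.

Lemma meas_cst (c : C) : circle_measurable (fun=> c).
Proof. by split; exact: measurable_cst. Qed.

Lemma measN f : circle_measurable f -> circle_measurable (fun z => - f z).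
Proof.
move=> mf; have := measM (meas_cst (-1)) mf.
by congr circle_measurable; apply/funext => z; rewrite mulN1r.
Qed.

Lemma measB f g : circle_measurable f -> circle_measurable g ->
  circle_measurable (fun z => f z - g z).
Proof. by move=> mf mg; apply: measD => //; exact: measN. Qed.

Lemma measJ f : circle_measurable f -> circle_measurable (fun z => (f z)^*).
Proof.
move=> [f1 f2]; split; first by under eq_fun do rewrite ReJ.
under eq_fun do rewrite ImJ.
have := measurable_funM (measurable_cst (-1 : R)) f2.
by congr measurable_fun; apply/funext => t /=; rewrite mulN1r.
Qed.

Lemma meas_sum (I : Type) (s : seq I) (P : pred I) (F : I -> circle R -> C) :
  (forall i, circle_measurable (F i)) ->
  circle_measurable (fun z => \sum_(i <- s | P i) F i z).
Proof.
move=> mF; elim: s => [|i s ih].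
  by under eq_fun do rewrite big_nil; exact: meas_cst.
under eq_fun do rewrite big_cons.
by case: (P i) => //; exact: measD.
Qed.

Lemma meas_id : circle_measurable (fun z : circle R => sval z).
Proof.
have cl : continuous (fun t : R => 2 * pi * t).
  by move=> t; apply: cvgM; [exact: cvg_cst | exact: cvg_id].
split; apply: measurable_funTS; apply: continuous_measurable_fun => t /=.
  by apply: (@continuous_comp _ _ _ (fun t : R => 2 * pi * t) (@cos R));
    [exact: cl | exact: continuous_cos].
by apply: (@continuous_comp _ _ _ (fun t : R => 2 * pi * t) (@sin R));
  [exact: cl | exact: continuous_sin].
Qed.

Lemma meas_exp f k : circle_measurable f -> circle_measurable (fun z => f z ^+ k).
Proof.
move=> mf; elim: k => [|k ih].
  by under eq_fun do rewrite expr0; exact: meas_cst.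
by under eq_fun do rewrite exprS; exact: measM.
Qed.

Lemma circle_exprz_neg (z : circle R) k :
  sval z ^ (- k%:Z) = (sval z ^+ k)^*.
Proof. by rewrite -exprnN -exprVn circle_inv rmorphXn. Qed.

Lemma sq_exprz (z : circle R) (k : int) : sq (sval z ^ k) = 1.
Proof.
case: (intP k) => [|n|n]; rewrite ?expr0z ?sq1 //.
  by rewrite -exprnP sqX sq_circle expr1n.
by rewrite circle_exprz_neg sqJ sqX sq_circle expr1n.
Qed.

Lemma meas_exprz (k : int) : circle_measurable (fun z : circle R => sval z ^ k).
Proof.
have h n : circle_measurable (fun z : circle R => sval z ^+ n).
  exact/meas_exp/meas_id.
case: (intP k) => [|n|n]; first exact: (h 0%N).
  exact: (h n.+1).
under eq_fun do rewrite circle_exprz_neg.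
exact/measJ/h.
Qed.

Lemma meas_horner (p : {poly C}) : circle_measurable (fun z : circle R => p.[sval z]).
Proof.
under eq_fun do rewrite horner_coef.
by apply: meas_sum => i; apply: measM; [exact: meas_cst | exact/meas_exp/meas_id].
Qed.

Lemma rmeas_sq f : circle_measurable f -> rmeas (fun z => sq (f z)).
Proof.
move=> [f1 f2]; rewrite /rmeas /sq.
have h (u : R -> R) : measurable_fun (@I01 R) u -> measurable_fun (@I01 R) (fun t => u t ^+ 2).
  by move=> mu; under eq_fun do rewrite expr2; exact: measurable_funM.
by apply: measurable_funD; exact: h.
Qed.

Definition L2 f := circle_measurable f /\ integ (fun z => sq (f z)).

(** The square of the norm of [L^2]. Squares are kept throughout, so that the
    triangle inequality reads [x <= 2 y + 2 z]. *)
Definition nrm2 f : R := mean (fun z => sq (f z)).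

Lemma L2_meas f : L2 f -> circle_measurable f.
Proof. by case. Qed.

Lemma nrm2_ge0 f : 0 <= nrm2 f.
Proof. by apply: mean_ge0 => z; exact: sq_ge0. Qed.

Lemma L2_bounded f (K : R) : circle_measurable f -> (forall z, sq (f z) <= K) -> L2 f.
Proof.
move=> mf fK; split => //; apply: (@integ_le _ _ (fun=> K)).
- exact: rmeas_sq.
- by move=> z; rewrite ger0_norm ?sq_ge0.
- exact: integ_cst.
Qed.

Lemma L2_ae_bounded f (K : R) : circle_measurable f ->
  circle_ae (fun z => sq (f z) <= K) -> L2 f.
Proof.
move=> mf fK; split => //; apply: (@integ_ae _ (fun z => Num.min (sq (f z)) K)).
- exact: rmeas_sq.
- by apply: (circle_aeS fK) => z /min_idPl.
- apply: (@integ_le _ _ (fun=> `|K|)); last exact: integ_cst.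
    apply: measurable_minr; [exact: rmeas_sq | exact: measurable_cst].
  move=> z; rewrite /Num.min; case: ifP => // /ltW h; rewrite ger0_norm ?sq_ge0 //.
  by rewrite (le_trans h) // ler_norm.
Qed.

Lemma L2M_bounded f g (K : R) : circle_measurable g ->
  (forall z, sq (g z) <= K) -> L2 f -> L2 (fun z => g z * f z).
Proof.
move=> mg gK [mf f2]; split; first exact: measM.
apply: (@integ_le _ _ (fun z => K * sq (f z))); last exact: integZ.
  by apply: rmeas_sq; exact: measM.
by move=> z; rewrite ger0_norm ?sq_ge0 // sqM ler_wpM2r ?sq_ge0.
Qed.

Lemma L2Z (c : C) f : L2 f -> L2 (fun z => c * f z).
Proof. by apply: (@L2M_bounded f (fun=> c) (sq c)) => //; exact: meas_cst. Qed.

Lemma L2_cst (c : C) : L2 (fun=> c).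
Proof. by apply: (@L2_bounded _ (sq c)) => //; exact: meas_cst. Qed.

Lemma L2D f g : L2 f -> L2 g -> L2 (fun z => f z + g z).
Proof.
move=> [mf f2] [mg g2]; split; first exact: measD.
apply: (@integ_le _ _ (fun z => 2 * sq (f z) + 2 * sq (g z))).
- by apply: rmeas_sq; exact: measD.
- by move=> z; rewrite ger0_norm ?sq_ge0 // sqD_le.
- by apply: integD; exact: integZ.
Qed.

Lemma L2N f : L2 f -> L2 (fun z => - f z).
Proof.
by move=> /(L2Z (-1)); congr L2; apply/funext => z; rewrite mulN1r.
Qed.

Lemma L2B f g : L2 f -> L2 g -> L2 (fun z => f z - g z).
Proof. by move=> hf hg; apply: L2D => //; exact: L2N. Qed.

Lemma L2J f : L2 f -> L2 (fun z => (f z)^*).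
Proof.
move=> [mf f2]; split; first exact: measJ.
by under eq_fun do rewrite sqJ.
Qed.

Lemma L2_sum (I : Type) (s : seq I) (P : pred I) (F : I -> circle R -> C) :
  (forall i, L2 (F i)) -> L2 (fun z => \sum_(i <- s | P i) F i z).
Proof.
move=> mF; elim: s => [|i s ih].
  by under eq_fun do rewrite big_nil; exact: L2_cst.
under eq_fun do rewrite big_cons.
by case: (P i) => //; exact: L2D.
Qed.

Lemma L2_exprz (k : int) : L2 (fun z : circle R => sval z ^ k).
Proof.
apply: (@L2_bounded _ 1); first exact: meas_exprz.
by move=> z; rewrite sq_exprz.
Qed.

Lemma L2M_exprz (k : int) f : L2 f -> L2 (fun z => sval z ^ k * f z).
Proof.
apply: (@L2M_bounded _ _ 1); first exact: meas_exprz.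
by move=> z; rewrite sq_exprz.
Qed.

Lemma L2_exp k : L2 (fun z : circle R => sval z ^+ k).
Proof. exact: (L2_exprz k). Qed.

Lemma horner_sq_le (p : {poly C}) : exists K : R, forall z : circle R, sq p.[sval z] <= K.
Proof.
elim/poly_ind: p => [|p c [K hK]].
  by exists 0 => z; rewrite horner0 sq0.
exists (2 * K + 2 * sq c) => z.
rewrite hornerMXaddC (le_trans (sqD_le _ _)) // lerD2r ler_wpM2l //.
by rewrite sqM sq_circle mulr1.
Qed.

Lemma L2_horner (p : {poly C}) : L2 (fun z : circle R => p.[sval z]).
Proof.
by have [K hK] := horner_sq_le p; apply: (L2_bounded _ hK); exact: meas_horner.
Qed.

Lemma nrm2D_le f g : L2 f -> L2 g ->
  nrm2 (fun z => f z + g z) <= 2 * nrm2 f + 2 * nrm2 g.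
Proof.
move=> hf hg; have [_ f2] := hf; have [_ g2] := hg; have [_ fg2] := L2D hf hg.
rewrite /nrm2 -!meanZ // -meanD; [|exact: integZ|exact: integZ].
apply: le_mean => //; first by apply: integD; exact: integZ.
by move=> z; exact: sqD_le.
Qed.

Lemma nrm2N f : nrm2 (fun z => - f z) = nrm2 f.
Proof. by rewrite /nrm2; under eq_fun do rewrite sqN. Qed.

Lemma nrm2J f : nrm2 (fun z => (f z)^*) = nrm2 f.
Proof. by rewrite /nrm2; under eq_fun do rewrite sqJ. Qed.

Lemma nrm2_exprz (k : int) f : nrm2 (fun z => sval z ^ k * f z) = nrm2 f.
Proof. by rewrite /nrm2; under eq_fun do rewrite sqM sq_exprz mul1r. Qed.

Lemma nrm2Z (c : C) f : L2 f -> nrm2 (fun z => c * f z) = sq c * nrm2 f.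
Proof.
by move=> [_ f2]; rewrite /nrm2 -meanZ //; under eq_fun do rewrite sqM.
Qed.

Lemma nrm2_eq0 f : L2 f -> nrm2 f = 0 -> ae_equal f (fun=> 0).
Proof.
move=> [mf f2] /(mean_eq0 f2) h; have {}h := h (fun z => sq_ge0 (f z)).
by apply: (circle_aeS h) => z /sq_eq0.
Qed.

Lemma nrm2_0 : nrm2 (fun=> 0) = 0.
Proof. by rewrite /nrm2 mean_cst sq0. Qed.

(** * Mean values of complex functions *)

Definition cinteg f := integ (fun z => complex.Re (f z)) /\ integ (fun z => complex.Im (f z)).

Definition cmean f : C :=
  Complex (mean (fun z => complex.Re (f z))) (mean (fun z => complex.Im (f z))).

Lemma L2M_cinteg f g : L2 f -> L2 g -> cinteg (fun z => f z * g z).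
Proof.
move=> [mf f2] [mg g2]; have [m1 m2] := measM mf mg.
have i2 : integ (fun z => sq (f z) + sq (g z)) by exact: integD.
have key (x y : C) : sq (x * y) <= (sq x + sq y) ^+ 2.
  rewrite sqM; have := sq_ge0 x; have := sq_ge0 y; nra.
have key2 (x y : R) : 0 <= y -> x ^+ 2 <= y ^+ 2 -> `|x| <= y.
  by move=> y0; rewrite -(real_normK (num_real x)) ler_sqr ?nnegrE.
split; apply: integ_le i2 => // z.
  apply: key2; first by rewrite addr_ge0 ?(sq_ge0 (f z)) ?(sq_ge0 (g z)).
  exact: le_trans (Re_le_sq _) (key _ _).
apply: key2; first by rewrite addr_ge0 ?(sq_ge0 (f z)) ?(sq_ge0 (g z)).
exact: le_trans (Im_le_sq _) (key _ _).
Qed.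

Lemma L2_cinteg f : L2 f -> cinteg f.
Proof.
move=> /(L2M_cinteg (L2_cst 1)); congr cinteg.
by apply/funext => z; rewrite mul1r.
Qed.

Lemma cmeanD f g : cinteg f -> cinteg g ->
  cmean (fun z => f z + g z) = cmean f + cmean g.
Proof.
move=> [f1 f2] [g1 g2]; apply: complex_eq; rewrite ReImE /= -meanD //.
  by congr mean; apply/funext => z; rewrite ReD.
by congr mean; apply/funext => z; rewrite ImD.
Qed.

Lemma cintegZ (c : C) f : cinteg f -> cinteg (fun z => c * f z).
Proof.
move=> [f1 f2]; split.
  by under eq_fun do rewrite ReM; apply: integB; exact: integZ.
by under eq_fun do rewrite ImM; apply: integD; exact: integZ.
Qed.

Lemma cmeanZ (c : C) f : cinteg f -> cmean (fun z => c * f z) = c * cmean f.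
Proof.
move=> [f1 f2]; apply: complex_eq; rewrite ReImE /= -!meanZ //.
  rewrite -meanB; [|exact: integZ|exact: integZ].
  by congr mean; apply/funext => z; rewrite ReM.
rewrite -meanD; [|exact: integZ|exact: integZ].
by congr mean; apply/funext => z; rewrite ImM.
Qed.

Lemma cmeanN f : cinteg f -> cmean (fun z => - f z) = - cmean f.
Proof.
move=> hf; rewrite -mulN1r -cmeanZ //.
by congr cmean; apply/funext => z; rewrite mulN1r.
Qed.

Lemma cintegN f : cinteg f -> cinteg (fun z => - f z).
Proof.
by move=> /(cintegZ (-1)); congr cinteg; apply/funext => z; rewrite mulN1r.
Qed.

Lemma cmeanB f g : cinteg f -> cinteg g ->
  cmean (fun z => f z - g z) = cmean f - cmean g.
Proof. by move=> hf hg; rewrite cmeanD ?cmeanN //; exact: cintegN. Qed.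

Lemma cmeanJ f : cinteg f -> cmean (fun z => (f z)^*) = (cmean f)^*.
Proof.
move=> [f1 f2]; apply: complex_eq; rewrite !ReImE /=.
  by congr mean; apply/funext => z; rewrite ReJ.
by rewrite -meanN //; congr mean; apply/funext => z; rewrite ImJ.
Qed.

Lemma cmean_cst (c : C) : cmean (fun=> c) = c.
Proof. by apply: complex_eq; rewrite /= mean_cst. Qed.

Lemma cmean_sum (I : Type) (s : seq I) (P : pred I) (F : I -> circle R -> C) :
  (forall i, cinteg (F i)) ->
  cmean (fun z => \sum_(i <- s | P i) F i z) = \sum_(i <- s | P i) cmean (F i).
Proof.
move=> iF; apply: complex_eq; rewrite ?Re_sum ?Im_sum /=.
  under eq_fun do rewrite Re_sum.
  by rewrite mean_sum // => i _; case: (iF i).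
under eq_fun do rewrite Im_sum.
by rewrite mean_sum // => i _; case: (iF i).
Qed.

Lemma cmean_ae f g : circle_measurable f -> circle_measurable g ->
  ae_equal f g -> cmean f = cmean g.
Proof.
move=> [f1 f2] [g1 g2] fg; apply: complex_eq; rewrite /=.
  by apply: mean_ae => //; apply: ae_equalS fg _ => z ->.
by apply: mean_ae => //; apply: ae_equalS fg _ => z ->.
Qed.

Lemma nrm2_expand f g (c : C) : L2 f -> L2 g ->
  nrm2 (fun z => f z - c * (g z)^*) =
  nrm2 f - 2 * complex.Re (c^* * cmean (fun z => f z * g z)) + sq c * nrm2 g.
Proof.
move=> hf hg; have [m1 f2] := hf; have [m2 g2] := hg.
have ifg := L2M_cinteg hf hg.
rewrite -cmeanZ // /nrm2 -!meanZ //; last by case: (cintegZ (c^*) ifg).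
rewrite -meanB //; last by apply: integZ; case: (cintegZ (c^*) ifg).
rewrite -meanD; last 1 first.
- exact: integZ.
- congr mean; apply/funext => z /=; rewrite /sq !ReImE; ring.
- by apply: integB => //; apply: integZ; case: (cintegZ (c^*) ifg).
Qed.

Lemma cauchy_schwarz f g : L2 f -> L2 g ->
  sq (cmean (fun z => f z * g z)) <= nrm2 f * nrm2 g.
Proof.
move=> hf hg; set c := cmean _.
(* The square of [f - t c g^*] is nonnegative; [t = 1 / nrm2 g] is optimal. *)
have h (t : R) : 0 <= nrm2 f - 2 * (t * sq c) + t ^+ 2 * sq c * nrm2 g.
  have := nrm2_ge0 (fun z => f z - (t%:C%C * c) * (g z)^*).
  rewrite nrm2_expand // -/c sqM sq_real.
  have -> : complex.Re ((t%:C%C * c)^* * c) = t * sq c.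
    by case: (c) => a b; rewrite !ReImE /= /sq /=; ring.
  by [].
have g0 := nrm2_ge0 g; have f0 := nrm2_ge0 f; have c0 := sq_ge0 c.
have [g00|gN0] := eqVneq (nrm2 g) 0.
  rewrite g00 mulr0 leNgt; apply/negP => cp.
  have := h ((nrm2 f + 1) / sq c); rewrite g00 mulr0 addr0.
  rewrite mulrAC -mulrA divff ?gt_eqF // mulr1; lra.
have gp : 0 < nrm2 g by rewrite lt_def gN0.
have := h (nrm2 g)^-1; rewrite expr2 => hh.
rewrite -ler_pdivrMr //.
have e : (nrm2 g)^-1 * (nrm2 g)^-1 * sq c * nrm2 g = sq c / nrm2 g.
  by field.
move: hh; rewrite e [(nrm2 g)^-1 * _]mulrC; lra.
Qed.

Lemma sq_cmean_le f : L2 f -> sq (cmean f) <= nrm2 f.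
Proof.
move=> hf; have := cauchy_schwarz hf (L2_cst 1).
rewrite {2}/nrm2 mean_cst sq1 mulr1.
by under eq_fun do rewrite mulr1.
Qed.

End L2.

(** * Mean values of trigonometric monomials *)

Section Fourier.
Variable R : realType.
Local Notation C := R[i].
Implicit Types (f g : circle R -> C).

Lemma cis_exp (t : R) k : sval (cis t) ^+ k =
  Complex (cos (2 * pi * k%:R * t)) (sin (2 * pi * k%:R * t)).
Proof.
elim: k => [|k ih]; first by rewrite expr0 mulr0 mul0r cos0 sin0.
rewrite exprS ih.
have -> : 2 * pi * k.+1%:R * t = 2 * pi * t + 2 * pi * k%:R * t.
  by rewrite -[k.+1%:R]natr1; ring.
by rewrite cosD sinD; apply: complex_eq; rewrite /=; ring.
Qed.

Lemma sin_period_nat k : sin (2 * pi * k%:R) = 0 :> R.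
Proof.
elim: k => [|k ih]; first by rewrite mulr0 sin0.
rewrite -[k.+1%:R]natr1 mulrDr mulr1 sinD ih mul0r add0r mulr_natl sin2pi mulr0 //.
Qed.

Lemma cos_period_nat k : cos (2 * pi * k%:R) = 1 :> R.
Proof.
elim: k => [|k ih]; first by rewrite mulr0 cos0.
by rewrite -[k.+1%:R]natr1 mulrDr mulr1 cosD ih mul1r mulr_natl cos2pi sin2pi mulr0 subr0.
Qed.

Lemma mean_FTC (h F : R -> R) : (forall t : R, is_derive t 1 F (h t)) ->
  (forall t : R, {for t, continuous h}) ->
  fine (\int[@lebesgue_measure R]_(t in @I01 R) (h t)%:E)%E = F 1 - F 0.
Proof.
move=> dF ch.
have cF t : {for t, continuous F}.
  by apply/differentiable_continuous/derivable1_diffP; case: (dF t).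
rewrite (@continuous_FTC2 _ h F) //.
- by apply: continuous_subspaceT => t; exact: ch.
- split.
  + by move=> t _; case: (dF t).
  + exact/cvg_at_right_filter/cF.
  + exact/cvg_at_left_filter/cF.
- by move=> t _; rewrite derive1E; case: (dF t).
Qed.

Lemma cmean_exp k : (0 < k)%N -> cmean (fun z : circle R => sval z ^+ k) = 0.
Proof.
move=> k0; set w : R := 2 * pi * k%:R.
have w0 : w != 0 by rewrite !mulf_neq0 ?pnatr_eq0 ?gt_eqF ?pi_gt0 // -lt0n.
have dw (t : R) : is_derive t 1 (fun t => w * t) w.
  by apply: (is_derive_eq (is_deriveZ w (is_derive_id t (1 : R^o)))); rewrite /GRing.scale /= mulr1.
have cw (t : R) : {for t, continuous (fun t => w * t)}.
  by apply: cvgM; [exact: cvg_cst | exact: cvg_id].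
have dS (t : R) : is_derive t 1 (fun t => w^-1 * sin (w * t)) (cos (w * t)).
  have d1 := @is_derive1_comp _ (@sin R) (fun t => w * t) t _ _ (is_derive_sin _) (dw t).
  apply: (is_derive_eq (is_deriveZ w^-1 d1)).
  by rewrite /GRing.scale /= mulrCA mulVf ?mulr1.
have dC (t : R) : is_derive t 1 (fun t => - w^-1 * cos (w * t)) (sin (w * t)).
  have d1 := @is_derive1_comp _ (@cos R) (fun t => w * t) t _ _ (is_derive_cos _) (dw t).
  apply: (is_derive_eq (is_deriveZ (- w^-1) d1)).
  by rewrite /GRing.scale /= mulrC -mulrA mulrN mulfV // mulrN1 opprK.
have cC (t : R) : {for t, continuous (fun t => cos (w * t))}.
  by apply: (@continuous_comp _ _ _ (fun t : R => w * t) (@cos R));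
    [exact: cw | exact: continuous_cos].
have cS (t : R) : {for t, continuous (fun t => sin (w * t))}.
  by apply: (@continuous_comp _ _ _ (fun t : R => w * t) (@sin R));
    [exact: cw | exact: continuous_sin].
apply: complex_eq; rewrite /= /mean /circle_int.
- under eq_integral do rewrite cis_exp /= -/w.
  by rewrite (mean_FTC dS cC) mulr1 mulr0 sin0 sin_period_nat subrr.
- under eq_integral do rewrite cis_exp /= -/w.
  by rewrite (mean_FTC dC cS) mulr1 mulr0 cos0 cos_period_nat subrr.
Qed.

Lemma cmean_exp_conj k m : (k < m)%N ->
  cmean (fun z : circle R => sval z ^+ k * (sval z ^+ m)^*) = 0.
Proof.
move=> km.
have -> : (fun z : circle R => sval z ^+ k * (sval z ^+ m)^*) =
          (fun z => (sval z ^+ (m - k))^*).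
  apply/funext => z; rewrite -{1}(subnKC (ltnW km)) exprD rmorphM mulrA mulcJ.
  by rewrite sqX sq_circle expr1n mul1r.
rewrite cmeanJ; last exact/L2_cinteg/L2_exp.
by rewrite cmean_exp ?subn_gt0 // rmorph0.
Qed.

(** The mean over the circle is the value at the origin. *)
Lemma cmean_horner (p : {poly C}) : cmean (fun z : circle R => p.[sval z]) = p.[0].
Proof.
have it (i : 'I_(size p)) : cinteg (fun z : circle R => p`_i * sval z ^+ i).
  exact/cintegZ/L2_cinteg/L2_exp.
under eq_fun do rewrite horner_coef.
rewrite cmean_sum // horner_coef0.
have [->|p0] := eqVneq p 0; first by rewrite big1 ?coef0 // => i _; rewrite cmeanZ ?coef0 ?mul0r //; exact/L2_cinteg/L2_exp.
have sp : (0 < size p)%N by rewrite size_poly_gt0.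
rewrite (bigD1 (Ordinal sp)) //= big1 => [|i i0].
  by under eq_fun do rewrite expr0 mulr1; rewrite cmean_cst addr0.
rewrite cmeanZ; last exact/L2_cinteg/L2_exp.
by rewrite cmean_exp ?mulr0 // lt0n; apply: contra i0 => /eqP i0; apply/eqP/val_inj.
Qed.

(** * The closure of the analytic polynomials *)

(** The Hardy space as a closed subspace of [L^2]; that it consists of the
    boundary values of the functions on the disc is proved further down. *)
Definition AH2 f := L2 f /\
  forall e : R, 0 < e -> exists p : {poly C}, nrm2 (fun z => f z - p.[sval z]) < e.

Lemma AH2_L2 f : AH2 f -> L2 f.
Proof. by case. Qed.

Lemma AH2_meas f : AH2 f -> circle_measurable f.
Proof. by case=> -[]. Qed.

Lemma AH2_cinteg f : AH2 f -> cinteg f.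
Proof. by move=> /AH2_L2; exact: L2_cinteg. Qed.

Lemma AH2_horner (p : {poly C}) : AH2 (fun z => p.[sval z]).
Proof.
split; first exact: L2_horner.
by move=> e e0; exists p; under eq_fun do rewrite subrr; rewrite nrm2_0.
Qed.

Lemma AH2_cst (c : C) : AH2 (fun=> c).
Proof.
have := AH2_horner c%:P; congr AH2; apply/funext => z; exact: hornerC.
Qed.

Lemma AH2_lim f : L2 f ->
  (forall e : R, 0 < e -> exists2 g, AH2 g & nrm2 (fun z => f z - g z) < e) -> AH2 f.
Proof.
move=> hf h; split => // e e0.
have e4 : 0 < e / 4 by rewrite divr_gt0.
have [g [hg gp] fg] := h _ e4.
have [p pe] := gp _ e4; exists p.
have := nrm2D_le (L2B hf hg) (L2B hg (L2_horner p)).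
under eq_fun do rewrite addrA subrK.
move=> /le_lt_trans; apply; lra.
Qed.

Lemma AH2D f g : AH2 f -> AH2 g -> AH2 (fun z => f z + g z).
Proof.
move=> [hf fp] [hg gp]; split; first exact: L2D.
move=> e e0; have e4 : 0 < e / 4 by rewrite divr_gt0.
have [p pe] := fp _ e4; have [q qe] := gp _ e4; exists (p + q).
have := nrm2D_le (L2B hf (L2_horner p)) (L2B hg (L2_horner q)).
have -> : (fun z : circle R => f z + g z - (p + q).[sval z]) =
  (fun z => f z - p.[sval z] + (g z - q.[sval z])).
  by apply/funext => z; rewrite hornerD; ring.
move=> /le_lt_trans; apply; lra.
Qed.

Lemma AH2Z (c : C) f : AH2 f -> AH2 (fun z => c * f z).
Proof.
move=> [hf fp]; split; first exact: L2Z.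
move=> e e0; have c1 : 0 < sq c + 1 by rewrite ltr_wpDl ?sq_ge0.
have [p pe] := fp _ (divr_gt0 e0 c1); exists (c *: p).
have -> : (fun z : circle R => c * f z - (c *: p).[sval z]) =
  (fun z => c * (f z - p.[sval z])).
  by apply/funext => z; rewrite hornerZ mulrBr.
rewrite nrm2Z; last exact: (L2B hf (L2_horner p)).
move: pe; rewrite ltr_pdivlMr // mulrDr mulr1 mulrC => pe.
apply: le_lt_trans pe; rewrite lerDl; exact: nrm2_ge0.
Qed.

Lemma AH2_sum (I : Type) (s : seq I) (P : pred I) (F : I -> circle R -> C) :
  (forall i, AH2 (F i)) -> AH2 (fun z => \sum_(i <- s | P i) F i z).
Proof.
move=> mF; elim: s => [|i s ih].
  by under eq_fun do rewrite big_nil; exact: AH2_cst.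
under eq_fun do rewrite big_cons.
by case: (P i) => //; exact: AH2D.
Qed.

Lemma AH2M_exp k f : AH2 f -> AH2 (fun z => sval z ^+ k * f z).
Proof.
move=> [hf fp]; split; first exact: (L2M_exprz k).
move=> e e0; have [p pe] := fp _ e0; exists ('X^k * p).
have -> : (fun z : circle R => sval z ^+ k * f z - ('X^k * p).[sval z]) =
  (fun z => sval z ^ k%:Z * (f z - p.[sval z])).
  by apply/funext => z; rewrite hornerM hornerXn -exprnP mulrBr.
by rewrite nrm2_exprz.
Qed.

(** A functional that is continuous on [L^2] and kills the polynomials kills
    their closure. *)
Lemma AH2_orth h f : L2 h ->
  (forall p : {poly C}, cmean (fun z => p.[sval z] * h z) = 0) ->
  AH2 f -> cmean (fun z => f z * h z) = 0.
Proof.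
move=> hh hp [hf fp]; apply: sq_eq0; apply/eqP; rewrite eq_le sq_ge0 andbT.
apply/ler_addgt0Pr => e e0; rewrite add0r.
have n1 : 0 < nrm2 h + 1 by rewrite ltr_wpDl ?nrm2_ge0.
have [p pe] := fp _ (divr_gt0 e0 n1).
have hfp := L2B hf (L2_horner p).
have -> : cmean (fun z => f z * h z) = cmean (fun z => (f z - p.[sval z]) * h z).
  under [in RHS]eq_fun do rewrite mulrBl.
  rewrite cmeanB ?hp ?subr0 //; apply: L2M_cinteg => //; exact: L2_horner.
apply: le_trans (cauchy_schwarz hfp hh) _.
move: pe; rewrite ltr_pdivlMr // mulrDr mulr1 => pe.
by apply: ltW; apply: le_lt_trans pe; rewrite lerDl nrm2_ge0.
Qed.

(** Evaluation at the origin is multiplicative; this turns products of functions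
    into products of means. *)
Lemma AH2_cmeanM f g : AH2 f -> AH2 g ->
  cmean (fun z => f z * g z) = cmean f * cmean g.
Proof.
move=> hf hg.
(* The polynomials multiply, and each factor is then replaced by its limit. *)
have step u (c : C) : L2 u -> (forall p : {poly C},
    cmean (fun z => p.[sval z] * u z) = p.[0] * c) ->
    forall v, AH2 v -> cmean (fun z => v z * u z) = cmean v * c.
  move=> hu hp v hv.
  have huc := L2B hu (L2_cst c).
  have iv := L2M_cinteg (AH2_L2 hv) hu.
  have e w : L2 w -> cmean (fun z => w z * (u z - c)) = cmean (fun z => w z * u z) - cmean w * c.
    move=> hw; under eq_fun do rewrite mulrBr [_ * c]mulrC.
    rewrite cmeanB ?cmeanZ ?[c * _]mulrC //; first exact: L2_cinteg.
      exact: L2M_cinteg.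
    exact/cintegZ/L2_cinteg.
  apply/eqP; rewrite -subr_eq0 -e; last exact: AH2_L2.
  apply/eqP/AH2_orth => // p.
  by rewrite e ?hp ?cmean_horner ?subrr //; exact: L2_horner.
apply: (@step) => //; first exact: AH2_L2.
move=> p; rewrite -cmean_horner.
under eq_fun do rewrite mulrC.
rewrite [RHS]mulrC; apply: (@step) => //; first exact: L2_horner.
by move=> q; rewrite cmean_horner -hornerM -cmean_horner; congr cmean; apply/funext => z; rewrite hornerM.
Qed.

Lemma cmean_exp_AH2 k f : (0 < k)%N -> AH2 f -> cmean (fun z => sval z ^+ k * f z) = 0.
Proof.
move=> k0 hf; rewrite (@AH2_cmeanM (fun z => sval z ^+ k)) ?cmean_exp ?mul0r //.
have := AH2_horner 'X^k; congr AH2; apply/funext => z; exact: hornerXn.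
Qed.

(** Division by [z] is possible exactly when the constant coefficient
    vanishes. *)
Lemma AH2_divz f : AH2 f -> cmean f = 0 -> AH2 (fun z => sval z ^ (-1) * f z).
Proof.
move=> [hf fp] f0; split; first exact: L2M_exprz.
move=> e e0; have e4 : 0 < e / 4 by rewrite divr_gt0.
have [p pe] := fp _ e4.
have hfp := L2B hf (L2_horner p).
have [q [c pE]] : exists q c, p = q * 'X + c%:P.
  by elim/poly_ind: (p) => [|q c _]; [exists 0, 0; rewrite mul0r add0r | exists q, c].
have ce : sq c <= nrm2 (fun z => f z - p.[sval z]).
  have <- : sq (cmean (fun z => f z - p.[sval z])) = sq c.
    rewrite cmeanB ?f0 ?cmean_horner ?pE ?hornerMXaddC ?mulr0 ?add0r ?sub0r ?sqN //.
      exact: L2_cinteg.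
    exact/L2_cinteg/L2_horner.
  exact: sq_cmean_le.
exists q.
have -> : (fun z : circle R => sval z ^ (-1) * f z - q.[sval z]) =
  (fun z => sval z ^ (-1) * (f z - p.[sval z] + c)).
  apply/funext => z; rewrite pE hornerMXaddC exprN1.
  by have z0 := circle_neq0 z; field.
rewrite nrm2_exprz; apply: le_lt_trans (nrm2D_le hfp (L2_cst c)) _.
rewrite {2}/nrm2 mean_cst; lra.
Qed.

End Fourier.

(** * Convergence of complex sequences *)

Section ComplexCvg.
Variable R : realType.
Local Notation C := R[i].

Lemma cvg0P (x : nat -> R) : (forall n, 0 <= x n) ->
  (x @ \oo --> (0 : R)) <->
  (forall e : R, 0 < e -> exists N, forall n, (N <= n)%N -> x n < e).
Proof.
move=> x0; split.
  move=> /cvgrPdist_lt h e e0; have [N _ hN] := h _ e0.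
  by exists N => n /hN /=; rewrite sub0r normrN ger0_norm.
move=> h; apply/cvgrPdist_lt => e /h [N hN].
by exists N => // n /= /hN; rewrite sub0r normrN ger0_norm.
Qed.

Lemma squeeze0 (x y : nat -> R) : (forall n, 0 <= x n) -> (forall n, x n <= y n) ->
  y @ \oo --> (0 : R) -> x @ \oo --> (0 : R).
Proof.
move=> x0 xy /cvg0P h; apply/(cvg0P x0) => e /h [|N hN].
  by move=> n; exact: le_trans (x0 n) (xy n).
by exists N => n /hN; apply: le_lt_trans.
Qed.

Lemma cvg_sumR (I : Type) (s : seq I) (P : pred I) (u : I -> nat -> R) (l : I -> R) :
  (forall i, u i @ \oo --> l i) ->
  (fun n => \sum_(i <- s | P i) u i n) @ \oo --> \sum_(i <- s | P i) l i.
Proof.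
move=> h; elim: s => [|i s ih].
  by under eq_fun do rewrite big_nil; rewrite big_nil; exact: cvg_cst.
under eq_fun do rewrite big_cons; rewrite big_cons.
by case: (P i) => //; exact: cvgD.
Qed.

(** Convergence stated through a nonnegative real sequence, to which the squeeze
    lemmas apply directly. *)
Definition ccvg (u : nat -> C) (l : C) :=
  (fun m => sq (u m - l)) @ \oo --> (0 : R).

Lemma ccvgP u l : ccvg u l <->
  ((fun m => complex.Re (u m)) @ \oo --> complex.Re l) /\
  ((fun m => complex.Im (u m)) @ \oo --> complex.Im l).
Proof.
have sc (v : nat -> R) : v @ \oo --> (0 : R) -> (fun m => v m ^+ 2) @ \oo --> (0 : R).
  move=> hv; rewrite (_ : (fun m => v m ^+ 2) = v \* v); last by apply/funext => m; rewrite expr2.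
  have h0 := cvgM hv hv.
  rewrite (mulr0 (0 : R)) in h0.
  exact: h0.
have cs (v : nat -> R) : (fun m => v m ^+ 2) @ \oo --> (0 : R) -> v @ \oo --> (0 : R).
  move=> /cvg0P h; apply/cvgrPdist_lt => e e0.
  have [|N hN] := h _ _ (exprn_gt0 2 e0); first by move=> n; exact: sqr_ge0.
  exists N => // n /= /hN; rewrite sub0r normrN -(real_normK (num_real (v n))).
  by rewrite ltr_pXn2r // nnegrE ltW.
split => [h|[h1 h2]].
  split; apply/subr_cvg0; apply: cs; apply: squeeze0 h => n; rewrite ?sqr_ge0 //.
    by rewrite -ReN -ReD Re_le_sq.
  by rewrite -ImN -ImD Im_le_sq.
rewrite /ccvg (_ : (fun m => sq (u m - l)) = fun m =>
  (complex.Re (u m) - complex.Re l) ^+ 2 + (complex.Im (u m) - complex.Im l) ^+ 2).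
  rewrite -[X in _ --> X]addr0; apply: cvgD; apply: sc; exact/subr_cvg0.
by apply/funext => m; rewrite /sq !ReImE.
Qed.

Lemma ccvg_e u l : ccvg u l <->
  (forall e : R, 0 < e -> exists N, forall n, (N <= n)%N -> sq (u n - l) < e).
Proof. by apply: cvg0P => n; exact: sq_ge0. Qed.

Lemma ccvg_cst (c : C) : ccvg (fun=> c) c.
Proof. by rewrite /ccvg; under eq_fun do rewrite subrr sq0; exact: cvg_cst. Qed.

Lemma ccvg_near u v l N : (forall n, (N <= n)%N -> u n = v n) -> ccvg u l -> ccvg v l.
Proof.
move=> uv /ccvg_e h; apply/ccvg_e => e /h [M hM]; exists (maxn N M) => n.
by rewrite geq_max => /andP [/uv <- /hM].
Qed.

Lemma ccvgD u v l k : ccvg u l -> ccvg v k -> ccvg (fun n => u n + v n) (l + k).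
Proof.
move=> /ccvgP [u1 u2] /ccvgP [v1 v2]; apply/ccvgP; rewrite !ReImE; split.
  by under eq_fun do rewrite ReD; exact: cvgD.
by under eq_fun do rewrite ImD; exact: cvgD.
Qed.

Lemma ccvgM u v l k : ccvg u l -> ccvg v k -> ccvg (fun n => u n * v n) (l * k).
Proof.
move=> /ccvgP [u1 u2] /ccvgP [v1 v2]; apply/ccvgP; rewrite !ReImE; split.
  by under eq_fun do rewrite ReM; apply: cvgB; exact: cvgM.
by under eq_fun do rewrite ImM; apply: cvgD; exact: cvgM.
Qed.

Lemma ccvgZ c u l : ccvg u l -> ccvg (fun n => c * u n) (c * l).
Proof. by apply: ccvgM; exact: ccvg_cst. Qed.

Lemma ccvgN u l : ccvg u l -> ccvg (fun n => - u n) (- l).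
Proof.
by move=> /(ccvgZ (-1)); rewrite mulN1r; under eq_fun do rewrite mulN1r.
Qed.

Lemma ccvgB u v l k : ccvg u l -> ccvg v k -> ccvg (fun n => u n - v n) (l - k).
Proof. by move=> hu hv; apply: ccvgD => //; exact: ccvgN. Qed.

Lemma ccvgJ u l : ccvg u l -> ccvg (fun n => (u n)^*) l^*.
Proof.
rewrite /ccvg (_ : (fun m => sq ((u m)^* - l^*)) = fun m => sq (u m - l)) //.
by apply/funext => m; rewrite -rmorphB sqJ.
Qed.

Lemma ccvg_sum (I : Type) (s : seq I) (P : pred I) (u : I -> nat -> C) (l : I -> C) :
  (forall i, ccvg (u i) (l i)) ->
  ccvg (fun n => \sum_(i <- s | P i) u i n) (\sum_(i <- s | P i) l i).
Proof.
move=> h; elim: s => [|i s ih].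
  by under eq_fun do rewrite big_nil; rewrite big_nil; exact: ccvg_cst.
under eq_fun do rewrite big_cons; rewrite big_cons.
by case: (P i) => //; exact: ccvgD.
Qed.

Lemma ccvg_prod (I : Type) (s : seq I) (P : pred I) (u : I -> nat -> C) (l : I -> C) :
  (forall i, ccvg (u i) (l i)) ->
  ccvg (fun n => \prod_(i <- s | P i) u i n) (\prod_(i <- s | P i) l i).
Proof.
move=> h; elim: s => [|i s ih].
  by under eq_fun do rewrite big_nil; rewrite big_nil; exact: ccvg_cst.
under eq_fun do rewrite big_cons; rewrite big_cons.
by case: (P i) => //; exact: ccvgM.
Qed.

Lemma ccvgV u l : l != 0 -> ccvg u l -> ccvg (fun n => (u n)^-1) l^-1.
Proof.
move=> l0 hu.
have inv (x : C) : x^-1 = (sq x)^-1%:C%C * x^*.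
  have [->|x0] := eqVneq x 0; first by rewrite invr0 rmorph0 mulr0.
  apply: (mulfI x0); rewrite divff // mulrCA mulcJ -rmorphM /= mulVf //.
  by apply: contra x0 => /eqP /sq_eq0 ->.
have sl0 : sq l != 0 by apply: contra l0 => /eqP /sq_eq0 ->.
rewrite inv (_ : (fun n => (u n)^-1) = fun n => ((sq (u n))^-1)%:C%C * (u n)^*).
  apply: ccvgM; last exact: ccvgJ.
  have /ccvgP [u1 u2] := hu.
  apply/ccvgP; split => /=; last exact: cvg_cst.
  apply: cvgV => //; rewrite /sq; apply: cvgD; exact: cvgM.
by apply/funext => n; rewrite inv.
Qed.

Lemma ccvg_unique u l k : ccvg u l -> ccvg u k -> l = k.
Proof.
move=> hl hk; apply/eqP; rewrite -subr_eq0; apply/eqP/sq_eq0.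
have := ccvgB hl hk; under eq_fun do rewrite subrr.
move=> /ccvg_e h; apply/eqP; rewrite eq_le sq_ge0 andbT; apply/ler_addgt0Pr => e e0.
have [N /(_ N (leqnn N))] := h _ e0.
by rewrite sub0r sqN add0r; exact: ltW.
Qed.

Lemma sqrt_pos_lt (x e : R) : 0 < e -> 0 <= x -> (x < Num.sqrt e) = (x ^+ 2 < e).
Proof.
move=> e0 x0; rewrite -{2}(sqr_sqrtr (ltW e0)) ltr_pXn2r // nnegrE // sqrtr_ge0.
Qed.

Lemma cmod_ge0 (x : C) : 0 <= cmod x.
Proof. by rewrite -(@ler0c R) -norm_cmod normr_ge0. Qed.

Lemma cvgC_ccvg (u : nat -> C) (l : C) :
  ((fun m => u m : C^o) @ \oo --> (l : C^o)) <-> ccvg u l.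
Proof.
split => [/cvgrPdist_lt h|/ccvg_e h].
  apply/ccvg_e => e e0.
  have e1 : 0 < (Num.sqrt e)%:C%C by rewrite -[0]/(0%:C%C) ltcR sqrtr_gt0.
  have [N _ hN] := h _ e1; exists N => n /hN /=.
  by rewrite distrC norm_cmod ltcR sqrt_pos_lt ?cmod_ge0 // cmod_sq.
apply/cvgrPdist_lt => /= -[a b]; rewrite ltcE /= => /andP [/eqP -> a0].
have [N hN] := h _ (exprn_gt0 2 a0).
exists N => // n /= /hN; rewrite distrC norm_cmod -cmod_sq => hh.
by rewrite ltcR -(ltr_pXn2r (ltn0Sn 1)) // nnegrE ?cmod_ge0 // ltW.
Qed.

Lemma cmodM (x y : C) : cmod (x * y) = cmod x * cmod y.
Proof. by apply: (@complexI R); rewrite rmorphM /= -!norm_cmod normrM. Qed.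

Lemma cmodD (x y : C) : cmod (x + y) <= cmod x + cmod y.
Proof. by rewrite -lecR rmorphD /= -!norm_cmod ler_normD. Qed.

Lemma cmod_real (x : R) : 0 <= x -> cmod x%:C%C = x.
Proof. by move=> x0; rewrite /cmod normc_def /= expr0n addr0 sqrtr_sqr ger0_norm. Qed.

Lemma cmodX (x : C) k : cmod (x ^+ k) = cmod x ^+ k.
Proof.
elim: k => [|k ih]; first by rewrite !expr0 -[1]/(1%:C%C) cmod_real.
by rewrite !exprS cmodM ih.
Qed.

Lemma cmod_circle (z : circle R) : cmod (sval z) = 1.
Proof. by case: z => z /= /eqP h; rewrite /cmod h. Qed.

Lemma cmod_le (x : C) (e : R) : 0 <= e -> (cmod x <= e) = (sq x <= e ^+ 2).
Proof. by move=> e0; rewrite -cmod_sq ler_pXn2r // nnegrE cmod_ge0. Qed.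

Lemma meas_ccvg (u : nat -> circle R -> C) (f : circle R -> C) :
  (forall n, circle_measurable (u n)) -> (forall z, ccvg (u ^~ z) (f z)) ->
  circle_measurable f.
Proof.
move=> mu uf; split.
  apply: (@measurable_fun_cvg _ (measurableTypeR R) R (@I01 R) (fun n t => complex.Re (u n (cis t)))).
    by move=> m; case: (mu m).
  by move=> t _; have /ccvgP [] := uf (cis t).
apply: (@measurable_fun_cvg _ (measurableTypeR R) R (@I01 R) (fun n t => complex.Im (u n (cis t)))).
  by move=> m; case: (mu m).
by move=> t _; have /ccvgP [] := uf (cis t).
Qed.

End ComplexCvg.

(** * Power series and boundary values *)

Section PowerSeries.
Variable R : realType.
Local Notation C := R[i].

Definition pseries_on_disc (a : nat -> C) (g : C -> C) :=
  forall w : C, cmod w < 1 -> ccvg (fun m => \sum_(k < m) a k * w ^+ k) (g w).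

Lemma analytic_disc_pseries g : analytic_disc g <-> exists a, pseries_on_disc a g.
Proof.
have e (w : C) : (`|w| < 1) = (cmod w < 1) by rewrite norm_cmod -[1]/(1%:C%C) ltcR.
split=> -[a h]; exists a => w w1.
  by apply/cvgC_ccvg/h; rewrite e.
by apply/cvgC_ccvg/h; rewrite -e.
Qed.

(** Comparison with a geometric series on a slightly larger circle. *)
Lemma pseries_unif a g (r : R) : pseries_on_disc a g -> 0 <= r < 1 ->
  forall e : R, 0 < e -> exists N, forall m, (N <= m)%N -> forall z : circle R,
    sq (g (r%:C%C * sval z) - \sum_(k < m) a k * (r%:C%C * sval z) ^+ k) <= e.
Proof.
move=> ag /andP [r0 r1] e e0.
(* The terms at [s] are bounded, so those at [r < s] decay like [(r / s)^k]. *)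
pose s := (1 + r) / 2; pose q := r / s.
have s0 : 0 < s by rewrite /s; lra.
have s1 : s < 1 by rewrite /s; lra.
have rs : r < s by rewrite /s; lra.
have q0 : 0 <= q by rewrite divr_ge0 // ltW.
have q1 : q < 1 by rewrite ltr_pdivrMr // mul1r.
have cs : cmod s%:C%C < 1 by rewrite cmod_real // ltW.
have /ccvg_e /(_ 1 ltr01) [N0 hN0] := ag _ cs.
have term k : (N0 <= k)%N -> cmod (a k * r%:C%C ^+ k) <= 2 * q ^+ k.
  move=> Nk; have h1 := hN0 _ Nk; have h2 := hN0 _ (leqW Nk).
  have : cmod (a k * s%:C%C ^+ k) <= 2.
    rewrite cmod_le //; move: h2; rewrite big_ord_recr /= => h2.
    set l := g _ in h1 h2; set u := \sum_(i < k) _ in h1 h2.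
    have -> : a k * s%:C%C ^+ k = (u + a k * s%:C%C ^+ k - l) + - (u - l) by ring.
    apply: le_trans (sqD_le _ _) _; rewrite sqN; lra.
  rewrite !cmodM !cmodX !cmod_real ?(ltW s0) // => h.
  rewrite /q expr_div_n mulrA ler_pdivlMr ?exprn_gt0 //.
  by rewrite mulrAC ler_wpM2r // exprn_ge0.
have diff (z : circle R) m l : (N0 <= m)%N -> (m <= l)%N ->
  (1 - q) * cmod (\sum_(k < l) a k * (r%:C%C * sval z) ^+ k -
        \sum_(k < m) a k * (r%:C%C * sval z) ^+ k) <= 2 * (q ^+ m - q ^+ l).
  move=> Nm; elim: l => [|l ih].
    by rewrite leqn0 => /eqP ->; rewrite !subrr mulr0 (@cmod_real _ 0) ?mulr0.
  rewrite leq_eqVlt => /predU1P [->|]; first by rewrite !subrr mulr0 (@cmod_real _ 0) ?mulr0.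
  rewrite ltnS => ml; have {}ih := ih ml.
  rewrite big_ord_recr /= addrAC.
  have tl : cmod (a l * (r%:C%C * sval z) ^+ l) <= 2 * q ^+ l.
    rewrite exprMn mulrA cmodM [cmod (sval z ^+ l)]cmodX cmod_circle expr1n mulr1.
    exact: term (leq_trans Nm ml).
  have q1' : 0 <= 1 - q by lra.
  have h1 := ler_wpM2l q1' (cmodD (\sum_(k < l) a k * (r%:C%C * sval z) ^+ k -
        \sum_(k < m) a k * (r%:C%C * sval z) ^+ k) (a l * (r%:C%C * sval z) ^+ l)).
  have h2 := ler_wpM2l q1' tl.
  apply: le_trans h1 _; rewrite mulrDr exprS; lra.
have qc : (fun m => q ^+ m) @ \oo --> (0 : R).
  by apply: cvg_expr; rewrite ger0_norm.
have d0 : 0 < Num.sqrt e * (1 - q) / 4.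
  by rewrite divr_gt0 // mulr_gt0 ?sqrtr_gt0 // subr_gt0.
have /cvg0P /(_ _ d0) [|N1 hN1] := qc; first by move=> n; exact: exprn_ge0.
exists (maxn N0 N1) => m; rewrite geq_max => /andP [Nm /hN1 qm] z.
have wz : cmod (r%:C%C * sval z) < 1.
  by rewrite cmodM cmod_real // cmod_circle mulr1.
have e4 : 0 < e / 4 by rewrite divr_gt0.
have /ccvg_e /(_ _ e4) [L hL] := ag _ wz.
have {}hL := hL _ (leq_maxl L m).
have := diff z m _ Nm (leq_maxr L m).
set Sl := \sum_(k < maxn L m) _ in hL *; set Sm := \sum_(k < m) _; set gw := g _ in hL *.
move=> h.
have hs : cmod (Sl - Sm) <= Num.sqrt e / 2.
  have qp : 0 < 1 - q by rewrite subr_gt0.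
  rewrite -(ler_pM2l qp); apply: le_trans h _.
  have := exprn_ge0 (maxn L m) q0; lra.
have hs2 : sq (Sl - Sm) <= e / 4.
  have <- : (Num.sqrt e / 2) ^+ 2 = e / 4.
    by rewrite exprMn sqr_sqrtr ?(ltW e0) // exprVn; congr (_ * _^-1); ring.
  by rewrite -cmod_le // divr_ge0 // sqrtr_ge0.
have -> : gw - Sm = - (Sl - gw) + (Sl - Sm) by ring.
apply: le_trans (sqD_le _ _) _; rewrite sqN; lra.
Qed.

Lemma pseries_partial (a : nat -> C) (r : R) m : {p : {poly C} |
  (forall z : circle R, p.[sval z] = \sum_(k < m) a k * (r%:C%C * sval z) ^+ k) &
  p.[0] = if m is 0 then 0 else a 0%N}.
Proof.
exists (\sum_(k < m) (a k * r%:C%C ^+ k) *: 'X^k) => [z|].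
  by rewrite horner_sum; apply: eq_bigr => k _; rewrite hornerZ hornerXn exprMn mulrA.
rewrite horner_sum; case: m => [|m]; first by rewrite big_ord0.
rewrite big_ord_recl big1 => [|k _]; rewrite hornerZ hornerXn.
  by rewrite !expr0 !mulr1 addr0.
by rewrite expr0n mulr0.
Qed.

Lemma pseries0 a g : pseries_on_disc a g -> g 0 = a 0%N.
Proof.
move=> ag; have h := ag 0; rewrite (@cmod_real _ 0) // ltr01 in h.
apply: ccvg_unique (h isT) _; apply: (@ccvg_near _ (fun=> a 0%N) _ _ 1%N); last exact: ccvg_cst.
case=> // n _; rewrite big_ord_recl expr0 mulr1 big1 ?addr0 // => k _.
by rewrite expr0n mulr0.
Qed.

Lemma pseries_L2 a g (r : R) : pseries_on_disc a g -> 0 <= r < 1 ->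
  L2 (fun z => g (r%:C%C * sval z)).
Proof.
move=> ag r01; have /andP [r0 r1] := r01.
have mg : circle_measurable (fun z => g (r%:C%C * sval z)).
  apply: (@meas_ccvg _ (fun m z => \sum_(k < m) a k * (r%:C%C * sval z) ^+ k)).
    move=> m; have [p hp _] := pseries_partial a r m.
    rewrite (_ : (fun z => _) = (fun z => p.[sval z])); first exact: meas_horner.
    by apply/funext => z; rewrite hp.
  by move=> z; apply: ag; rewrite cmodM cmod_real // cmod_circle mulr1.
have [N hN] := pseries_unif ag r01 ltr01.
have [p hp _] := pseries_partial a r N.
have [K hK] := horner_sq_le p.
apply: (@L2_bounded _ _ (2 * 1 + 2 * K)) => // z.
have -> : g (r%:C%C * sval z) = (g (r%:C%C * sval z) - p.[sval z]) + p.[sval z] by rewrite subrK.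
apply: le_trans (sqD_le _ _) _; apply: lerD; rewrite ler_wpM2l // {1}hp.
exact: hN.
Qed.

(** Some dilate of [g] is close to [f] in mean square, and the dilate is the
    uniform limit on the circle of its Taylor polynomials. *)
Lemma disc_extension_approx (f : circle R -> C) g : circle_measurable f ->
  disc_extension f g -> L2 f /\
  forall e : R, 0 < e -> exists2 p : {poly C}, p.[0] = g 0 &
    nrm2 (fun z => f z - p.[sval z]) < e.
Proof.
move=> mf [[/analytic_disc_pseries [a ag] _] bf].
have key e : 0 < e -> exists r : R, [/\ 0 <= r < 1, L2 (fun z => g (r%:C%C * sval z) - f z) &
    nrm2 (fun z => g (r%:C%C * sval z) - f z) < e].
  move=> e0.
  have lt0 : (0 < e%:E)%E by rewrite lte_fin.
  pose J (r : R) := circle_int (fun z => cmod (g (r%:C%C * sval z) - f z) ^+ 2).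
  have h : \forall r \near (1 : R)^'-, (J r < e%:E)%E.
    apply: (bf [set x : \bar R | (x < e%:E)%E]).
    by apply: open_nbhs_nbhs; split; [exact: open_ereal_lt_ereal | ].
  have h01 : \forall r \near (1 : R)^'-, 0 <= r < 1.
    near=> r; apply/andP; split; near: r; last exact: nbhs_left_lt.
    by apply: nbhs_left_ge; exact: ltr01.
  have [r [r01 hr]] := filter_ex (filterI h01 h).
  have mgr := measB (L2_meas (pseries_L2 ag r01)) mf.
  have E : (fun z => cmod (g (r%:C%C * sval z) - f z) ^+ 2) = (fun z => sq (g (r%:C%C * sval z) - f z)).
    by apply/funext => z; rewrite cmod_sq.
  rewrite /J E in hr.
  have iL : integ (fun z => sq (g (r%:C%C * sval z) - f z)).
    apply: ge0_integ => [|z|]; [exact: rmeas_sq | exact: sq_ge0 | exact: lt_trans hr (ltry _)].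
  exists r; split => //; by rewrite circle_int_mean // lte_fin in hr.
have hf : L2 f.
  have [r [r01 hr _]] := key _ ltr01.
  have := L2B (pseries_L2 ag r01) hr.
  by congr L2; apply/funext => z; rewrite opprB addrC subrK.
split => // e e0.
have e4 : 0 < e / 4 by rewrite divr_gt0.
have e8 : 0 < e / 8 by rewrite divr_gt0.
have [r [r01 hr re]] := key _ e4.
have [N hN] := pseries_unif ag r01 e8.
have {}hN := hN _ (leqnSn N).
have [p hp p0] := pseries_partial a r N.+1.
exists p; first by rewrite p0 (pseries0 ag).
have hgp : L2 (fun z => g (r%:C%C * sval z) - p.[sval z]) := L2B (pseries_L2 ag r01) (L2_horner p).
have -> : (fun z => f z - p.[sval z]) =
  (fun z => - (g (r%:C%C * sval z) - f z) + (g (r%:C%C * sval z) - p.[sval z])).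
  by apply/funext => z; ring.
apply: le_lt_trans (nrm2D_le (L2N hr) hgp) _; rewrite nrm2N.
have : nrm2 (fun z => g (r%:C%C * sval z) - p.[sval z]) <= e / 8.
  rewrite -[leRHS]mean_cst; apply: le_mean; [by case: hgp | exact: integ_cst |].
  by move=> z; rewrite hp.
lra.
Unshelve. all: by end_near. Qed.

End PowerSeries.

(** * The two descriptions of the Hardy space agree *)

Section Hardy.
Variable R : realType.
Local Notation C := R[i].
Implicit Types (f : circle R -> C) (a : nat -> C).

Definition fcoef f k : C := cmean (fun z => f z * (sval z ^+ k)^*).

Lemma L2_trig a m : L2 (fun z : circle R => \sum_(k < m) a k * sval z ^+ k).
Proof. by apply: L2_sum => k; exact/L2Z/L2_exp. Qed.

Lemma fcoef_trig a m : cmean (fun z : circle R =>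
  (\sum_(k < m) a k * sval z ^+ k) * (sval z ^+ m)^*) = 0.
Proof.
under eq_fun do rewrite mulr_suml.
rewrite cmean_sum => [|k]; last by apply: L2M_cinteg; [exact/L2Z/L2_exp | exact/L2J/L2_exp].
apply: big1 => k _; under eq_fun do rewrite -mulrA.
rewrite cmeanZ ?cmean_exp_conj ?mulr0 //.
by apply: L2M_cinteg; [exact/L2_exp | exact/L2J/L2_exp].
Qed.

Lemma nrm2_exp k : nrm2 (fun z : circle R => (sval z ^+ k)^*) = 1.
Proof.
rewrite /nrm2; under eq_fun do rewrite sqJ sqX sq_circle expr1n.
exact: mean_cst.
Qed.

Lemma nrm2_expand_exp f k (c : C) : L2 f ->
  nrm2 (fun z => f z - c * sval z ^+ k) =
  nrm2 f - 2 * complex.Re (c^* * fcoef f k) + sq c.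
Proof.
move=> hf; have := nrm2_expand c hf (L2J (L2_exp R k)); rewrite nrm2_exp mulr1 => <-.
by congr nrm2; apply/funext => z; rewrite conjCK.
Qed.

Lemma parseval_trig a m :
  nrm2 (fun z : circle R => \sum_(k < m) a k * sval z ^+ k) = \sum_(k < m) sq (a k).
Proof.
elim: m => [|m ih].
  by under eq_fun do rewrite big_ord0; rewrite big_ord0 nrm2_0.
rewrite big_ord_recr /= -ih; under eq_fun do rewrite big_ord_recr /= -[_ + _ * _]opprK opprD -mulNr opprD opprK.
have := @nrm2_expand_exp _ m (- a m) (L2_trig a m).
rewrite /fcoef fcoef_trig mulr0 mulr0 subr0 sqN => <-.
by congr nrm2; apply/funext => z; rewrite mulNr opprK opprD !opprK.
Qed.

Lemma bessel f m : L2 f ->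
  nrm2 (fun z => f z - \sum_(k < m) fcoef f k * sval z ^+ k) =
  nrm2 f - \sum_(k < m) sq (fcoef f k).
Proof.
move=> hf; elim: m => [|m ih].
  by rewrite big_ord0 subr0; under eq_fun do rewrite big_ord0 subr0.
have hs := L2B hf (L2_trig (fcoef f) m).
have -> : (fun z : circle R => f z - \sum_(k < m.+1) fcoef f k * sval z ^+ k) =
  (fun z => (f z - \sum_(k < m) fcoef f k * sval z ^+ k) - fcoef f m * sval z ^+ m).
  by apply/funext => z; rewrite big_ord_recr /= opprD addrA.
rewrite nrm2_expand_exp // ih.
have -> : fcoef (fun z => f z - \sum_(k < m) fcoef f k * sval z ^+ k) m = fcoef f m.
  rewrite {1}/fcoef; under eq_fun do rewrite mulrBl.
  rewrite cmeanB ?fcoef_trig ?subr0 //; apply: L2M_cinteg => //; [exact/L2J/L2_exp | exact: L2_trig | exact/L2J/L2_exp].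
by rewrite [_^* * _]mulrC mulcJ big_ord_recr /=; ring.
Qed.

Lemma bessel_le f m : L2 f -> \sum_(k < m) sq (fcoef f k) <= nrm2 f.
Proof. by move=> hf; have := bessel m hf; have := nrm2_ge0 (fun z => f z - \sum_(k < m) fcoef f k * sval z ^+ k); lra. Qed.

(** Parseval for a truncation of the series, whose coefficients are shrunk by
    powers of [r], and Bessel for [f]; the factor 2 pays for the truncation. *)
Lemma dilate_le f g (r : R) : L2 f -> pseries_on_disc (fcoef f) g -> 0 <= r < 1 ->
  nrm2 (fun z => g (r%:C%C * sval z)) <= 2 * nrm2 f.
Proof.
move=> hf ag r01; have /andP [r0 r1] := r01.
apply/ler_addgt0Pr => e e0.
have e2 : 0 < e / 2 by rewrite divr_gt0.
have [N hN] := pseries_unif ag r01 e2; have {}hN := hN _ (leqnn N).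
have hg := pseries_L2 ag r01.
have E (z : circle R) : \sum_(k < N) fcoef f k * (r%:C%C * sval z) ^+ k =
    \sum_(k < N) (fcoef f k * r%:C%C ^+ k) * sval z ^+ k.
  by apply: eq_bigr => k _; rewrite exprMn mulrA.
have ht := L2_trig (fun k => fcoef f k * r%:C%C ^+ k) N.
have hd := L2B hg ht.
have := nrm2D_le hd ht; under eq_fun do rewrite subrK.
move=> /le_trans; apply; rewrite addrC; apply: lerD; last first.
  have -> : e = 2 * (e / 2) by field.
  rewrite ler_wpM2l // -[leRHS]mean_cst.
  apply: le_mean; [by case: hd | exact: integ_cst | by move=> z; rewrite -E].
rewrite ler_wpM2l // (@parseval_trig (fun k => fcoef f k * r%:C%C ^+ k)).
apply: le_trans (bessel_le N hf); apply: ler_sum => k _.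
rewrite sqM sqX sq_real ler_piMr ?sq_ge0 // exprn_ile1 ?sqr_ge0 //.
by rewrite exprn_ile1 // ltW.
Qed.

Lemma bounded_pseries a (A : R) : (forall k, sq (a k) <= A) ->
  exists g, pseries_on_disc a g.
Proof.
move=> aA; have A0 : 0 <= A := le_trans (sq_ge0 _) (aA 0%N).
pose re w := fun k => complex.Re (a k * w ^+ k).
pose im w := fun k => complex.Im (a k * w ^+ k).
exists (fun w => Complex (limn (series (re w))) (limn (series (im w)))) => w w1.
have c0 := cmod_ge0 w.
have geo : cvgn (series (fun k => Num.sqrt A * cmod w ^+ k)).
  by apply: is_cvg_geometric_series; rewrite ger0_norm.
have bd k : cmod (a k * w ^+ k) <= Num.sqrt A * cmod w ^+ k.
  rewrite cmodM cmodX ler_wpM2r ?exprn_ge0 // cmod_le ?sqrtr_ge0 //.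
  by rewrite sqr_sqrtr.
have nle (x : C) (e : R) : cmod x <= e -> `|complex.Re x| <= e /\ `|complex.Im x| <= e.
  move=> xe; have e0 := le_trans (cmod_ge0 _) xe.
  move: xe; rewrite cmod_le // => xe.
  have key (y : R) : y ^+ 2 <= e ^+ 2 -> `|y| <= e.
    by rewrite -(real_normK (num_real y)) ler_pXn2r // nnegrE.
  by split; apply: key; apply: le_trans xe; [exact: Re_le_sq | exact: Im_le_sq].
have cv (u : nat -> R) : (forall k, `|u k| <= Num.sqrt A * cmod w ^+ k) -> cvgn (series u).
  by move=> hu; apply: normed_cvg; apply: series_le_cvg geo => k //=; rewrite ?mulr_ge0 ?sqrtr_ge0 ?exprn_ge0.
have cre : cvgn (series (re w)) by apply: cv => k; have [] := nle _ _ (bd k).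
have cim : cvgn (series (im w)) by apply: cv => k; have [] := nle _ _ (bd k).
apply/ccvgP; split.
  under eq_fun do rewrite Re_sum -(big_mkord xpredT (re w)).
  exact: cre.
under eq_fun do rewrite Im_sum -(big_mkord xpredT (im w)).
exact: cim.
Qed.

Lemma fcoef_le f k : L2 f -> sq (fcoef f k) <= nrm2 f.
Proof.
move=> hf; have := cauchy_schwarz hf (L2J (L2_exp R k)).
by rewrite nrm2_exp mulr1.
Qed.

Lemma fcoefB f g k : L2 f -> L2 g ->
  fcoef (fun z => f z - g z) k = fcoef f k - fcoef g k.
Proof.
move=> hf hg; rewrite /fcoef -cmeanB; last 2 first.
- exact/L2M_cinteg/L2J/L2_exp.
- exact/L2M_cinteg/L2J/L2_exp.
by congr cmean; apply/funext => z; rewrite mulrBl.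
Qed.

Lemma fcoef_horner (p : {poly C}) k : fcoef (fun z => p.[sval z]) k = p`_k.
Proof.
have h m (b : nat -> C) : (k < m)%N -> fcoef (fun z => \sum_(i < m) b i * sval z ^+ i) k = b k.
  move=> km; rewrite /fcoef; under eq_fun do rewrite mulr_suml.
  rewrite cmean_sum => [|i]; last by apply: L2M_cinteg; [exact/L2Z/L2_exp | exact/L2J/L2_exp].
  have L2e i : cinteg (fun z : circle R => sval z ^+ i * (sval z ^+ k)^*).
    by apply: L2M_cinteg; [exact/L2_exp | exact/L2J/L2_exp].
  rewrite (bigD1 (Ordinal km)) //= big1 => [|i ik].
    under eq_fun do rewrite -mulrA mulcJ sqX sq_circle expr1n mulr1.
    by rewrite cmean_cst addr0.
  under eq_fun do rewrite -mulrA; rewrite cmeanZ //.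
  have ik' : (i : nat) != k by [].
  case: (ltngtP i k) ik' => // ik' _; first by rewrite cmean_exp_conj ?mulr0.
  have -> : (fun z : circle R => sval z ^+ i * (sval z ^+ k)^*) =
      (fun z => (sval z ^+ k * (sval z ^+ i)^*)^*).
    by apply/funext => z; rewrite rmorphM /= conjCK mulrC.
  rewrite cmeanJ ?cmean_exp_conj ?rmorph0 ?mulr0 //.
  by apply: L2M_cinteg; [exact/L2_exp | exact/L2J/L2_exp].
have hc (z : circle R) : p.[sval z] = \sum_(i < maxn (size p) k.+1) p`_i * sval z ^+ i.
  by apply: horner_coef_wide; exact: leq_maxl.
have -> := funext hc.
by rewrite (@h _ (fun i => p`_i)) // leq_max ltnSn orbT.
Qed.

Lemma horner_dilate (p : {poly C}) : exists D : R, forall r, 0 <= r < 1 ->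
  nrm2 (fun z : circle R => p.[r%:C%C * sval z] - p.[sval z]) <= (1 - r) * D.
Proof.
exists (\sum_(k < size p) k%:R * sq (p`_k)) => r /andP [r0 r1].
have -> : (fun z : circle R => p.[r%:C%C * sval z] - p.[sval z]) =
  (fun z => \sum_(k < size p) (p`_k * (r ^+ k - 1)%:C%C) * sval z ^+ k).
  apply/funext => z; rewrite !horner_coef -sumrB; apply: eq_bigr => k _.
  by rewrite exprMn rmorphB rmorphXn /=; ring.
rewrite (@parseval_trig (fun k => p`_k * (r ^+ k - 1)%:C%C)) mulr_sumr.
apply: ler_sum => k _; rewrite sqM sq_real [leRHS]mulrA [leLHS]mulrC.
apply: ler_wpM2r; first exact: sq_ge0.
have h : 0 <= 1 - r ^+ k <= (1 - r) * k%:R.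
  elim: (k : nat) => [|j /andP [h1 h2]]; first by rewrite expr0 subrr mulr0 lexx.
  have := exprn_ge0 j r0; rewrite exprS -natr1 => h3; apply/andP; split; nra.
have := exprn_ge0 k r0; rewrite -sqrrN opprB expr2; case/andP: h => h1 h2 h3; nra.
Qed.

(** The Taylor coefficients of the extension are the Fourier coefficients of
    [f]. For convergence of the dilates, [f] is split into a polynomial, whose
    dilates converge by inspection, and a remainder that is small in mean
    square, and stays so after dilation uniformly in [r]. *)
Lemma AH2_H2 f : AH2 f -> H2 f.
Proof.
move=> [hf fp]; split; first exact: L2_meas.
have [g ag] := bounded_pseries (fun k => fcoef_le k hf).
have sqE (h : circle R -> C) : (fun z => cmod (h z) ^+ 2) = (fun z => sq (h z)).
  by apply/funext => z; rewrite cmod_sq.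
have iE (h : circle R -> C) : L2 h -> circle_int (fun z => cmod (h z) ^+ 2) = (nrm2 h)%:E.
  by move=> [_ hi]; rewrite sqE circle_int_mean.
exists g; split; first split.
- by apply/analytic_disc_pseries; exists (fcoef f).
- exists (2 * nrm2 f) => r r01; rewrite iE; last exact: pseries_L2 ag r01.
  by rewrite lee_fin; exact: dilate_le.
have gf (r : R) : 0 <= r < 1 -> L2 (fun z => g (r%:C%C * sval z) - f z).
  by move=> r01; apply: L2B => //; exact: pseries_L2 ag r01.
have main (e : R) : 0 < e -> exists2 d : R, 0 < d & forall r : R, 0 <= r < 1 -> 1 - d < r ->
    nrm2 (fun z => g (r%:C%C * sval z) - f z) < e.
  move=> e0; have e16 : 0 < e / 32 by rewrite divr_gt0.
  have [p pe] := fp _ e16; have [D hD] := horner_dilate p.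
  have D1 : 0 < `|D| + 1 by rewrite ltr_wpDl.
  exists (e / 32 / (`|D| + 1)); first by rewrite divr_gt0.
  move=> r r01 rd; have hfp := L2B hf (L2_horner p).
  have ag' : pseries_on_disc (fcoef (fun z => f z - p.[sval z])) (fun w => g w - p.[w]).
    move=> w w1; have := ag w w1.
    have hp : ccvg (fun m => \sum_(k < m) p`_k * w ^+ k) p.[w].
      apply: (@ccvg_near _ (fun=> p.[w]) _ _ (size p)); last exact: ccvg_cst.
      by move=> m pm; rewrite (horner_coef_wide _ pm).
    move=> hg; have := ccvgB hg hp; congr ccvg; apply/funext => m.
    rewrite -sumrB; apply: eq_bigr => k _.
    by rewrite fcoefB ?fcoef_horner ?mulrBl //; exact: L2_horner.
  have h1 := dilate_le hfp ag' r01.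
  have h2 := hD r r01.
  have l1 := pseries_L2 ag' r01.
  have l2 : L2 (fun z : circle R => p.[r%:C%C * sval z] - p.[sval z]).
    apply: L2B; last exact: L2_horner.
    have := L2_horner (p \Po (r%:C%C *: 'X)); congr L2; apply/funext => z.
    by rewrite horner_comp hornerZ hornerX.
  have := nrm2D_le (L2D l1 l2) (L2N hfp); rewrite nrm2N.
  have := nrm2D_le l1 l2.
  have -> : (fun z : circle R => g (r%:C%C * sval z) - p.[r%:C%C * sval z] +
      (p.[r%:C%C * sval z] - p.[sval z]) + - (f z - p.[sval z])) =
      (fun z => g (r%:C%C * sval z) - f z) by apply/funext => z; ring.
  have hr : (1 - r) * D < e / 32.
    have h3 : (1 - r) * (`|D| + 1) < e / 32 by rewrite -ltr_pdivlMr //; lra.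
    have h4 := ler_norm D; have /andP [h5 h6] := r01; nra.
  move=> h3 h4; lra.
rewrite /boundary_function.
apply: cvg_trans (_ : (nrm2 (fun z => g (r%:C%C * sval z) - f z))%:E @[r --> (1 : R)^'-] --> (0 : R)%:E).
  apply: near_eq_cvg; near=> r; rewrite iE //; apply: gf.
  apply/andP; split; near: r; last exact: nbhs_left_lt.
  by apply: nbhs_left_ge; exact: ltr01.
apply: cvg_EFin; first by near=> r.
apply/cvgrPdist_lt => e /main [d d0 hd].
near=> r; rewrite /= sub0r normrN ger0_norm ?nrm2_ge0 //; apply: hd.
  apply/andP; split; near: r; last exact: nbhs_left_lt.
  by apply: nbhs_left_ge; exact: ltr01.
near: r; apply: nbhs_left_gt; lra.
Unshelve. all: by end_near. Qed.

Lemma H2_AH2 f : H2 f -> AH2 f.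
Proof.
move=> [mf [g fg]]; have [hf h] := disc_extension_approx mf fg.
by split => // e /h [p _ pe]; exists p.
Qed.

Lemma H2P f : H2 f <-> AH2 f.
Proof. by split; [exact: H2_AH2 | exact: AH2_H2]. Qed.

(** Both sides are the limit of [p.[0]] along polynomials [p] that approximate
    [f]; in particular all extensions agree at the origin. *)
Lemma h2ext0 f : AH2 f -> h2ext f 0 = cmean f.
Proof.
move=> hf; have [mf [g0 fg0]] := AH2_H2 hf.
have : disc_extension f (h2ext f) by apply: (xgetPex (fun=> 0)); exists g0.
set g := h2ext f => fg; have [hL h] := disc_extension_approx mf fg.
apply/eqP; rewrite -subr_eq0; apply/eqP/sq_eq0/eqP; rewrite eq_le sq_ge0 andbT.
apply/ler_addgt0Pr => e e0; rewrite add0r.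
have [p p0 pe] := h _ e0.
rewrite -p0 -cmean_horner -sqN opprB -cmeanB; last 2 first.
- exact: L2_cinteg.
- exact/L2_cinteg/L2_horner.
apply: le_trans (ltW pe).
exact: sq_cmean_le (L2B hL (L2_horner p)).
Qed.

End Hardy.

(** * Matrix-valued functions in quadratic mean *)

Section HilbertSchmidt.
Variable R : realType.
Local Notation C := R[i].

(** The square of the Hilbert-Schmidt norm. *)
Definition hs2 p q (A : 'M[C]_(p, q)) : R := \sum_i \sum_j sq (A i j).

Lemma hsnorm2 p q (A : 'M[C]_(p, q)) : hsnorm A ^+ 2 = hs2 A.
Proof.
rewrite /hsnorm sqr_sqrtr; last by apply: sumr_ge0 => i _; apply: sumr_ge0 => j _; exact: sqr_ge0.
by apply: eq_bigr => i _; apply: eq_bigr => j _; exact: cmod_sq.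
Qed.

Lemma hs2_ge0 p q (A : 'M[C]_(p, q)) : 0 <= hs2 A.
Proof. by apply: sumr_ge0 => i _; apply: sumr_ge0 => j _; exact: sq_ge0. Qed.

Lemma sq_le_hs2 p q (A : 'M[C]_(p, q)) i j : sq (A i j) <= hs2 A.
Proof.
rewrite /hs2 (bigD1 i) //= (bigD1 j) //= -addrA lerDl addr_ge0 //.
  by apply: sumr_ge0 => k _; exact: sq_ge0.
by apply: sumr_ge0 => k _; apply: sumr_ge0 => l _; exact: sq_ge0.
Qed.

Lemma hs2_tr p q (A : 'M[C]_(p, q)) : (hs2 A)%:C%C = \tr (A *m A^t*).
Proof.
rewrite /hs2 rmorph_sum; apply: eq_bigr => i _; rewrite rmorph_sum mxE.
by apply: eq_bigr => j _; rewrite !mxE mulcJ.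
Qed.

Lemma trmxC_mul p q s (A : 'M[C]_(p, q)) (B : 'M[C]_(q, s)) :
  (A *m B)^t* = B^t* *m A^t*.
Proof. by rewrite trmx_mul map_mxM. Qed.

Lemma trmxCK p q (A : 'M[C]_(p, q)) : (A^t*)^t* = A.
Proof. by apply/matrixP => i j; rewrite !mxE conjCK. Qed.

Lemma trmxC1 p : (1%:M : 'M[C]_p)^t* = 1%:M.
Proof. by apply/matrixP => i j; rewrite !mxE eq_sym rmorph_nat. Qed.

Lemma unitaryE p (U : 'M[C]_p) : U \is unitarymx -> U *m U^t* = 1%:M.
Proof. by move/unitarymxP. Qed.

Lemma unitaryE' p (U : 'M[C]_p) : U \is unitarymx -> U^t* *m U = 1%:M.
Proof. by move/unitarymxP/mulmx1C. Qed.

Lemma unitary1 p : (1%:M : 'M[C]_p) \is unitarymx.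
Proof. by apply/unitarymxP; rewrite trmxC1 mulmx1. Qed.

Lemma hs2J p q (A : 'M[C]_(p, q)) : hs2 (A^t*) = hs2 A.
Proof.
rewrite /hs2 exchange_big; apply: eq_bigr => i _; apply: eq_bigr => j _.
by rewrite !mxE sqJ.
Qed.

Lemma hs2_mulr p q (A : 'M[C]_(p, q)) (U : 'M[C]_q) : U \is unitarymx ->
  hs2 (A *m U) = hs2 A.
Proof.
move=> uU; apply: (@complexI R); rewrite !hs2_tr trmxC_mul mulmxA -[A *m U *m _]mulmxA.
by rewrite unitaryE // mulmx1.
Qed.

Lemma hs2_mull p q (A : 'M[C]_(p, q)) (U : 'M[C]_p) : U \is unitarymx ->
  hs2 (U *m A) = hs2 A.
Proof.
move=> uU; rewrite -[LHS]hs2J trmxC_mul hs2_mulr; first exact: hs2J.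
by rewrite trmxC_unitary.
Qed.

Lemma hs2D_le p q (A B : 'M[C]_(p, q)) : hs2 (A + B) <= 2 * hs2 A + 2 * hs2 B.
Proof.
rewrite /hs2 !mulr_sumr -big_split; apply: ler_sum => i _.
rewrite !mulr_sumr -big_split; apply: ler_sum => j _.
by rewrite mxE sqD_le.
Qed.

Lemma hs2N p q (A : 'M[C]_(p, q)) : hs2 (- A) = hs2 A.
Proof. by apply: eq_bigr => i _; apply: eq_bigr => j _; rewrite mxE sqN. Qed.

Lemma hs2B_le p q (A B D : 'M[C]_(p, q)) : hs2 (A - D) <= 2 * hs2 (A - B) + 2 * hs2 (B - D).
Proof. by apply: le_trans (hs2D_le _ _); rewrite addrA subrK. Qed.

Lemma hs2_0 p q : hs2 (0 : 'M[C]_(p, q)) = 0.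
Proof. by apply: big1 => i _; apply: big1 => j _; rewrite mxE sq0. Qed.

Lemma hs2_eq0 p q (A : 'M[C]_(p, q)) : hs2 A = 0 -> A = 0.
Proof.
move=> A0; apply/matrixP => i j; rewrite mxE; apply: sq_eq0.
by apply/eqP; rewrite eq_le sq_ge0 andbT -A0 sq_le_hs2.
Qed.

Lemma hs2_le p q (A : 'M[C]_(p, q)) (K : R) : (forall i j, sq (A i j) <= K) ->
  hs2 A <= K * q%:R * p%:R.
Proof.
move=> AK; apply: le_trans (_ : \sum_(i < p) \sum_(j < q) K <= _).
  by apply: ler_sum => i _; apply: ler_sum => j _.
by rewrite sumr_const card_ord sumr_const card_ord -[K *+ q]mulr_natr -[X in X <= _]mulr_natr.
Qed.

Lemma sq_unitary_le1 p (U : 'M[C]_p) i j : U \is unitarymx -> sq (U i j) <= 1.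
Proof.
move=> /unitaryE /matrixP /(_ i i); rewrite !mxE eqxx => h.
have : (\sum_k sq (U i k))%:C%C = 1 :> C.
  by rewrite rmorph_sum -[RHS]h; apply: eq_bigr => k _; rewrite !mxE mulcJ.
move=> /complexI <-; rewrite (bigD1 j) //= lerDl.
by apply: sumr_ge0 => k _; exact: sq_ge0.
Qed.

(** * Mean values of matrix functions *)

Definition mnrm p q (M : circle R -> 'M[C]_(p, q)) : R := mean (fun z => hs2 (M z)).

Definition mL2 p q (M : circle R -> 'M[C]_(p, q)) := forall i j, L2 (fun z => M z i j).

Definition mmean p q (M : circle R -> 'M[C]_(p, q)) : 'M[C]_(p, q) :=
  \matrix_(i, j) cmean (fun z => M z i j).

Lemma rmeas_hs2 p q (M : circle R -> 'M[C]_(p, q)) :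
  mx_measurable M -> rmeas (fun z => hs2 (M z)).
Proof.
move=> mM; rewrite /rmeas /hs2.
apply: measurable_sum => i; apply: measurable_sum => j.
exact: rmeas_sq (mM i j).
Qed.

Lemma integ_hs2 p q (M : circle R -> 'M[C]_(p, q)) : mL2 M -> integ (fun z => hs2 (M z)).
Proof.
move=> hM; apply: integ_sum => i _; apply: integ_sum => j _.
by case: (hM i j).
Qed.

Lemma mL2_meas p q (M : circle R -> 'M[C]_(p, q)) : mL2 M -> mx_measurable M.
Proof. by move=> hM i j; exact: L2_meas. Qed.

Lemma mnrm_ge0 p q (M : circle R -> 'M[C]_(p, q)) : 0 <= mnrm M.
Proof. by apply: mean_ge0 => z; exact: hs2_ge0. Qed.

Lemma mmeasB p q (M N : circle R -> 'M[C]_(p, q)) : mx_measurable M -> mx_measurable N ->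
  mx_measurable (fun z => M z - N z).
Proof.
move=> hM hN i j; rewrite (_ : (fun z => (M z - N z) i j) = fun z => M z i j - N z i j).
  exact: measB.
by apply/funext => z; rewrite !mxE.
Qed.

Lemma mL2B p q (M N : circle R -> 'M[C]_(p, q)) : mL2 M -> mL2 N ->
  mL2 (fun z => M z - N z).
Proof.
move=> hM hN i j; rewrite (_ : (fun z => (M z - N z) i j) = fun z => M z i j - N z i j).
  exact: L2B.
by apply/funext => z; rewrite !mxE.
Qed.

Lemma mL2_cst p q (A : 'M[C]_(p, q)) : mL2 (fun=> A).
Proof. by move=> i j; exact: L2_cst. Qed.

Lemma mL2_unitary p (M : circle R -> 'M[C]_p) : mx_measurable M ->
  circle_ae (fun z => M z \is unitarymx) -> mL2 M.
Proof.
move=> mM uM i j; apply: (@L2_ae_bounded _ _ 1) => //.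
by apply: (circle_aeS uM) => z uz; exact: sq_unitary_le1.
Qed.

Lemma mnrmB_le p q (M N S : circle R -> 'M[C]_(p, q)) : mL2 M -> mL2 N -> mL2 S ->
  mnrm (fun z => M z - S z) <=
  2 * mnrm (fun z => M z - N z) + 2 * mnrm (fun z => N z - S z).
Proof.
move=> hM hN hS.
have h1 := integ_hs2 (mL2B hM hN); have h2 := integ_hs2 (mL2B hN hS).
rewrite /mnrm -(meanZ 2 h1) -(meanZ 2 h2) -(meanD (integZ 2 h1) (integZ 2 h2)).
apply: le_mean; first exact/integ_hs2/mL2B.
  exact: integD (integZ 2 h1) (integZ 2 h2).
by move=> z; exact: hs2B_le.
Qed.

Lemma mnrmC p q (M N : circle R -> 'M[C]_(p, q)) :
  mnrm (fun z => M z - N z) = mnrm (fun z => N z - M z).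
Proof. by congr mean; apply/funext => z; rewrite -hs2N opprB. Qed.

Lemma nrm2_le_mnrm p q (M : circle R -> 'M[C]_(p, q)) i j : mL2 M ->
  nrm2 (fun z => M z i j) <= mnrm M.
Proof.
move=> hM; apply: le_mean; [by case: (hM i j) | exact: integ_hs2 |].
by move=> z; exact: sq_le_hs2.
Qed.

Lemma mnrm_eq0 p q (M : circle R -> 'M[C]_(p, q)) : mL2 M -> mnrm M = 0 ->
  ae_equal M (fun=> 0).
Proof.
move=> hM /(mean_eq0 (integ_hs2 hM)) h; have {}h := h (fun z => hs2_ge0 (M z)).
by apply: (circle_aeS h) => z /hs2_eq0.
Qed.

Lemma mmean_ae p q (M N : circle R -> 'M[C]_(p, q)) : mx_measurable M ->
  mx_measurable N -> ae_equal M N -> mmean M = mmean N.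
Proof.
move=> mM mN MN; apply/matrixP => i j; rewrite !mxE; apply: cmean_ae => //.
by apply: ae_equalS MN _ => z ->.
Qed.

Lemma mmean_sub_le p q (M N : circle R -> 'M[C]_(p, q)) i j : mL2 M -> mL2 N ->
  sq (mmean M i j - mmean N i j) <= mnrm (fun z => M z - N z).
Proof.
move=> hM hN; rewrite !mxE -cmeanB; [|exact: L2_cinteg|exact: L2_cinteg].
have := sq_cmean_le (L2B (hM i j) (hN i j)).
move=> /le_trans; apply; apply: le_trans (nrm2_le_mnrm i j (mL2B hM hN)).
by rewrite le_eqVlt; apply/orP; left; apply/eqP; congr nrm2; apply/funext => z; rewrite !mxE.
Qed.

(** In the expansion of the square the quadratic term is constant, as
    [M M^* = 1]; so closeness to the identity in mean square can be tested on
    the diagonal of the mean. All quantitative bounds below rest on this. *)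
Lemma mnrm_sub1 p (M : circle R -> 'M[C]_p) : mL2 M ->
  circle_ae (fun z => M z \is unitarymx) ->
  mnrm (fun z => M z - 1%:M) = 2 * p%:R - 2 * complex.Re (\tr (mmean M)).
Proof.
move=> hM uM.
have itr : integ (fun z => complex.Re (\tr (M z))).
  under eq_fun do rewrite Re_sum.
  by apply: integ_sum => i _; case: (L2_cinteg (hM i i)).
have -> : complex.Re (\tr (mmean M)) = mean (fun z => complex.Re (\tr (M z))).
  rewrite Re_sum; under [in RHS]eq_fun do rewrite Re_sum.
  rewrite mean_sum => [|i _]; last by case: (L2_cinteg (hM i i)).
  by apply: eq_bigr => i _; rewrite mxE.
rewrite -meanZ // -{1}(mean_cst (2 * p%:R)) -meanB //; [|exact: integ_cst|exact: integZ].
apply: mean_ae.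
- by apply: rmeas_hs2; apply: mL2_meas; apply: mL2B => //; exact: mL2_cst.
- by apply: integ_rmeas; apply: integB; [exact: integ_cst | exact: integZ].
apply: (circle_aeS uM) => z uz.
apply: (@complexI R); rewrite hs2_tr.
have -> : (M z - 1%:M) *m (M z - 1%:M)^t* = M z *m (M z)^t* - M z - (M z)^t* + 1%:M.
  have -> : (M z - 1%:M)^t* = (M z)^t* - 1%:M.
    by apply/matrixP => i j; rewrite !mxE rmorphB /= [j == i]eq_sym rmorph_nat.
  by rewrite mulmxBl !mulmxBr !mulmx1 mul1mx opprB; rewrite addrA addrAC.
rewrite unitaryE // !linearD /= !linearN /= !mxtrace1.
have -> : \tr ((M z)^t*) = (\tr (M z) : C)^*.
  by rewrite /mxtrace rmorph_sum; apply: eq_bigr => i _; rewrite !mxE.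
by apply: complex_eq; rewrite !ReImE -(rmorph_nat (real_complex R)) /=; ring.
Qed.

End HilbertSchmidt.

(** * Completeness of bounded matrix functions in quadratic mean *)

Section Completeness.
Variable R : realType.
Local Notation C := R[i].
Local Notation mu := (@lebesgue_measure R).

Lemma geom_half_sum m : \sum_(k < m) (2^-1 : R) ^+ k <= 2.
Proof.
suff -> : \sum_(k < m) (2^-1 : R) ^+ k = 2 - 2 * 2^-1 ^+ m.
  by rewrite gerBl mulr_ge0 // exprn_ge0 // invr_ge0.
elim: m => [|m ih]; first by rewrite big_ord0 expr0 mulr1 subrr.
by rewrite big_ord_recr /= ih exprS; field.
Qed.

(** Monotone convergence: the integral of the weighted sum is at most
    [sum 2^-k], hence the sum is finite almost everywhere. *)
Lemma ae_summable (d : nat -> circle R -> R) :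
  (forall k, integ (d k)) -> (forall k z, 0 <= d k z) ->
  (forall k, mean (d k) <= (2^-1) ^+ k * (2^-1) ^+ k) ->
  circle_ae (fun z => exists B : R, forall m, \sum_(k < m) 2 ^+ k * d k z <= B).
Proof.
move=> di d0 dm.
pose u k t := (2 ^+ k * d k (cis t))%:E.
pose g t := (\sum_(0 <= k <oo) u k t)%E.
have u0 k t : (0 <= u k t)%E by rewrite lee_fin mulr_ge0 ?exprn_ge0.
have ui k : integ (fun z => 2 ^+ k * d k z) by exact: integZ.
have mu_ k : @measurable_fun _ _ (measurableTypeR R) _ (@I01 R) (u k).
  exact: (rmeas_EFin (integ_rmeas (ui k))).
have g0 t : (0 <= g t)%E by apply: nneseries_ge0.
have mg : @measurable_fun _ _ (measurableTypeR R) _ (@I01 R) g.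
  apply: (@ge0_emeasurable_sum _ (measurableTypeR R) R (@I01 R) u xpredT) => //.
have ig : mu.-integrable (@I01 R) g.
  apply/integrableP; split => //.
  rewrite (_ : (fun x => `|g x|)%E = g); last first.
    by apply/funext => t; rewrite gee0_abs.
  rewrite /g (integral_nneseries mu (@mI01 R)) //.
  apply: (@le_lt_trans _ _ (2 : R)%:E); last exact: ltry.
  apply: lime_le; first by apply: is_cvg_nneseries => n _ _; exact: integral_ge0.
  apply: nearW => m; rewrite (_ : (\sum_(0 <= i < m) _)%E = (\sum_(i < m) mean (fun z => 2 ^+ i * d i z))%:E).
    rewrite lee_fin; apply: le_trans (geom_half_sum m); apply: ler_sum => k _.
    rewrite meanZ // mulrC -ler_pdivlMr ?exprn_gt0 //.
    by apply: le_trans (dm k) _; rewrite exprVn.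
  rewrite big_mkord -sumEFin; apply: eq_bigr => i _.
  by rewrite -(circle_int_mean (ui i)).
have := integrable_ae (@mI01 R) ig.
move=> [N [mN N0 sN]]; exists N; split => // t /= nt; apply: sN => /= ht; apply: nt => It.
have := ht It; rewrite ge0_fin_numE // => fin.
exists (fine (g t)) => m; rewrite -lee_fin fineK ?ge0_fin_numE // -sumEFin.
rewrite -(big_mkord xpredT (fun k => u k t)).
exact: nneseries_lim_ge.
Qed.

Lemma abs_summable_cvg (x : nat -> R) (B : R) :
  (forall m, \sum_(k < m) `|x k.+1 - x k| <= B) -> cvgn x.
Proof.
move=> xB.
have cs : cvgn (series (telescope x)).
  apply: normed_cvg; apply: nondecreasing_is_cvgn.
    by apply: nondecreasing_series => k _ _; exact: normr_ge0.
  exists B => _ [m _ <-]; have := xB m.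
    by rewrite -(big_mkord xpredT (fun k => `|x k.+1 - x k|)).
have -> : x = (fun n => x 0%N + series (telescope x) n).
  by apply/funext => n; rewrite -eq_sum_telescope.
by apply: is_cvgD => //; exact: is_cvg_cst.
Qed.

Lemma fast_subsequence (e : nat -> R) (eps : nat -> R) : (forall k, 0 <= e k) ->
  e @ \oo --> (0 : R) -> (forall k, 0 < eps k) ->
  exists phi : nat -> nat, [/\ (forall k, (phi k <= phi k.+1)%N), (forall k, (k <= phi k)%N) &
    forall k, e (phi k) <= eps k].
Proof.
move=> e0 /cvg0P h ep.
have [n hn] := choice (fun k => h e0 _ (ep k)).
(* The partial sums increase, and exceed both [k] and [n k]. *)
exists (fun k => (\sum_(i < k.+1) (n i).+1)%N); split => k.
- by rewrite [leqRHS]big_ord_recr leq_addr.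
- by elim: k => // k ih; rewrite big_ord_recr /= addnS ltnS (leq_trans ih) // leq_addr.
- apply/ltW/hn; rewrite big_ord_recr /=; exact: leq_trans (leqnSn _) (leq_addl _ _).
Qed.

(** Riesz-Fischer for bounded matrix functions, with the almost everywhere
    convergent subsequence that carries pointwise identities to the limit. *)
Lemma mL2_complete p q (M_ : nat -> circle R -> 'M[C]_(p, q)) (e : nat -> R) :
  (forall k, mx_measurable (M_ k)) -> (forall k z i j, sq (M_ k z i j) <= 1) ->
  (forall k, 0 <= e k) -> e @ \oo --> (0 : R) ->
  (forall k l, (k <= l)%N -> mnrm (fun z => M_ k z - M_ l z) <= e k) ->
  exists M : circle R -> 'M[C]_(p, q), [/\ mL2 M,
    (fun k => mnrm (fun z => M_ k z - M z)) @ \oo --> (0 : R) &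
    exists phi : nat -> nat, circle_ae (fun z => forall i j, ccvg (fun k => M_ (phi k) z i j) (M z i j))].
Proof.
move=> mM M1 e0 ec Me.
have hM k : mL2 (M_ k).
  by move=> i j; apply: (@L2_bounded _ _ 1) => [|z]; [exact: mM | exact: M1].
have ep (k : nat) : 0 < (2^-1 : R) ^+ k * 2^-1 ^+ k by rewrite mulr_gt0 // exprn_gt0 // invr_gt0.
have [phi [phiS phik ephi]] := fast_subsequence e0 ec ep.
pose x k z i j := M_ (phi k) z i j.
pose d k z := hs2 (M_ (phi k) z - M_ (phi k.+1) z).
have di k : integ (d k) by apply: integ_hs2; exact: mL2B.
have dm k : mean (d k) <= (2^-1) ^+ k * (2^-1) ^+ k by apply: le_trans (ephi k); exact: Me.
have sumae := ae_summable di (fun k z => hs2_ge0 _) dm.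
have Rb (y : C) : sq y <= 1 -> `|complex.Re y| <= 1 /\ `|complex.Im y| <= 1.
  move=> y1.
  have key (t : R) : t ^+ 2 <= 1 -> `|t| <= 1.
    by rewrite -(real_normK (num_real t)) expr_le1.
  by split; apply: key; apply: le_trans y1; [exact: Re_le_sq | exact: Im_le_sq].
(* The limes superior is measurable and everywhere defined; almost everywhere
   it is the limit. *)
pose M z : 'M[C]_(p, q) := \matrix_(i, j)
  Complex (limn_sup (fun k => complex.Re (x k z i j))) (limn_sup (fun k => complex.Im (x k z i j))).
have ub (u : nat -> R) : (forall k, `|u k| <= 1) -> has_ubound (range u) /\ has_lbound (range u).
  move=> hu; split; [exists 1 | exists (-1)] => _ [k _ <-]; have := hu k; rewrite ler_norml => /andP [] //.
have mMl : mx_measurable M.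
  move=> i j; split.
    under eq_fun do rewrite mxE /=.
    apply: (@measurable_fun_limn_sup _ (measurableTypeR R)).
    - by move=> t _; apply: (ub _ _).1 => k; apply: (Rb _ _).1; exact: M1.
    - by move=> t _; apply: (ub _ _).2 => k; apply: (Rb _ _).1; exact: M1.
    - by move=> k; case: (mM (phi k) i j).
  under eq_fun do rewrite mxE /=.
  apply: (@measurable_fun_limn_sup _ (measurableTypeR R)).
  - by move=> t _; apply: (ub _ _).1 => k; apply: (Rb _ _).2; exact: M1.
  - by move=> t _; apply: (ub _ _).2 => k; apply: (Rb _ _).2; exact: M1.
  - by move=> k; case: (mM (phi k) i j).
have cvae : circle_ae (fun z => forall i j, ccvg (fun k => x k z i j) (M z i j)).
  apply: (circle_aeS sumae) => z [B hB] i j.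
  have bd k : sq (x k.+1 z i j - x k z i j) <= d k z.
    rewrite -sqN opprB; apply: le_trans (sq_le_hs2 _ i j); by rewrite !mxE.
  (* t <= 2^-k + 2^k t^2 turns square summability with weights into
     absolute summability. *)
  have am (t : R) k : t ^+ 2 <= d k z -> `|t| <= (2^-1) ^+ k + 2 ^+ k * d k z.
    move=> td; set a : R := 2^-1 ^+ k; set b : R := 2 ^+ k.
    have ab : a * b = 1 by rewrite /a /b -exprMn mulVf ?expr1n.
    have a0 : 0 < a by rewrite exprn_gt0 // invr_gt0.
    have b0 : 0 < b by rewrite exprn_gt0.
    have : b * `|t| ^+ 2 <= b * d k z by rewrite ler_pM2l // real_normK ?num_real.
    have h : 0 <= b * (`|t| - a) ^+ 2 by rewrite mulr_ge0 ?sqr_ge0 // ltW.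
    have h2 : b * (`|t| - a) ^+ 2 = b * `|t| ^+ 2 - 2 * `|t| * (a * b) + a * (a * b) by ring.
    rewrite h2 ab in h; have := normr_ge0 t; lra.
  have cv (f : C -> R) : (forall y1 y2, f (y1 - y2) = f y1 - f y2) -> (forall y, f y ^+ 2 <= sq y) ->
      (fun k => f (x k z i j)) @ \oo --> limn_sup (fun k => f (x k z i j)).
    move=> fB fs.
    have cx : cvgn (fun k => f (x k z i j)).
      apply: (@abs_summable_cvg _ (2 + B)) => m.
      apply: le_trans (_ : \sum_(k < m) ((2^-1) ^+ k + 2 ^+ k * d k z) <= _).
        by apply: ler_sum => k _; apply: am; rewrite -fB; apply: le_trans (fs _) (bd k).
      by rewrite big_split; exact: lerD (geom_half_sum m) (hB m).
    by rewrite (cvg_limn_supE cx).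
  apply/ccvgP; rewrite mxE /=; split; apply: cv.
  - by move=> y1 y2; rewrite ReD ReN.
  - exact: Re_le_sq.
  - by move=> y1 y2; rewrite ImD ImN.
  - exact: Im_le_sq.
have Mb : circle_ae (fun z => forall i j, sq (M z i j) <= 4).
  apply: (circle_aeS cvae) => z hz i j; have /ccvg_e /(_ 1 ltr01) [N hN] := hz i j.
  have := hN N (leqnn N); have := M1 (phi N) z i j.
  have := sqD_le (x N z i j) (- (x N z i j - M z i j)); rewrite sqN opprB addrC subrK /x.
  lra.
have hMl : mL2 M.
  move=> i j; apply: (@L2_ae_bounded _ _ 4) => //.
  by apply: (circle_aeS Mb) => z; exact.
exists M; split => //; last by exists phi.
have sub0 : (fun k => mnrm (fun z => M_ (phi k) z - M z)) @ \oo --> (0 : R).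
  pose K : R := 10 * q%:R * p%:R.
  have hd k : mL2 (fun z => M_ (phi k) z - M z) by exact: mL2B.
  pose f_ k t := (hs2 (M_ (phi k) (cis t) - M (cis t)))%:E.
  have mf k : @measurable_fun _ _ (measurableTypeR R) _ (@I01 R) (f_ k).
    exact: (rmeas_EFin (integ_rmeas (integ_hs2 (hd k)))).
  have c1 : {ae mu, forall t, I01 t -> f_ ^~ t @ \oo --> (cst 0)%E t}.
    move: cvae => [N [mN N0 sN]]; exists N; split => // t /= nt; apply: sN => /= ht; apply: nt => It.
    have {ht} hz := ht It; apply: cvg_EFin; first by apply: nearW.
    rewrite /= (_ : fine \o _ = (fun k => \sum_i \sum_j sq (M_ (phi k) (cis t) i j - M (cis t) i j))); last first.
      by apply/funext => k; apply: eq_bigr => i _; apply: eq_bigr => j _; rewrite !mxE.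
    rewrite -[X in _ --> X](@big1 R 0 +%R 'I_p (index_enum 'I_p) xpredT (fun=> 0)) //.
    apply: cvg_sumR => i.
    rewrite -[X in _ --> X](@big1 R 0 +%R 'I_q (index_enum 'I_q) xpredT (fun=> 0)) //.
    by apply: cvg_sumR => j; exact: hz.
  have c2 : {ae mu, forall t, forall k, I01 t -> (`|f_ k t| <= (cst K%:E) t)%E}.
    move: Mb => [N [mN N0 sN]]; exists N; split => // t /= nt; apply: sN => /= ht; apply: nt => k It.
    rewrite /= lee_fin ger0_norm ?hs2_ge0 //; apply: hs2_le => i j; rewrite !mxE.
    have := sqD_le (M_ (phi k) (cis t) i j) (- M (cis t) i j); rewrite sqN.
    have := ht It i j; have := M1 (phi k) (cis t) i j; rewrite !mxE /=; lra.
  have [_ _] := @dominated_convergence _ (measurableTypeR R) R mu (@I01 R) (@mI01 R) f_ (cst 0)%E (cst K%:E) mf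
    (measurable_cst _) c1 (integ_cst K) c2.
  rewrite integral0 => h.
  exact: (fine_cvg h).
apply/cvg0P => [k|eps eps0]; first exact: mnrm_ge0.
have e4 : 0 < eps / 4 by rewrite divr_gt0.
have [N1 hN1] := (cvg0P e0).1 ec _ e4.
have [N2 hN2] := (cvg0P (fun k => mnrm_ge0 _)).1 sub0 _ e4.
exists N1 => n Nn; pose m := maxn n N2.
have nm : (n <= phi m)%N by exact: leq_trans (leq_maxl _ _) (phik _).
apply: le_lt_trans (mnrmB_le (hM n) (hM (phi m)) hMl) _.
have := Me _ _ nm; have := hN1 _ Nn; have := hN2 _ (leq_maxr n N2 : (N2 <= m)%N); lra.
Qed.

End Completeness.

(** * Entrywise convergence of matrices *)

Section MatrixCvg.
Variable R : realType.
Local Notation C := R[i].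

Definition mcvg p q (A_ : nat -> 'M[C]_(p, q)) (A : 'M[C]_(p, q)) :=
  forall i j, ccvg (fun m => A_ m i j) (A i j).

Lemma subr_mxE p q (A B : 'M[C]_(p, q)) i j : (A - B) i j = A i j - B i j.
Proof. by rewrite !mxE. Qed.

Lemma trmxCE p q (A : 'M[C]_(p, q)) i j : (A^t*) i j = (A j i)^*.
Proof. by rewrite !mxE. Qed.

Lemma mcvg_cst p q (A : 'M[C]_(p, q)) : mcvg (fun=> A) A.
Proof. by move=> i j; exact: ccvg_cst. Qed.

Lemma mcvgM p q s (A_ : nat -> 'M[C]_(p, q)) (A : 'M[C]_(p, q))
    (B_ : nat -> 'M[C]_(q, s)) (B : 'M[C]_(q, s)) :
  mcvg A_ A -> mcvg B_ B -> mcvg (fun m => A_ m *m B_ m) (A *m B).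
Proof.
move=> hA hB i j; under eq_fun do rewrite mxE; rewrite mxE.
by apply: ccvg_sum => k; exact: ccvgM.
Qed.

Lemma mcvgD p q (A_ B_ : nat -> 'M[C]_(p, q)) (A B : 'M[C]_(p, q)) :
  mcvg A_ A -> mcvg B_ B -> mcvg (fun m => A_ m + B_ m) (A + B).
Proof. by move=> hA hB i j; under eq_fun do rewrite mxE; rewrite mxE; exact: ccvgD. Qed.

Lemma mcvgB p q (A_ B_ : nat -> 'M[C]_(p, q)) (A B : 'M[C]_(p, q)) :
  mcvg A_ A -> mcvg B_ B -> mcvg (fun m => A_ m - B_ m) (A - B).
Proof.
move=> hA hB i j; rewrite (_ : (fun m => (A_ m - B_ m) i j) = fun m => A_ m i j - B_ m i j).
  by rewrite !mxE; exact: ccvgB.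
by apply/funext => m; rewrite !mxE.
Qed.

Lemma mcvgJ p q (A_ : nat -> 'M[C]_(p, q)) (A : 'M[C]_(p, q)) : mcvg A_ A ->
  mcvg (fun m => (A_ m)^t*) (A^t*).
Proof.
move=> hA i j; rewrite (_ : (fun m => _) = fun m => (A_ m j i : C)^*).
  by rewrite !mxE; exact: ccvgJ.
by apply/funext => m; rewrite !mxE.
Qed.

Lemma mcvg_det p (A_ : nat -> 'M[C]_p) (A : 'M[C]_p) : mcvg A_ A ->
  ccvg (fun m => \det (A_ m)) (\det A).
Proof.
move=> hA; rewrite /determinant; apply: ccvg_sum => s; apply: ccvgZ.
by apply: ccvg_prod => i.
Qed.

Lemma mcvg_inv p (A_ : nat -> 'M[C]_p) (A : 'M[C]_p) : (forall m, A_ m \in unitmx) ->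
  A \in unitmx -> mcvg A_ A -> mcvg (fun m => invmx (A_ m)) (invmx A).
Proof.
move=> uA_ uA hA i j; rewrite /invmx uA.
rewrite (_ : (fun m => _) = fun m => (\det (A_ m))^-1 * cofactor (A_ m) j i); last first.
  by apply/funext => m; rewrite uA_ !mxE.
rewrite !mxE; apply: ccvgM.
  by apply: ccvgV (mcvg_det hA); rewrite -unitfE -unitmxE.
apply: ccvgZ; apply: mcvg_det => k l.
rewrite (_ : (fun m => _) = fun m => A_ m (lift j k) (lift i l)); last first.
  by apply/funext => m; rewrite !mxE.
by rewrite !mxE.
Qed.

Lemma ccvg0_bounded (u v : nat -> C) (K : R) : ccvg u 0 ->
  (forall m, sq (v m) <= K) -> ccvg (fun m => u m * v m) 0.
Proof.
move=> /ccvg_e hu vK; have K0 : 0 <= K := le_trans (sq_ge0 _) (vK 0%N).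
have K1 : 0 < K + 1 by rewrite ltr_wpDl.
apply/ccvg_e => e e0; have [N hN] := hu _ (divr_gt0 e0 K1).
exists N => m /hN; rewrite !subr0 sqM ltr_pdivlMr // => h.
apply: le_lt_trans h; apply: ler_wpM2l; first exact: sq_ge0.
by apply: le_trans (vK m) _; rewrite lerDl.
Qed.

End MatrixCvg.

(** * Triangular matrices with positive diagonal *)

Section Triangular.
Variable R : realType.
Local Notation C := R[i].
Variable n : nat.
Implicit Types (A B P : 'M[C]_n) (b : bool).

Lemma pos_complex (x : C) : (0 < x) = (complex.Im x == 0) && (0 < complex.Re x).
Proof. by rewrite ltcE. Qed.

Lemma pos_realE (x : C) : 0 < x -> x = (complex.Re x)%:C%C.
Proof. by rewrite pos_complex => /andP [/eqP h _]; apply: complex_eq; rewrite //= h. Qed.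

Lemma pos_Re (x : C) : 0 < x -> 0 < complex.Re x.
Proof. by rewrite pos_complex => /andP []. Qed.

Lemma pos_conj (x : C) : 0 < x -> x^* = x.
Proof. by move=> /pos_realE ->; apply: complex_eq; rewrite !ReImE //= oppr0. Qed.

(** The positions where a matrix of the given triangular type vanishes. *)
Definition off b (i j : 'I_n) : bool := if b then (i < j)%N else (j < i)%N.

Lemma offN b i j : off (~~ b) i j = off b j i.
Proof. by case: b. Qed.

Lemma off_neq b i j : i != j -> ~~ off b i j -> off (~~ b) i j.
Proof.
move=> ij; have : (i : nat) != j by [].
by case: b => /=; case: ltngtP.
Qed.

Lemma triGP b A :
  triG b A <-> (forall i j, off b i j -> A i j = 0) /\ (forall i, 0 < A i i).
Proof.
case: b; split => -[h1 h2]; split => //.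
- by move=> i j; move/is_trig_mxP: h1; apply.
- by apply/is_trig_mxP.
- by move=> i j ij; move/is_trig_mxP: h1 => /(_ j i ij); rewrite mxE.
- by apply/is_trig_mxP => i j ij; rewrite mxE; apply: h1.
Qed.

Lemma triG_diag b A i : triG b A -> 0 < A i i.
Proof. by case/triGP. Qed.

Lemma triG_diag_mul b A B i : triG b A -> triG b B -> (A *m B) i i = A i i * B i i.
Proof.
move=> /triGP [A0 _] /triGP [B0 _]; rewrite mxE (bigD1 i) //= big1 ?addr0 // => k ki.
have [/A0 ->|] := boolP (off b i k); first by rewrite mul0r.
move=> /(off_neq (b := b)); rewrite eq_sym => /(_ ki); rewrite offN => /B0 ->.
by rewrite mulr0.
Qed.

Lemma triG_mul b A B : triG b A -> triG b B -> triG b (A *m B).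
Proof.
move=> tA tB; apply/triGP; split=> [i j ij|i]; last first.
  by rewrite (triG_diag_mul i tA tB) mulr_gt0 //; [exact: triG_diag tA | exact: triG_diag tB].
have [A0 _] := (triGP _ _).1 tA; have [B0 _] := (triGP _ _).1 tB.
rewrite mxE big1 // => k _.
have [/A0 ->|nik] := boolP (off b i k); first by rewrite mul0r.
rewrite B0 ?mulr0 //; move: nik ij; case: (b) => /=; rewrite -leqNgt.
  by move=> ki ij; exact: leq_ltn_trans ki ij.
by move=> ik ji; exact: leq_trans ji ik.
Qed.

Lemma triG1 b : triG b (1%:M : 'M[C]_n).
Proof.
apply/triGP; split=> [i j ij|i]; rewrite mxE ?eqxx ?ltr01 //.
by case: eqP ij => // ->; case: b; rewrite /= ltnn.
Qed.

Lemma triG_tr b A : triG (~~ b) A^T <-> triG b A.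
Proof.
split=> /triGP [h1 h2]; apply/triGP; split.
- by move=> i j ij; have := h1 j i; rewrite mxE offN; apply.
- by move=> i; have := h2 i; rewrite mxE.
- by move=> i j; rewrite offN mxE => /h1.
- by move=> i; rewrite mxE.
Qed.

Lemma triG_J b A : triG b A -> triG (~~ b) (A^t*).
Proof.
move=> /triGP [h1 h2]; apply/triGP; split=> [i j|i]; rewrite !mxE.
  by rewrite offN => /h1 ->; rewrite rmorph0.
by rewrite pos_conj.
Qed.

Lemma triG_det b A : triG b A -> \det A = \prod_i A i i.
Proof.
case: b => -[/det_trig h _]; first by rewrite h.
by rewrite -det_tr h; apply: eq_bigr => i _; rewrite mxE.
Qed.

Lemma triG_det_gt0 b A : triG b A -> 0 < \det A.
Proof.
by move=> tA; rewrite (triG_det tA); apply: prodr_gt0 => i _; exact: triG_diag tA.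
Qed.

Lemma triG_unit b A : triG b A -> A \in unitmx.
Proof. by move=> /triG_det_gt0; rewrite unitmxE unitfE => /gt_eqF ->. Qed.

Lemma triG_inv b A : triG b A -> triG b (invmx A).
Proof.
have low B : triG true B -> triG true (invmx B).
  move=> tB; have uB := triG_unit tB; have [B0 Bp] := (triGP _ _).1 tB.
  have z (i j : 'I_n) : (i < j)%N -> invmx B i j = 0.
    have [m] := ubnP (i : nat); elim: m i j => // m ih i j; rewrite ltnS => im ij.
    have /matrixP /(_ i j) := mulmxV uB.
    rewrite !mxE (bigD1 i) //= big1 ?addr0 => [|k ki].
      have -> : (i == j) = false by apply/eqP => e; rewrite e ltnn in ij.
      by move/eqP; rewrite mulf_eq0 (gt_eqF (Bp i)) /= => /eqP.
    have ki' : (k : nat) != i by [].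
    case: (ltngtP k i) ki' => // ki' _; last by rewrite B0 ?mul0r.
    by rewrite ih ?mulr0 //; [exact: leq_trans ki' im | exact: ltn_trans ki' ij].
  apply/triGP; split => // i.
  have /matrixP /(_ i i) := mulmxV uB.
  rewrite !mxE eqxx (bigD1 i) //= big1 ?addr0 => [e|k ki].
    have -> : invmx B i i = (B i i)^-1.
      by apply: (mulfI (lt0r_neq0 (Bp i))); rewrite e divff // lt0r_neq0.
    by rewrite invr_gt0.
  have ki' : (k : nat) != i by [].
  by case: (ltngtP k i) ki' => // ki' _; [rewrite z ?mulr0 | rewrite B0 ?mul0r].
case: b; first exact: low.
move=> tA; apply/(triG_tr false); rewrite trmx_inv; apply: low.
exact/(triG_tr false).
Qed.

(** * Existence of triangular factors *)

(** Gram-Schmidt: [S = A B] where the rows of [B] are orthonormal and span the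
    same flag as the rows of [S]. *)
Lemma chol_lower m (S : 'M[C]_(n, m)) : S *m S^t* \in unitmx ->
  exists2 A, triG true A & A *m A^t* = S *m S^t*.
Proof.
move=> uS.
have nm : (n <= m)%N.
  have : (\rank (S *m S^t*) <= m)%N.
    by apply: leq_trans (mulmx_max_rank _ _) _.
  by rewrite mxrank_unit.
have [B defB] : {B | B = schmidt S} by exists (schmidt S).
have uB : B *m B^t* = 1%:M by apply/unitarymxP; rewrite defB schmidt_unitarymx.
have [A defA] : {A | A = S *m B^t*} by exists (S *m B^t*).
have SE : S = A *m B.
  have /submxP [D SD] := schmidt_sub S; rewrite -defB in SD.
  by rewrite defA SD -!mulmxA [B *m (_ *m _)]mulmxA uB mul1mx.
have AE : A *m A^t* = S *m S^t*.
  by rewrite [in RHS]SE trmxC_mul !mulmxA -[A *m B *m _]mulmxA uB mulmx1.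
have uA : A \in unitmx.
  move: uS; rewrite -AE => /mulmxV; rewrite -mulmxA => /mulmx1_unit [] //.
have entry i j : A i j = (row i S *m (row j B)^t*) 0 0.
  by rewrite defA !mxE; apply: eq_bigr => k _; rewrite !mxE.
have A0 (i j : 'I_n) : (i < j)%N -> A i j = 0.
  move=> ij; rewrite entry.
  have h : (row i S <= kermx ((row j B)^t*))%MS.
    apply: submx_trans (row_schmidt_sub S i) _; rewrite -defB; apply/sumsmx_subP => k ki.
    rewrite genmxE; apply/sub_kermxP; apply/matrixP => u v; rewrite !ord1.
    have /matrixP /(_ k j) := uB; rewrite !mxE.
    have -> : (k == j) = false by apply/eqP => e; rewrite -e ltnNge ki in ij.
    by move=> e; apply: etrans e; apply: eq_bigr => l _; rewrite !mxE.
  by move/sub_kermxP: h => ->; rewrite mxE.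
have Age i : 0 <= A i i.
  by rewrite entry -dotmxE defB form1_row_schmidt.
exists A => //; apply/triGP; split => // i.
rewrite lt_def Age andbT.
have tA : is_trig_mx A by apply/is_trig_mxP.
move: uA; rewrite unitmxE unitfE (det_trig tA).
by apply: contra => /eqP e; rewrite (bigD1 i) //= e mul0r.
Qed.

Lemma chol_exists b m (S : 'M[C]_(n, m)) : S *m S^t* \in unitmx ->
  exists2 A, triG b A & A *m A^t* = S *m S^t*.
Proof.
case: b; first exact: chol_lower.
(* The upper triangular factor comes from the lower one of the inverse. *)
move=> uS; set P := S *m S^t* in uS *.
have PJ : P^t* = P by rewrite /P trmxC_mul trmxCK.
have invJ : (invmx P)^t* = invmx P by rewrite trmx_inv map_invmx PJ.
have E : (invmx P *m S) *m (invmx P *m S)^t* = invmx P.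
  by rewrite trmxC_mul invJ mulmxA -[invmx P *m S *m _]mulmxA -/P mulVmx // mul1mx.
have uS' : (invmx P *m S) *m (invmx P *m S)^t* \in unitmx by rewrite E unitmx_inv.
have [A tA] := chol_lower uS'; rewrite E => AE.
have uA := triG_unit tA.
exists ((invmx A)^t*); first exact: (triG_J (triG_inv tA)).
rewrite trmxCK -[RHS]mulmx1.
have h : ((invmx A)^t* *m invmx A) *m (A *m A^t*) = 1%:M.
  rewrite -mulmxA [invmx A *m _]mulmxA mulVmx // mul1mx -trmxC_mul mulmxV //.
  by rewrite trmxC1.
rewrite AE in h.
by rewrite -[LHS](mulmxKV uS) h mul1mx mulmx1.
Qed.

(** * Continuity and uniqueness of triangular factors *)

Lemma invmx_unique A B : A *m B = 1%:M -> invmx A = B.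
Proof.
move=> AB; have [uA _] := mulmx1_unit AB.
by rewrite -[invmx A]mulmx1 -AB mulKmx.
Qed.

Lemma invmxJ A : (invmx A)^t* = invmx (A^t*).
Proof. by rewrite trmx_inv map_invmx. Qed.

Lemma unitmxJ A : (A^t* \in unitmx) = (A \in unitmx).
Proof. by rewrite !unitmxE det_map_mx det_tr !unitfE fmorph_eq0. Qed.

(** With [T = A^-1 B], the deviation [T - T^-*] is governed by the difference of
    the Gram matrices of [A] and [B]. *)
Lemma gap_identity A B : A \in unitmx -> B \in unitmx ->
  invmx A *m B - (invmx (invmx A *m B))^t* =
  invmx A *m (B *m B^t* - A *m A^t*) *m invmx (B *m B^t*) *m B.
Proof.
move=> uA uB; have uBJ : B^t* \in unitmx by rewrite unitmxJ.
have h1 : invmx (B *m B^t*) *m B = invmx (B^t*).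
  have uQ : B *m B^t* \in unitmx by rewrite unitmx_mul uB.
  apply: (can_inj (mulKmx uQ)); rewrite mulKVmx // -mulmxA mulmxV // mulmx1 //.
have h2 : invmx (invmx A *m B) = invmx B *m A.
  apply: invmx_unique; rewrite -mulmxA [B *m _]mulmxA mulmxV // mul1mx mulVmx //.
rewrite h2 trmxC_mul invmxJ -[RHS]mulmxA h1 mulmxBr mulmxBl; congr (_ - _).
  by rewrite -!mulmxA mulmxV // mulmx1.
by rewrite !mulmxA mulVmx // mul1mx.
Qed.

(** [T] and [T^-*] are triangular of opposite types, so an off-diagonal entry of
    [T - T^-*] is an entry of [T] or of [T^-*]; on the diagonal
    [|x - 1| <= |x - 1/x|] for [x > 0]. *)
Lemma gap_cvg b (T : nat -> 'M[C]_n) : (forall m, triG b (T m)) ->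
  mcvg (fun m => T m - (invmx (T m))^t*) 0 -> mcvg T 1%:M.
Proof.
move=> tT cT i j; have := cT i j.
have -> : (0 : 'M[C]_n) i j = 0 by rewrite mxE.
have -> : (1%:M : 'M[C]_n) i j = (i == j)%:R by rewrite mxE.
have [<-{j}|ij] := eqVneq i j; last first.
  rewrite mulr0n; have [oij|oij] := boolP (off b i j).
    move=> _; rewrite (_ : (fun m => T m i j) = fun=> 0); first exact: ccvg_cst.
    by apply/funext => m; have [h _] := (triGP _ _).1 (tT m); exact: h.
  rewrite (_ : (fun m => T m i j) = (fun m => (T m - (invmx (T m))^t*) i j)) //.
  apply/funext => m; have [h _] := (triGP _ _).1 (triG_J (triG_inv (tT m))).
  by rewrite subr_mxE h ?subr0 //; exact: off_neq.
rewrite mulr1n => /ccvg_e h; apply/ccvg_e => e /h [N hN]; exists N => m /hN; rewrite subr0.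
apply: le_lt_trans.
have tp := triG_diag i (tT m); have t0 := lt0r_neq0 tp.
have Ti : (invmx (T m)) i i = (T m i i)^-1.
  apply: (mulfI t0); rewrite -(triG_diag_mul i (tT m) (triG_inv (tT m))) divff //.
  by rewrite mulmxV ?(triG_unit (tT m)) // mxE eqxx.
rewrite subr_mxE trmxCE Ti.
rewrite pos_conj ?invr_gt0 // (pos_realE tp).
set x := complex.Re _; have x0 : 0 < x by exact: pos_Re tp.
rewrite -fmorphV -[1]/((1 : R)%:C%C) -!rmorphB /= !sq_real.
have -> : x - x^-1 = (x - 1) * (1 + x^-1) by field; rewrite gt_eqF.
rewrite exprMn ler_peMr ?sqr_ge0 // expr_ge1 //; last by rewrite addr_ge0 // invr_ge0 ltW.
by rewrite lerDl invr_ge0 ltW.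
Qed.

(** Traces of the Gram matrices bound the factors, so [gap_identity] shows that
    [T_m - T_m^-*] tends to zero for [T_m = A^-1 A_m], and [gap_cvg] applies. *)
Lemma chol_cvg b (A_ : nat -> 'M[C]_n) A :
  (forall m, triG b (A_ m)) -> triG b A ->
  mcvg (fun m => A_ m *m (A_ m)^t*) (A *m A^t*) -> mcvg A_ A.
Proof.
move=> tA_ tA hP; set P_ := (fun m => _) in hP; set P := A *m A^t* in hP.
have uA := triG_unit tA; have uA_ m := triG_unit (tA_ m).
have uP : P \in unitmx by rewrite unitmx_mul uA unitmxJ.
have uP_ m : P_ m \in unitmx by rewrite unitmx_mul uA_ unitmxJ uA_.
pose T m := invmx A *m A_ m.
have tT m : triG b (T m) by apply: triG_mul => //; exact: triG_inv.
have uT m := triG_unit (tT m).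
pose X m := invmx A *m (P_ m - P) *m invmx (P_ m).
have cX : mcvg X 0.
  have := mcvgM (mcvgM (mcvg_cst (invmx A)) (mcvgB hP (mcvg_cst P))) (mcvg_inv uP_ uP hP).
  by rewrite subrr mulmx0 mul0mx.
have bA : exists K : R, forall m i j, sq (A_ m i j) <= K.
  pose t m := complex.Re (\tr (P_ m)).
  have ht m : t m = hs2 (A_ m) by rewrite /t -hs2_tr.
  have ct : cvgn t.
    have : ccvg (fun m => \tr (P_ m)) (\tr P) by apply: ccvg_sum => i; exact: hP.
    by move=> /ccvgP [h _]; apply/cvg_ex; exists (complex.Re (\tr P)).
  have [K [_ hK]] := cvg_seq_bounded ct.
  exists (K + 1) => m i j; apply: le_trans (sq_le_hs2 _ i j) _.
  rewrite -ht; apply: le_trans (ler_norm _) _.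
  by apply: hK; [rewrite ltrDl | ].
have [K hK] := bA.
have cXA : mcvg (fun m => X m *m A_ m) 0.
  move=> i j; have : ccvg (fun m => \sum_k X m i k * A_ m k j) (\sum_(k < n) 0).
    apply: ccvg_sum => k; apply: (ccvg0_bounded (K := K)) => //.
    by have := cX i k; rewrite mxE.
  by rewrite big1 // mxE; congr ccvg; apply/funext => m; rewrite mxE.
have cT : mcvg T 1%:M.
  apply: (gap_cvg tT) => i j; have := cXA i j.
  by under [in X in X -> _]eq_fun do rewrite -(gap_identity uA (uA_ _)).
have := mcvgM (mcvg_cst A) cT; rewrite mulmx1.
by congr mcvg; apply/funext => m; rewrite /T mulmxA mulmxV // mul1mx.
Qed.

(** Uniqueness is continuity along a constant sequence. *)
Lemma chol_unique b A B : triG b A -> triG b B ->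
  A *m A^t* = B *m B^t* -> A = B.
Proof.
move=> tA tB AB; have h : mcvg (fun=> A) B.
  by apply: (chol_cvg (b := b)) => //; rewrite AB; exact: mcvg_cst.
by apply/matrixP => i j; exact: ccvg_unique (ccvg_cst _) (h i j).
Qed.

End Triangular.

(** * Contractive matrices *)

Section Contractive.
Variable R : realType.
Local Notation C := R[i].
Variable n : nat.
Implicit Types (F K : 'M[C]_n).

Lemma mulmx_bounded p q (A : 'M[C]_(p, q)) : exists2 K : R, 0 < K &
  forall s (B : 'M[C]_(q, s)), hs2 (A *m B) <= K * hs2 B.
Proof.
exists (2 ^+ q * hs2 A + 1); first by rewrite ltr_wpDl // mulr_ge0 ?exprn_ge0 ?hs2_ge0.
move=> s B.
have sum_le (r : seq 'I_q) (x : 'I_q -> C) :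
    sq (\sum_(k <- r) x k) <= 2 ^+ size r * \sum_(k <- r) sq (x k).
  elim: r => [|k r ih]; first by rewrite !big_nil sq0 mulr0.
  rewrite !big_cons /= exprS; apply: le_trans (sqD_le _ _) _.
  have c1 : 1 <= (2 : R) ^+ size r by rewrite exprn_ege1 // ler1n.
  have := sq_ge0 (x k); have := ih; nra.
apply: le_trans (_ : 2 ^+ q * hs2 A * hs2 B <= _); last first.
  by rewrite ler_wpM2r ?hs2_ge0 // lerDl.
rewrite {1}/hs2 {2}/hs2 [X in _ * X]exchange_big /= mulr_sumr exchange_big /=.
apply: ler_sum => j _.
rewrite mulrAC -mulrA mulr_sumr mulr_sumr; apply: ler_sum => i _.
rewrite mxE; apply: le_trans (sum_le _ _) _.
have -> : size (index_enum 'I_q) = q by rewrite -[index_enum _]enumT size_enum_ord.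
rewrite ler_wpM2l ?exprn_ge0 // mulr_suml; apply: ler_sum => k _.
rewrite sqM [leLHS]mulrC; apply: ler_wpM2l; first exact: sq_ge0.
by rewrite (bigD1 k) //= lerDl; apply: sumr_ge0 => l _; exact: sq_ge0.
Qed.

Lemma hsnorm_le p q (A : 'M[C]_(p, q)) (e : R) : 0 <= e -> (hsnorm A <= e) = (hs2 A <= e ^+ 2).
Proof.
by move=> e0; rewrite -hsnorm2 ler_pXn2r // nnegrE // sqrtr_ge0.
Qed.

Lemma opnorm_bound F (v : 'cV[C]_n) : hsnorm v <= 1 -> hsnorm (F *m v) <= opnorm F.
Proof.
move=> v1; apply: sup_upper_bound; last by exists v.
split; first by exists (hsnorm (F *m v)), v.
have [K K0 hK] := mulmx_bounded F.
exists (Num.sqrt K) => _ [w /= w1 <-].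
rewrite hsnorm_le ?sqrtr_ge0 // sqr_sqrtr ?(ltW K0) //.
apply: le_trans (hK _ w) _; rewrite ler_piMr ?(ltW K0) //.
by move: w1; rewrite hsnorm_le // expr1n.
Qed.

(** The constant [c] keeps the supremum in the operator norm away from one; the
    block equations provide it through a bound on [H^-1]. *)
Lemma contractiveP F (c : R) : 0 < c ->
  (forall v : 'cV[C]_n, hs2 (F *m v) + c * hs2 v <= hs2 v) -> contractive F.
Proof.
move=> c0 h; rewrite /contractive.
pose d := Num.max 0 (1 - c).
have d0 : 0 <= d by rewrite le_max lexx.
have d1 : d < 1 by rewrite gt_max ltr01 /= gtrBl.
apply: (@le_lt_trans _ _ (Num.sqrt d)); last by rewrite -[ltRHS]sqrtr1 ltr_sqrt.
apply: ge_sup.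
  by exists (hsnorm (F *m (0 : 'cV[C]_n))), 0 => //=; rewrite hsnorm_le // hs2_0 sqr_ge0.
move=> _ [v /= v1 <-]; rewrite hsnorm_le ?sqrtr_ge0 // sqr_sqrtr //.
move: v1; rewrite hsnorm_le // expr1n => v1.
have := h v; have := hs2_ge0 v.
have : 1 - c <= d by rewrite le_max lexx orbT.
nra.
Qed.

(** * The spectrum of F^* F *)

Lemma gram_spectral F : exists (U : 'M[C]_n) (l : 'I_n -> R), [/\ U \is unitarymx,
  F^t* *m F = U^t* *m diag_mx (\row_i (l i)%:C%C) *m U &
  forall i, exists2 v : 'cV[C]_n, hs2 v = 1 & l i = hs2 (F *m v)].
Proof.
set P := F^t* *m F.
have Pn : P \is normalmx.
  by apply/normalmxP; rewrite /P trmxC_mul trmxCK.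
pose U := spectralmx P; have uU : U \is unitarymx := spectral_unitarymx P.
have PE : P = U^t* *m diag_mx (spectral_diag P) *m U.
  have := orthomx_spectralP Pn; rewrite -/U => {1}->.
  by rewrite (invmx_unique (unitaryE uU)).
have UPU : U *m P *m U^t* = diag_mx (spectral_diag P).
  by rewrite {1}PE !mulmxA unitaryE // mul1mx -mulmxA unitaryE // mulmx1.
pose v i := col i (U^t*).
have vE i : (hs2 (F *m v i))%:C%C = spectral_diag P 0 i.
  have -> : spectral_diag P 0 i = (U *m P *m U^t*) i i by rewrite UPU !mxE eqxx.
  have -> : (U *m P *m U^t*) i i = ((F *m v i)^t* *m (F *m v i)) 0 0.
    have Fv k : (F *m v i) k 0 = (F *m U^t*) k i.
      by rewrite !mxE; apply: eq_bigr => l _; rewrite !mxE.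
    have -> : U *m P *m U^t* = (F *m U^t*)^t* *m (F *m U^t*).
      by rewrite /P trmxC_mul trmxCK !mulmxA.
    rewrite mxE [RHS]mxE; apply: eq_bigr => k _.
    by rewrite [in LHS]trmxCE [in RHS]trmxCE !Fv.
  by rewrite -hs2J hs2_tr trmxCK /mxtrace big_ord1.
exists U, (fun i => hs2 (F *m v i)); split; first exact: uU.
  rewrite PE; congr (_ *m diag_mx _ *m _); apply/rowP => i.
  by rewrite mxE vE.
move=> i; exists (v i) => //.
apply: (@complexI R); rewrite -hs2J hs2_tr trmxCK /mxtrace big_ord1.
have /matrixP /(_ i i) := unitaryE uU.
rewrite [(1%:M : 'M[C]_n) i i]mxE eqxx => h; apply: etrans h.
rewrite !mxE; apply: eq_bigr => k _; rewrite !mxE conjCK //.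
Qed.

Lemma prod_ge_sub (I : Type) (s : seq I) (x : I -> R) : (forall i, 0 <= x i <= 1) ->
  1 - \sum_(i <- s) (1 - x i) <= \prod_(i <- s) x i /\ 0 <= \prod_(i <- s) x i <= 1.
Proof.
move=> hx; elim: s => [|i s [ih /andP [h0 h1]]].
  by rewrite !big_nil subr0 !lexx ler01.
rewrite !big_cons; have /andP [x0 x1] := hx i; split; last first.
  by rewrite mulr_ge0 // mulr_ile1.
nra.
Qed.

(** The eigenvalues [l_i] of [F^* F] lie in [0, 1] and sum to [hs2 F]; the
    determinant is the product of the [1 - l_i]. *)
Lemma det_gram F : (forall v : 'cV[C]_n, hs2 v = 1 -> hs2 (F *m v) <= 1) ->
  exists d : R, \det (1%:M - F^t* *m F) = d%:C%C /\ 1 - hs2 F <= d.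
Proof.
move=> hF; have [U [l [uU PE hl]]] := gram_spectral F.
have l01 i : 0 <= 1 - l i <= 1.
  have [v v1 ->] := hl i; have := hF v v1; have := hs2_ge0 (F *m v); lra.
exists (\prod_i (1 - l i)); split.
  have -> : 1%:M - F^t* *m F = U^t* *m diag_mx (\row_i (1 - l i)%:C%C) *m U.
    rewrite PE -{1}(unitaryE' uU) -{1}[U^t*]mulmx1 -mulmxBl -mulmxBr.
    congr (_ *m _ *m _); apply/matrixP => i j; rewrite !mxE rmorphB /=.
    by case: eqP => _; rewrite ?mulr1n // !mulr0n subr0.
  rewrite !det_mulmx mulrAC -det_mulmx unitaryE' // det1 mul1r det_diag rmorph_prod.
  by apply: eq_bigr => i _; rewrite mxE.
have [h _] := @prod_ge_sub 'I_n (index_enum 'I_n) (fun i => 1 - l i) l01.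
apply: le_trans h; rewrite lerD2l lerN2.
have -> : hs2 F = \sum_i l i.
  apply: (@complexI R); rewrite -hs2J hs2_tr trmxCK PE -mulmxA mxtrace_mulC -mulmxA.
  rewrite unitaryE // mulmx1 mxtrace_diag rmorph_sum; apply: eq_bigr => i _.
  by rewrite mxE.
by rewrite le_eqVlt; apply/orP; left; apply/eqP; apply: eq_bigr => i _; ring.
Qed.

Lemma contractive_lt F (v : 'cV[C]_n) : contractive F -> hs2 v = 1 -> hs2 (F *m v) < 1.
Proof.
move=> cF v1; have h : hsnorm (F *m v) < 1.
  by apply: le_lt_trans cF; apply: opnorm_bound; rewrite hsnorm_le // v1 expr1n.
by rewrite -hsnorm2 expr_lt1 // sqrtr_ge0.
Qed.

Lemma contractive_gram F : contractive F -> exists S : 'M[C]_n,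
  S \in unitmx /\ 1%:M - F^t* *m F = S *m S^t*.
Proof.
move=> cF; have [U [l [uU PE hl]]] := gram_spectral F.
have lp i : 0 < 1 - l i.
  by have [v v1 ->] := hl i; rewrite subr_gt0; exact: contractive_lt.
pose D : 'M[C]_n := diag_mx (\row_i (Num.sqrt (1 - l i))%:C%C).
exists (U^t* *m D); split.
  rewrite unitmx_mul unitmxJ; apply/andP; split.
    by have /mulmx1_unit [] := unitaryE uU.
  rewrite unitmxE unitfE det_diag; apply/prodf_neq0 => i _; rewrite mxE.
  by rewrite fmorph_eq0 gt_eqF // sqrtr_gt0.
rewrite trmxC_mul trmxCK PE -{1}(unitaryE' uU) -{1}[U^t*]mulmx1 -mulmxBl -mulmxBr.
rewrite !mulmxA -[U^t* *m D *m _]mulmxA; congr (_ *m _ *m _); apply/matrixP => i j.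
rewrite mul_diag_mx !mxE; case: (eqVneq i j) => [->|ij].
  rewrite !mulr1n.
  by rewrite conjcE /= oppr0 -rmorphM -expr2 sqr_sqrtr ?(ltW (lp j)) // rmorphB.
by rewrite !mulr0n subr0 rmorph0 mulr0.
Qed.

End Contractive.

(** * Existence and uniqueness of Y(F) *)

Section YMatrix.
Variable R : realType.
Local Notation C := R[i].
Variable n : nat.
Implicit Types (E F G H K : 'M[C]_n).

Lemma blockJ E F G H :
  (block_mx E F G H)^t* = block_mx (E^t*) (G^t*) (F^t*) (H^t*).
Proof. by rewrite tr_block_mx map_block_mx. Qed.

Lemma invmx_mul E F : E \in unitmx -> F \in unitmx ->
  invmx (E *m F) = invmx F *m invmx E.
Proof.
move=> uE uF; apply: invmx_unique.
by rewrite -mulmxA [F *m _]mulmxA mulmxV // mul1mx mulmxV.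
Qed.

Lemma block1 : (1%:M : 'M[C]_(n + n)) = block_mx 1%:M 0 0 1%:M.
Proof. exact: scalar_mx_block. Qed.

Lemma unitary_block E F G H : block_mx E F G H \is unitarymx ->
  [/\ E *m E^t* + F *m F^t* = 1%:M, G *m E^t* + H *m F^t* = 0,
      F^t* *m F + H^t* *m H = 1%:M & E^t* *m F + G^t* *m H = 0].
Proof.
move=> uY; have := unitaryE uY; have := unitaryE' uY.
rewrite blockJ !mulmx_block block1.
by move=> /eq_block_mx [_ h1 _ h2] /eq_block_mx [h3 _ h4 _].
Qed.

(** Right multiplication by a block triangular matrix whose first column is the
    adjoint of the first block row reduces the left block column to the
    identity over zero. *)
Lemma det_block_unitary E F G H : block_mx E F G H \is unitarymx ->
  \det (block_mx E F G H) * \det (E^t*) = \det H.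
Proof.
move=> /unitary_block [h1 h2 _ _].
have : block_mx E F G H *m block_mx (E^t*) 0 (F^t*) 1%:M = block_mx 1%:M F 0 H.
  by rewrite mulmx_block h1 h2 !mulmx0 !mulmx1 !add0r.
move=> /(congr1 determinant); rewrite det_mulmx det_lblock det_ublock !det1.
by rewrite mulr1 mul1r.
Qed.

Lemma det_trJ p (A : 'M[C]_p) : \det (A^t*) = (\det A)^*.
Proof. by rewrite det_map_mx det_tr. Qed.

(** Unitarity of the rows fixes the lower left block, and positivity of the
    diagonals of [E] and [H] turns [|det| = 1] into [det = 1]. *)
Lemma Y_build (alpha : bool -> bool) E F H :
  triG (alpha false) E -> triG (alpha true) H ->
  E *m E^t* = 1%:M - F *m F^t* -> H^t* *m H = 1%:M - F^t* *m F ->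
  is_Y alpha F (block_mx E F (- (invmx (H^t*) *m F^t* *m E)) H).
Proof.
move=> tE tH EE HH; set G := - _.
have uH := triG_unit tH; have uHJ : H^t* \in unitmx by rewrite unitmxJ.
have F2 : F^t* *m F = 1%:M - H^t* *m H by rewrite HH opprB addrC subrK.
have h1 : E *m E^t* + F *m F^t* = 1%:M by rewrite EE subrK.
have swap : F^t* *m (E *m E^t*) = H^t* *m H *m F^t*.
  by rewrite EE HH mulmxBr mulmxBl mulmx1 mul1mx !mulmxA.
have h2 : G *m E^t* + H *m F^t* = 0.
  rewrite /G mulNmx -!mulmxA swap -!mulmxA mulKmx // addNr //.
have h3 : E *m G^t* + F *m H^t* = 0.
  have := congr1 (fun M : 'M[C]_n => M^t*) h2.
  rewrite linearD /= map_mxD !trmxC_mul !trmxCK => ->.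
  by apply/matrixP => i j; rewrite !mxE rmorph0.
have h4 : G *m G^t* + H *m H^t* = 1%:M.
  have -> : G^t* = - (E^t* *m F *m invmx H).
    by rewrite /G linearN /= map_mxN !trmxC_mul trmxCK invmxJ trmxCK mulmxA.
  rewrite /G mulNmx mulmxN opprK -!mulmxA [E *m (_ *m _)]mulmxA [F^t* *m (_ *m _)]mulmxA swap.
  rewrite -!mulmxA [invmx _ *m _]mulmxA mulVmx // mul1mx [F^t* *m (_ *m _)]mulmxA F2.
  by rewrite mulmxBl mul1mx -mulmxA mulmxV // mulmx1 mulmxBr mulmxV // subrK.
have uY : block_mx E F G H \is unitarymx.
  by apply/unitarymxP; rewrite blockJ mulmx_block h1 h2 h3 h4 block1.
have dE := triG_det_gt0 tE; have dH := triG_det_gt0 tH.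
split; rewrite ?block_mxKul ?block_mxKur ?block_mxKdr //.
split => //.
have := det_block_unitary uY; rewrite det_trJ (pos_conj dE) => e.
(* The determinant is positive and of modulus one. *)
have dY : 0 < \det (block_mx E F G H).
  by rewrite -(pmulr_lgt0 _ dE) e.
have : \det (block_mx E F G H) * (\det (block_mx E F G H))^* = 1.
  by rewrite -det_trJ -det_mulmx unitaryE // det1.
rewrite (pos_conj dY) -expr2 => /eqP; rewrite sqrf_eq1 => /orP [/eqP //|/eqP e1].
by move: dY; rewrite e1 oppr_gt0 ltr10.
Qed.

Lemma is_Y_block (alpha : bool -> bool) F (Y : 'M[C]_(n + n)) : is_Y alpha F Y ->
  Y = block_mx (ulsubmx Y) F (dlsubmx Y) (drsubmx Y).
Proof. by case=> _ e _ _; rewrite -e submxK. Qed.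

Lemma is_Y_eqs (alpha : bool -> bool) F (Y : 'M[C]_(n + n)) : is_Y alpha F Y ->
  let E := ulsubmx Y in let H := drsubmx Y in
  [/\ E *m E^t* = 1%:M - F *m F^t*, H^t* *m H = 1%:M - F^t* *m F,
      dlsubmx Y = - (invmx (H^t*) *m F^t* *m E) & \det E = \det H].
Proof.
move=> hY E H; have YE := is_Y_block hY; have [[uY dY] _ tE tH] := hY.
rewrite YE in uY dY.
have [h1 h2 h3 h4] := unitary_block uY.
have uH := triG_unit tH.
split.
- by rewrite -h1 addrK.
- by rewrite -h3 addrAC subrr add0r.
- have := congr1 (fun M : 'M[C]_n => M^t*) h4.
  rewrite linearD /= map_mxD !trmxC_mul !trmxCK -/E -/H => /eqP.
  rewrite trmx0 map_mx0 addr_eq0 => /eqP e.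
  have uHJ : H^t* \in unitmx by rewrite unitmxJ.
  by rewrite -mulmxA e mulmxN mulKmx // opprK.
- have := det_block_unitary uY; rewrite dY mul1r det_trJ pos_conj //.
  exact: triG_det_gt0 tE.
Qed.

Lemma Y_unique (alpha : bool -> bool) F (Y Y' : 'M[C]_(n + n)) :
  is_Y alpha F Y -> is_Y alpha F Y' -> Y = Y'.
Proof.
move=> hY hY'; have [e1 e2 e3 _] := is_Y_eqs hY; have [f1 f2 f3 _] := is_Y_eqs hY'.
have [_ _ tE tH] := hY; have [_ _ tE' tH'] := hY'.
have EE : ulsubmx Y = ulsubmx Y' by apply: (chol_unique tE tE'); rewrite e1 f1.
have HH : drsubmx Y = drsubmx Y'.
  rewrite -[LHS]trmxCK -[RHS]trmxCK; congr (_^t*).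
  by apply: (chol_unique (triG_J tH) (triG_J tH')); rewrite !trmxCK e2 f2.
by rewrite (is_Y_block hY) (is_Y_block hY') e3 f3 EE HH.
Qed.

(** Every contractive [F] is [K H] with [H] the triangular factor of
    [(1 + K^* K)^-1]; in terms of [K] the two factorisations decouple. *)
Lemma gram1_unit K : 1%:M + K *m K^t* \in unitmx /\
  exists m (S : 'M[C]_(n, m)), S *m S^t* = 1%:M + K *m K^t*.
Proof.
have E : row_mx 1%:M K *m (row_mx 1%:M K)^t* = 1%:M + K *m K^t*.
  by rewrite tr_row_mx map_col_mx mul_row_col trmxC1 mulmx1.
split; last by exists (n + n)%N, (row_mx 1%:M K).
rewrite -row_free_unit; apply/row_freeP; exists (invmx (1%:M + K *m K^t*)).
apply: mulmxV; rewrite -row_free_unit -kermx_eq0; apply/rowV0P => v /sub_kermxP hv.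
have : hs2 (v *m row_mx 1%:M K) = 0.
  by apply: (@complexI R); rewrite hs2_tr trmxC_mul mulmxA -[_ *m row_mx _ _ *m _]mulmxA E hv mul0mx mxtrace0.
move/hs2_eq0; rewrite mul_mx_row mulmx1 => /eqP; rewrite row_mx_eq0.
by case/andP => /eqP.
Qed.

Lemma triG_inv_gram b K : exists2 A : 'M[C]_n, triG b A &
  A *m A^t* = invmx (1%:M + K *m K^t*).
Proof.
have [uP [m [S SE]]] := gram1_unit K.
have [|A tA] := @chol_exists _ _ (~~ b) _ S; first by rewrite SE.
rewrite SE => AE; have uA := triG_unit tA.
exists ((invmx A)^t*); first by rewrite -[b]negbK; exact: (triG_J (triG_inv tA)).
rewrite trmxCK -AE; apply: esym; apply: invmx_unique.
rewrite invmxJ -mulmxA [A^t* *m _]mulmxA mulmxV ?unitmxJ // mul1mx.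
exact: mulmxV.
Qed.

Lemma Y_of_K (alpha : bool -> bool) K : exists F (Y : 'M[C]_(n + n)),
  is_Y alpha F Y /\ F = K *m drsubmx Y.
Proof.
have [E tE EE] := triG_inv_gram (alpha false) K.
have [H tH HH] := triG_inv_gram (alpha true) (K^t*).
have [uP _] := gram1_unit K; have [uQ _] := gram1_unit (K^t*).
rewrite trmxCK in HH uQ.
have [P defP] : {P | P = 1%:M + K *m K^t*} by exists (1%:M + K *m K^t*).
have [Q defQ] : {Q | Q = 1%:M + K^t* *m K} by exists (1%:M + K^t* *m K).
rewrite -defP in EE uP; rewrite -defQ in HH uQ.
have PK : P *m K = K *m Q by rewrite defP defQ mulmxDl [RHS]mulmxDr mul1mx mulmx1 -mulmxA.
have PK' : K *m invmx Q = invmx P *m K.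
  by apply: (can_inj (mulKmx uP)); rewrite mulmxA PK mulmxK // mulKVmx.
pose F := K *m H.
have h1 : E *m E^t* = 1%:M - F *m F^t*.
  rewrite EE /F trmxC_mul -!mulmxA [H *m _]mulmxA HH [K *m (_ *m _)]mulmxA PK' -mulmxA.
  have -> : K *m K^t* = P - 1%:M by rewrite defP addrC addKr.
  by rewrite mulmxBr mulVmx // mulmx1 opprB addrC subrK.
have h2 : H^t* *m H = 1%:M - F^t* *m F.
  have uH := triG_unit tH; have uHJ : H^t* \in unitmx by rewrite unitmxJ.
  have QE : Q = invmx (H^t*) *m invmx H by rewrite -invmx_mul // HH invmxK.
  have : H^t* *m Q *m H = 1%:M by rewrite QE mulmxA mulmxV // mul1mx mulVmx.
  rewrite defQ mulmxDr mulmxDl mulmx1 /F trmxC_mul => {1}<-.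
  by rewrite -!mulmxA addrK.
have hY := Y_build tE tH h1 h2.
by exists F, (block_mx E F (- (invmx (H^t*) *m F^t* *m E)) H); split; rewrite ?block_mxKdr.
Qed.

Lemma is_Y_contractive (alpha : bool -> bool) F (Y : 'M[C]_(n + n)) :
  is_Y alpha F Y -> contractive F.
Proof.
move=> hY; have [_ HH _ _] := is_Y_eqs hY; have [_ _ _ tH] := hY.
set H := drsubmx Y in HH tH; have uH := triG_unit tH.
have [c c0 hc] := mulmx_bounded (invmx H).
apply: (@contractiveP _ _ _ c^-1); first by rewrite invr_gt0.
move=> v; have e : hs2 (F *m v) + hs2 (H *m v) = hs2 v.
  apply: (@complexI R); rewrite rmorphD /= -(hs2J (F *m v)) -(hs2J (H *m v)) -(hs2J v) !hs2_tr !trmxCK !trmxC_mul.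
  rewrite -linearD /= -!mulmxA -mulmxDr !mulmxA -!mulmxDl ?mulmxA.
  by rewrite HH addrC subrK mulmx1.
rewrite -[leRHS]e lerD2l mulrC ler_pdivrMr // mulrC -{1}(mulKmx uH v).
exact: hc.
Qed.

Lemma contractive_is_Y (alpha : bool -> bool) F : contractive F ->
  exists Y : 'M[C]_(n + n), is_Y alpha F Y.
Proof.
move=> cF; have [S [uS SE]] := contractive_gram cF.
have uSS : S *m S^t* \in unitmx by rewrite unitmx_mul uS unitmxJ.
have [HJ tHJ] := @chol_exists _ _ (~~ alpha true) _ S uSS.
rewrite -SE => HH.
pose H := HJ^t*; have tH : triG (alpha true) H by rewrite -[alpha true]negbK; exact: triG_J.
have uH := triG_unit tH; have uHJ := triG_unit tHJ.
have HHE : H^t* *m H = 1%:M - F^t* *m F by rewrite /H trmxCK.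
pose K := F *m invmx H.
have [E tE EE] := triG_inv_gram (alpha false) K.
have [uP _] := gram1_unit K.
have h1 : E *m E^t* = 1%:M - F *m F^t*.
  rewrite EE; apply: invmx_unique; rewrite mulmxDl mul1mx.
  have -> : K *m K^t* *m (1%:M - F *m F^t*) = F *m F^t*; last by rewrite subrK.
  rewrite /K trmxC_mul invmxJ.
  have -> : F *m invmx H *m (invmx (H^t*) *m F^t*) *m (1%:M - F *m F^t*) =
     F *m invmx H *m invmx (H^t*) *m ((1%:M - F^t* *m F) *m F^t*).
    have sw : F^t* *m (1%:M - F *m F^t*) = (1%:M - F^t* *m F) *m F^t*.
      by rewrite mulmxBr mulmxBl mulmx1 mul1mx mulmxA.
    by rewrite -[LHS]mulmxA -[X in _ *m X = _]mulmxA sw mulmxA.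
  rewrite -HHE -!mulmxA mulKmx ?unitmxJ // mulKmx //.
by eexists; exact: Y_build tE tH h1 HHE.
Qed.

End YMatrix.

Section YFunction.
Variables (R : realType) (n : nat) (alpha : bool -> bool).
Local Notation C := R[i].
Local Notation Y := (@Y R n alpha).
Implicit Types (F K : 'M[C]_n).

Lemma YP F : contractive F -> is_Y alpha F (Y F).
Proof.
by move=> /(contractive_is_Y alpha) [Z hZ]; apply: (xgetPex 0); exists Z.
Qed.

Lemma Y_eq F (Z : 'M[C]_(n + n)) : is_Y alpha F Z -> Y F = Z.
Proof.
by move=> hZ; apply: (Y_unique (YP (is_Y_contractive hZ)) hZ).
Qed.

Lemma Y_unitary F : contractive F -> Y F \is unitarymx.
Proof. by move=> /YP [[]]. Qed.

Lemma Y_ur F : contractive F -> ursubmx (Y F) = F.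
Proof. by move=> /YP []. Qed.

Lemma Y_ul F : contractive F -> triG (alpha false) (ulsubmx (Y F)).
Proof. by move=> /YP []. Qed.

Lemma Y_dr F : contractive F -> triG (alpha true) (drsubmx (Y F)).
Proof. by move=> /YP []. Qed.

Lemma is_Y0 : is_Y alpha (0 : 'M[C]_n) 1%:M.
Proof.
rewrite block1; split; rewrite ?block_mxKul ?block_mxKur ?block_mxKdr.
- by rewrite -block1; split; [exact: unitary1 | exact: det1].
- by [].
- exact: triG1.
- exact: triG1.
Qed.

Lemma Y0 : Y 0 = 1%:M.
Proof. exact: Y_eq is_Y0. Qed.

(** * The coordinate K = F H^-1 and continuity of Y *)

(** In the product with any further factors, [K = F H^-1] becomes [B(0) D(0)^-1],
    from which [F] has to be recovered; [K] ranges over all matrices. *)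
Definition Kof F : 'M[C]_n := F *m invmx (drsubmx (Y F)).

Lemma Kof_mul F : contractive F -> F = Kof F *m drsubmx (Y F).
Proof. by move=> cF; rewrite /Kof mulmxKV // (triG_unit (Y_dr cF)). Qed.

Lemma Kof_gram F : contractive F ->
  drsubmx (Y F) *m (drsubmx (Y F))^t* = invmx (1%:M + (Kof F)^t* *m Kof F).
Proof.
move=> cF; have tH := Y_dr cF; have uH := triG_unit tH.
have [_ HH _ _] := is_Y_eqs (YP cF).
have := Kof_mul cF; move: (Kof F) => K.
move: tH uH HH; move: (drsubmx (Y F)) => H tH uH HH FE.
have uHJ : H^t* \in unitmx by rewrite unitmxJ.
have e : H^t* *m (1%:M + K^t* *m K) *m H = 1%:M.
  have e2 : F^t* = H^t* *m K^t* by rewrite -trmxC_mul -FE.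
  rewrite mulmxDr mulmxDl mulmx1 HH.
  by rewrite mulmxA -[_ *m K *m H]mulmxA -FE -e2 subrK.
apply: esym; apply: invmx_unique.
apply: (can_inj (mulKmx uHJ)); rewrite mulmx1 !mulmxA e mul1mx //.
Qed.

Lemma Kof_surj K : exists2 F, contractive F & Kof F = K.
Proof.
have [F [Z [hZ FE]]] := Y_of_K alpha K.
exists F; first exact: is_Y_contractive hZ.
have [_ _ _ tH] := hZ.
by rewrite /Kof (Y_eq hZ) {1}FE mulmxK // (triG_unit tH).
Qed.

(** [H] is the triangular factor of [(1 + K^* K)^-1], hence depends continuously
    on [K], and [F = K H]. *)
Lemma Kof_cvg (F_ : nat -> 'M[C]_n) F : (forall m, contractive (F_ m)) ->
  contractive F -> mcvg (fun m => Kof (F_ m)) (Kof F) -> mcvg F_ F.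
Proof.
move=> cF_ cF hK.
have cH : mcvg (fun m => drsubmx (Y (F_ m))) (drsubmx (Y F)).
  apply: (chol_cvg (b := alpha true)); [by move=> m; exact: (Y_dr (cF_ m)) | exact: (Y_dr cF) |].
  rewrite (Kof_gram cF) (_ : (fun m => _) = fun m => invmx (1%:M + (Kof (F_ m))^t* *m Kof (F_ m))); last first.
    by apply/funext => m; rewrite (Kof_gram (cF_ m)).
  have u1 (K : 'M[C]_n) : 1%:M + K^t* *m K \in unitmx.
    by have [] := gram1_unit (K^t*); rewrite trmxCK.
  apply: mcvg_inv => //; apply: mcvgD; first exact: mcvg_cst.
  by apply: mcvgM => //; exact: mcvgJ.
rewrite (Kof_mul cF) (_ : F_ = fun m => Kof (F_ m) *m drsubmx (Y (F_ m))).
  exact: mcvgM.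
by apply/funext => m; exact: (Kof_mul (cF_ m)).
Qed.

Lemma Kof_inj F F' : contractive F -> contractive F' -> Kof F = Kof F' -> F = F'.
Proof.
move=> cF cF' e; have h : mcvg (fun=> F) F'.
  by apply: Kof_cvg => //; rewrite e; exact: mcvg_cst.
by apply/matrixP => i j; exact: ccvg_unique (ccvg_cst _) (h i j).
Qed.

Definition Fof K : 'M[C]_n := xget 0 [set F | contractive F /\ Kof F = K].

Lemma FofP K : contractive (Fof K) /\ Kof (Fof K) = K.
Proof.
have [F cF FK] := Kof_surj K.
by apply: (@xgetPex _ 0 [set F | contractive F /\ Kof F = K]); exists F.
Qed.

Lemma Fof_Kof F : contractive F -> Fof (Kof F) = F.
Proof. by move=> cF; have [c1 e1] := FofP (Kof F); exact: Kof_inj. Qed.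

Lemma mcvg_block (A_ B_ D_ E_ : nat -> 'M[C]_n) A B D E :
  mcvg A_ A -> mcvg B_ B -> mcvg D_ D -> mcvg E_ E ->
  mcvg (fun m => block_mx (A_ m) (B_ m) (D_ m) (E_ m)) (block_mx A B D E).
Proof.
move=> hA hB hD hE i j.
case: (split_ordP i) => k ->; case: (split_ordP j) => l ->.
- by rewrite block_mxEul; under eq_fun do rewrite block_mxEul; exact: hA.
- by rewrite block_mxEur; under eq_fun do rewrite block_mxEur; exact: hB.
- by rewrite block_mxEdl; under eq_fun do rewrite block_mxEdl; exact: hD.
- by rewrite block_mxEdr; under eq_fun do rewrite block_mxEdr; exact: hE.
Qed.

Lemma Y_cvg (F_ : nat -> 'M[C]_n) F : (forall m, contractive (F_ m)) ->
  contractive F -> mcvg F_ F -> mcvg (fun m => Y (F_ m)) (Y F).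
Proof.
move=> cF_ cF hF.
have eqs G := is_Y_eqs (YP G).
have cE : mcvg (fun m => ulsubmx (Y (F_ m))) (ulsubmx (Y F)).
  apply: (chol_cvg (b := alpha false)); [by move=> m; exact: (Y_ul (cF_ m)) | exact: (Y_ul cF) |].
  have [-> _ _ _] := eqs _ cF.
  rewrite (_ : (fun m => _) = fun m => 1%:M - F_ m *m (F_ m)^t*); last first.
    by apply/funext => m; have [] := eqs _ (cF_ m).
  by apply: mcvgB; [exact: mcvg_cst | apply: mcvgM => //; exact: mcvgJ].
have cH : mcvg (fun m => (drsubmx (Y (F_ m)))^t*) ((drsubmx (Y F))^t*).
  apply: (chol_cvg (b := ~~ alpha true)); [by move=> m; exact: (triG_J (Y_dr (cF_ m))) | exact: (triG_J (Y_dr cF)) |].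
  rewrite trmxCK; have [_ -> _ _] := eqs _ cF.
  rewrite (_ : (fun m => _) = fun m => 1%:M - (F_ m)^t* *m F_ m); last first.
    by apply/funext => m; rewrite trmxCK; have [] := eqs _ (cF_ m).
  by apply: mcvgB; [exact: mcvg_cst | apply: mcvgM => //; exact: mcvgJ].
have YE G : contractive G -> Y G = block_mx (ulsubmx (Y G)) G
    (- (invmx ((drsubmx (Y G))^t*) *m G^t* *m ulsubmx (Y G))) (drsubmx (Y G)).
  move=> cG; rewrite {1}(is_Y_block (YP cG)).
  by have [_ _ -> _] := eqs _ cG.
rewrite (YE _ cF); have -> := funext (fun m => YE _ (cF_ m)).
apply: mcvg_block => //; last first.
  by have := mcvgJ cH; rewrite trmxCK; under eq_fun do rewrite trmxCK.
rewrite -[- _]sub0r; under eq_fun do rewrite -[- _]sub0r.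
apply: mcvgB; first exact: mcvg_cst.
apply: mcvgM => //; apply: mcvgM; last exact: mcvgJ.
apply: mcvg_inv => //.
  by move=> m; rewrite unitmxJ (triG_unit (Y_dr (cF_ m))).
by rewrite unitmxJ (triG_unit (Y_dr cF)).
Qed.

(** * Diagonal entries and determinants of Y(F) *)

Definition dE F i : R := complex.Re (ulsubmx (Y F) i i).
Definition dH F i : R := complex.Re (drsubmx (Y F) i i).
Definition delta F : R := complex.Re (\det (ulsubmx (Y F))).

Lemma dE_eq F i : contractive F -> ulsubmx (Y F) i i = (dE F i)%:C%C.
Proof. by move=> cF; rewrite -pos_realE //; exact: triG_diag (Y_ul cF). Qed.

Lemma dH_eq F i : contractive F -> drsubmx (Y F) i i = (dH F i)%:C%C.
Proof. by move=> cF; rewrite -pos_realE //; exact: triG_diag (Y_dr cF). Qed.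

Lemma Re_unitary_le1 p (U : 'M[C]_p) i j : U \is unitarymx -> complex.Re (U i j) <= 1.
Proof.
move=> uU; have h := le_trans (Re_le_sq _) (sq_unitary_le1 i j uU).
by apply: le_trans (ler_norm _) _; rewrite -(expr_le1 (ltn0Sn 1)) // real_normK ?num_real.
Qed.

Lemma dE01 F i : contractive F -> 0 < dE F i <= 1.
Proof.
move=> cF; rewrite pos_Re ?(triG_diag _ (Y_ul cF)) //=.
by rewrite /dE !mxE Re_unitary_le1 // Y_unitary.
Qed.

Lemma dH01 F i : contractive F -> 0 < dH F i <= 1.
Proof.
move=> cF; rewrite pos_Re ?(triG_diag _ (Y_dr cF)) //=.
by rewrite /dH !mxE Re_unitary_le1 // Y_unitary.
Qed.

Lemma delta_eq F : contractive F -> \det (ulsubmx (Y F)) = (delta F)%:C%C.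
Proof. by move=> cF; rewrite -pos_realE //; exact: triG_det_gt0 (Y_ul cF). Qed.

Lemma delta_dE F : contractive F -> delta F = \prod_i dE F i.
Proof.
move=> cF; apply: (@complexI R); rewrite -delta_eq // (triG_det (Y_ul cF)) rmorph_prod.
by apply: eq_bigr => i _; exact: dE_eq.
Qed.

Lemma delta_dH F : contractive F -> delta F = \prod_i dH F i.
Proof.
move=> cF; apply: (@complexI R); rewrite -delta_eq //.
have [_ _ _ ->] := is_Y_eqs (YP cF).
rewrite (triG_det (Y_dr cF)) rmorph_prod.
by apply: eq_bigr => i _; exact: dH_eq.
Qed.

Lemma delta_gt0 F : contractive F -> 0 < delta F.
Proof. by move=> cF; apply/pos_Re/(triG_det_gt0 (Y_ul cF)). Qed.

Lemma prod_le_factor (x : 'I_n -> R) i : (forall j, 0 < x j <= 1) -> \prod_j x j <= x i.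
Proof.
move=> hx; rewrite (bigD1 i) //= ler_piMr //; first by have /andP [/ltW] := hx i.
by apply: prodr_ile1 => j _; have /andP [/ltW -> ->] := hx j.
Qed.

Lemma delta_le_dE F i : contractive F -> delta F <= dE F i.
Proof. by move=> cF; rewrite delta_dE //; apply: prod_le_factor => j; exact: dE01. Qed.

Lemma delta_le_dH F i : contractive F -> delta F <= dH F i.
Proof. by move=> cF; rewrite delta_dH //; apply: prod_le_factor => j; exact: dH01. Qed.

Lemma delta_le1 F : contractive F -> delta F <= 1.
Proof.
move=> cF; rewrite delta_dE //; apply: prodr_ile1 => i _.
by have /andP [/ltW -> ->] := dE01 i cF.
Qed.

(** [delta^2] is the determinant of [1 - F^* F]. *)
Lemma delta_sqr_ge F : contractive F -> 1 - hs2 F <= delta F ^+ 2.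
Proof.
move=> cF; have [d [dd hd]] := det_gram (fun v v1 => ltW (contractive_lt cF v1)).
suff -> : delta F ^+ 2 = d by [].
apply: (@complexI R); rewrite -dd rmorphXn /= -delta_eq //.
have [_ <- _ eH] := is_Y_eqs (YP cF).
rewrite det_mulmx det_trJ -eH pos_conj ?expr2 //.
exact: triG_det_gt0 (Y_ul cF).
Qed.

Lemma delta_ge F : contractive F -> 1 - hs2 F <= delta F.
Proof.
move=> cF; apply: le_trans (delta_sqr_ge cF) _.
by rewrite expr2 ler_piMl ?delta_le1 // ltW // delta_gt0.
Qed.

(** The rows of [E E^* = 1 - F F^*] give [E_ii^2 <= 1 - |F_i|^2 <= exp (- |F_i|^2)]
    for each row [F_i] of [F]. *)
Lemma delta_sqr_le F : contractive F -> delta F ^+ 2 <= expR (- hs2 F).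
Proof.
move=> cF; rewrite delta_dE // -prodrXl /hs2 -sumrN expR_sum.
apply: ler_prod => i _; rewrite sqr_ge0 /=.
apply: le_trans (expR_ge1Dx _).
have [/matrixP /(_ i i) e _ _ _] := is_Y_eqs (YP cF).
have rowsq (A : 'M[C]_n) : (A *m A^t*) i i = (\sum_j sq (A i j))%:C%C.
  by rewrite mxE rmorph_sum; apply: eq_bigr => j _; rewrite trmxCE mulcJ.
rewrite subr_mxE !rowsq mxE eqxx in e.
have {}e : \sum_j sq (ulsubmx (Y F) i j) = 1 - \sum_j sq (F i j).
  by apply: (@complexI R); rewrite e rmorphB.
rewrite -e (bigD1 i) //= dE_eq // sq_real lerDl.
by apply: sumr_ge0 => j _; exact: sq_ge0.
Qed.

Lemma hs2_le_ln_delta F : contractive F -> hs2 F <= - 2 * ln (delta F).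
Proof.
move=> cF; have d0 := delta_gt0 cF.
have := delta_sqr_le cF; rewrite -ler_ln ?posrE ?exprn_gt0 ?expR_gt0 // expRK.
rewrite lnXn // -mulr_natl; lra.
Qed.

End YFunction.

(** * Conjugation by powers of Z *)

Section Zconj.
Variables (R : realType) (n : nat).
Local Notation C := R[i].
Local Notation M2n := 'M[C]_(n + n).
Implicit Types (A B : M2n) (z : circle R) (j k : int).

(** Conjugation by [Z^j] is conjugation by [diag (z^j, 1)], as the two differ by
    a scalar; this avoids square roots of [z]. *)
Definition Zmat z j : M2n := block_mx (sval z ^ j)%:M 0 0 1%:M.

Lemma expz_conj z j : (sval z ^ j)^* = sval z ^ (- j) :> C.
Proof.
apply: (mulfI (expfz_neq0 j (circle_neq0 z))).
by rewrite mulcJ sq_exprz -expfzDr ?circle_neq0 // subrr expr0z.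
Qed.

Lemma Zmat_mul z j k : Zmat z j *m Zmat z k = Zmat z (j + k).
Proof.
rewrite /Zmat mulmx_block !mulmx0 !mul0mx !addr0 !add0r mulmx1 -scalar_mxM.
by rewrite expfzDr // circle_neq0.
Qed.

Lemma Zmat0 z : Zmat z 0 = 1%:M.
Proof. by rewrite /Zmat expr0z -scalar_mx_block. Qed.

Lemma ZmatJ z j : (Zmat z j)^t* = Zmat z (- j).
Proof.
rewrite /Zmat blockJ trmx0 map_mx0 trmxC1 tr_scalar_mx map_scalar_mx.
by rewrite -expz_conj.
Qed.

Lemma Zmat_unitary z j : Zmat z j \is unitarymx.
Proof. by apply/unitarymxP; rewrite ZmatJ Zmat_mul subrr Zmat0. Qed.

Lemma ZconjE z j A : Zconj z j A = Zmat z j *m A *m Zmat z (- j).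
Proof.
rewrite -[A in RHS]submxK /Zmat.
have l (a b : 'M[C]_n) E F G H : block_mx a 0 0 b *m block_mx E F G H =
    block_mx (a *m E) (a *m F) (b *m G) (b *m H).
  by rewrite mulmx_block !mul0mx !addr0 !add0r.
have r (a b : 'M[C]_n) E F G H : block_mx E F G H *m block_mx a 0 0 b =
    block_mx (E *m a) (F *m b) (G *m a) (H *m b).
  by rewrite mulmx_block !mulmx0 !addr0 !add0r.
rewrite l r !mul1mx !mulmx1 !mul_scalar_mx !mul_mx_scalar scalerA.
by rewrite -expfzDr ?circle_neq0 // addrC subrr expr0z scale1r.
Qed.

Lemma Zconj_mul z j A B : Zconj z j (A *m B) = Zconj z j A *m Zconj z j B.
Proof.
rewrite !ZconjE -!mulmxA [Zmat z (- j) *m (_ *m _)]mulmxA Zmat_mul addNr Zmat0.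
by rewrite mul1mx.
Qed.

Lemma ZconjB z j A B : Zconj z j (A - B) = Zconj z j A - Zconj z j B.
Proof. by rewrite !ZconjE mulmxBr mulmxBl. Qed.

Lemma Zconj1 z j : Zconj z j 1%:M = 1%:M :> M2n.
Proof. by rewrite ZconjE mulmx1 Zmat_mul subrr Zmat0. Qed.

Lemma Zconj0 z A : Zconj z 0 A = A.
Proof. by rewrite ZconjE oppr0 Zmat0 mulmx1 mul1mx. Qed.

Lemma Zconj_add z j k A : Zconj z j (Zconj z k A) = Zconj z (j + k) A.
Proof.
rewrite !ZconjE !mulmxA Zmat_mul -[_ *m A *m _ *m _]mulmxA Zmat_mul.
by rewrite opprD addrC [- j - k]addrC.
Qed.

Lemma det_Zconj z j A : \det (Zconj z j A) = \det A.
Proof.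
rewrite ZconjE !det_mulmx mulrAC -det_mulmx Zmat_mul subrr Zmat0 det1.
by rewrite mul1r.
Qed.

Lemma hs2_Zconj z j A : hs2 (Zconj z j A) = hs2 A.
Proof. by rewrite ZconjE hs2_mulr ?hs2_mull ?Zmat_unitary. Qed.

Lemma SU_mul A B : SU A -> SU B -> SU (A *m B).
Proof.
move=> [uA dA] [uB dB]; split; first exact: mul_unitarymx.
by rewrite det_mulmx dA dB mulr1.
Qed.

Lemma SU_J A : SU A -> SU (A^t*).
Proof. by move=> [uA dA]; split; [rewrite trmxC_unitary | rewrite det_trJ dA rmorph1]. Qed.

Lemma SU1 : SU (1%:M : M2n).
Proof. by split; [exact: unitary1 | exact: det1]. Qed.

Lemma SU_Zconj z j A : SU A -> SU (Zconj z j A).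
Proof.
move=> [uA dA]; split; last by rewrite det_Zconj.
by rewrite ZconjE !mul_unitarymx ?Zmat_unitary.
Qed.

Lemma Zconj_ul z j A (i l : 'I_n) : Zconj z j A (lshift n i) (lshift n l) = A (lshift n i) (lshift n l).
Proof. by rewrite /Zconj block_mxEul !mxE. Qed.

Lemma Zconj_ur z j A (i l : 'I_n) :
  Zconj z j A (lshift n i) (rshift n l) = sval z ^ j * A (lshift n i) (rshift n l).
Proof. by rewrite /Zconj block_mxEur !mxE. Qed.

Lemma Zconj_dl z j A (i l : 'I_n) :
  Zconj z j A (rshift n i) (lshift n l) = sval z ^ (- j) * A (rshift n i) (lshift n l).
Proof. by rewrite /Zconj block_mxEdl !mxE. Qed.

Lemma Zconj_dr z j A (i l : 'I_n) : Zconj z j A (rshift n i) (rshift n l) = A (rshift n i) (rshift n l).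
Proof. by rewrite /Zconj block_mxEdr !mxE. Qed.

Lemma split_ind (P : 'I_(n + n) -> Prop) :
  (forall i, P (lshift n i)) -> (forall i, P (rshift n i)) -> forall i, P i.
Proof. by move=> h1 h2 i; case: (split_ordP i) => k ->. Qed.

Lemma meas_Zconj j (M : circle R -> M2n) : mx_measurable M ->
  mx_measurable (fun z => Zconj z j (M z)).
Proof.
move=> mM; elim/split_ind => i; elim/split_ind => l.
- by under eq_fun do rewrite Zconj_ul.
- by under eq_fun do rewrite Zconj_ur; apply: measM => //; exact: meas_exprz.
- by under eq_fun do rewrite Zconj_dl; apply: measM => //; exact: meas_exprz.
- by under eq_fun do rewrite Zconj_dr.
Qed.

Lemma meas_mulmx p q s (A : circle R -> 'M[C]_(p, q)) (B : circle R -> 'M[C]_(q, s)) :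
  mx_measurable A -> mx_measurable B -> mx_measurable (fun z => A z *m B z).
Proof.
move=> mA mB i l; under eq_fun do rewrite mxE.
by apply: meas_sum => k; exact: measM.
Qed.

Lemma mmeas_cst p q (A : 'M[C]_(p, q)) : mx_measurable (fun=> A).
Proof. by move=> i l; exact: meas_cst. Qed.

Lemma mmeasJ p q (A : circle R -> 'M[C]_(p, q)) : mx_measurable A ->
  mx_measurable (fun z => (A z)^t*).
Proof. by move=> mA i l; under eq_fun do rewrite trmxCE; exact: measJ. Qed.

End Zconj.

(** * Block columns analytic outside and inside the disc *)

Section Analytic.
Variables (R : realType) (n : nat).
Local Notation C := R[i].
Local Notation M2n := 'M[C]_(n + n).
Implicit Types (M : circle R -> M2n).

(** The left columns are boundary values of functions analytic outside the
    disc, the right ones inside; this only constrains columns, hence is stable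
    under left multiplication by constants. *)
Definition colH M :=
  (forall i l, AH2 (fun z => (M z i (lshift n l))^*)) /\
  (forall i l, AH2 (fun z => M z i (rshift n l))).

Lemma colH_mL2 M : colH M -> mL2 M.
Proof.
move=> [hl hr] i; elim/split_ind => l; last exact: AH2_L2.
have := L2J (AH2_L2 (hl i l)); congr L2; apply/funext => z; exact: conjCK.
Qed.

Lemma colH_cst (A : M2n) : colH (fun=> A).
Proof. by split=> i l; exact: AH2_cst. Qed.

Lemma colH_mull (A : M2n) M : colH M -> colH (fun z => A *m M z).
Proof.
move=> [hl hr]; split=> i l.
  rewrite (_ : (fun z => _) = fun z => \sum_k (A i k)^* * (M z k (lshift n l))^*).
    by apply: AH2_sum => k; exact: AH2Z.
  by apply/funext => z; rewrite mxE rmorph_sum; apply: eq_bigr => k _; rewrite rmorphM.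
rewrite (_ : (fun z => _) = fun z => \sum_k A i k * M z k (rshift n l)).
  by apply: AH2_sum => k; exact: AH2Z.
by apply/funext => z; rewrite mxE.
Qed.

Lemma mmean_mull p q s (A : 'M[C]_(p, q)) (N : circle R -> 'M[C]_(q, s)) : mL2 N ->
  mmean (fun z => A *m N z) = A *m mmean N.
Proof.
move=> hN; apply/matrixP => i l; rewrite !mxE.
under eq_fun do rewrite mxE.
rewrite cmean_sum => [|k]; last exact/cintegZ/L2_cinteg.
by apply: eq_bigr => k _; rewrite cmeanZ ?mxE //; exact: L2_cinteg.
Qed.

Lemma colH_Zconj1 M : colH M -> colH (fun z => Zconj z 1 (M z)).
Proof.
move=> [hl hr]; split; elim/split_ind => i l.
- by under eq_fun do rewrite Zconj_ul.
- under eq_fun do rewrite Zconj_dl rmorphM /= expz_conj opprK.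
  exact: (AH2M_exp 1).
- by under eq_fun do rewrite Zconj_ur; exact: (AH2M_exp 1).
- by under eq_fun do rewrite Zconj_dr.
Qed.

Lemma cmean_conj (f : circle R -> C) : AH2 (fun z => (f z)^*) ->
  cmean f = (cmean (fun z => (f z)^*))^*.
Proof.
move=> hf; rewrite -cmeanJ; last exact: AH2_cinteg.
by congr cmean; apply/funext => z; rewrite conjCK.
Qed.

(** The off-diagonal blocks gain a zero at the origin or at infinity. *)
Lemma mmean_Zconj1 M : colH M -> mmean (fun z => Zconj z 1 (M z)) =
  block_mx (ulsubmx (mmean M)) 0 0 (drsubmx (mmean M)).
Proof.
move=> hM; have [hl hr] := hM; apply/matrixP; elim/split_ind => i; elim/split_ind => l.
- rewrite block_mxEul !mxE; by under eq_fun do rewrite Zconj_ul.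
- rewrite block_mxEur !mxE; under eq_fun do rewrite Zconj_ur.
  exact: (cmean_exp_AH2 (k := 1)).
- rewrite block_mxEdl !mxE cmean_conj; last by case: (colH_Zconj1 hM).
  under eq_fun do rewrite Zconj_dl rmorphM /= expz_conj opprK.
  by rewrite (cmean_exp_AH2 (k := 1)) ?rmorph0.
- rewrite block_mxEdr !mxE; by under eq_fun do rewrite Zconj_dr.
Qed.

(** Left and right columns are orthogonal pointwise, and products of analytic
    functions pass to the means. *)
Lemma mmean_orth M : colH M -> circle_ae (fun z => M z \is unitarymx) ->
  (ulsubmx (mmean M))^t* *m ursubmx (mmean M) +
  (dlsubmx (mmean M))^t* *m drsubmx (mmean M) = 0.
Proof.
move=> hM uM; have [hl hr] := hM; have h2 := colH_mL2 hM.
apply/matrixP => i l; rewrite mxE [(_ *m _) i l]mxE [X in _ + X]mxE [RHS]mxE.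
have e0 : 0 = cmean (fun z => \sum_k (M z k (lshift n i))^* * M z k (rshift n l)).
  rewrite -[LHS](cmean_cst (R := R) 0); apply: cmean_ae; first exact: meas_cst.
    apply: meas_sum => k; apply: measM; last exact: AH2_meas.
    exact: (AH2_meas (hl k i)).
  apply: (circle_aeS uM) => z uz; have /matrixP /(_ (lshift n i) (rshift n l)) := unitaryE' uz.
  rewrite block1 block_mxEur mxE [RHS]mxE => e.
  apply: esym; apply: etrans e; apply: eq_bigr => k _; by rewrite trmxCE.
rewrite [RHS]e0 cmean_sum => [|k]; last first.
  by apply: L2M_cinteg; [exact: AH2_L2 (hl k i) | exact: h2].
rewrite big_split_ord /=; congr (_ + _); apply: eq_bigr => k _.
  rewrite trmxCE !mxE AH2_cmeanM //; congr (_ * _).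
  by rewrite cmean_conj // conjCK.
rewrite trmxCE !mxE AH2_cmeanM //; congr (_ * _).
by rewrite cmean_conj // conjCK.
Qed.

Lemma mnrm_mull (U : M2n) M : U \is unitarymx ->
  mnrm (fun z => U *m M z) = mnrm M.
Proof. by move=> uU; congr mean; apply/funext => z; rewrite hs2_mull. Qed.

Lemma mnrm_Zconj j M : mnrm (fun z => Zconj z j (M z)) = mnrm M.
Proof. by congr mean; apply/funext => z; rewrite hs2_Zconj. Qed.

Lemma mL2_mull (A : M2n) M : mL2 M -> mL2 (fun z => A *m M z).
Proof.
move=> hM i l; under eq_fun do rewrite mxE.
by apply: L2_sum => k; exact: L2Z.
Qed.

Lemma mL2_Zconj j M : mL2 M -> mL2 (fun z => Zconj z j (M z)).
Proof.
move=> hM; elim/split_ind => i; elim/split_ind => l.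
- by under eq_fun do rewrite Zconj_ul.
- by under eq_fun do rewrite Zconj_ur; exact: L2M_exprz.
- by under eq_fun do rewrite Zconj_dl; exact: L2M_exprz.
- by under eq_fun do rewrite Zconj_dr.
Qed.

Lemma mnrm_mull_sub (U V : M2n) M N : U \is unitarymx -> mL2 M -> mL2 N ->
  circle_ae (fun z => N z \is unitarymx) ->
  mnrm (fun z => U *m M z - V *m N z) <=
  2 * mnrm (fun z => M z - N z) + 2 * hs2 (U - V).
Proof.
move=> uU hM hN uN.
have := mnrmB_le (mL2_mull U hM) (mL2_mull U hN) (mL2_mull V hN).
move=> /le_trans; apply; apply: lerD; rewrite ler_wpM2l //.
  by under eq_fun do rewrite -mulmxBr; rewrite mnrm_mull.
rewrite -[leRHS](mean_cst (R := R)).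
rewrite le_eqVlt; apply/orP; left; apply/eqP; apply: mean_ae.
- by apply: rmeas_hs2; apply: mmeasB; apply: mL2_meas; exact: mL2_mull.
- exact: (integ_rmeas (integ_cst _)).
- by apply: (circle_aeS uN) => z uz; rewrite -mulmxBl hs2_mulr.
Qed.

Lemma colH_lim (M_ : nat -> circle R -> M2n) M : (forall m, colH (M_ m)) -> mL2 M ->
  (fun m => mnrm (fun z => M_ m z - M z)) @ \oo --> (0 : R) -> colH M.
Proof.
move=> hM_ hM /cvg0P h; have {}h := h (fun m => mnrm_ge0 _).
split=> i l.
  apply: AH2_lim; first exact: L2J.
  move=> e /h [N /(_ N (leqnn N)) hN]; exists (fun z => (M_ N z i (lshift n l))^*).
    by case: (hM_ N).
  apply: le_lt_trans hN; have hd := mL2B (colH_mL2 (hM_ N)) hM.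
  apply: le_trans (nrm2_le_mnrm i (lshift n l) hd); rewrite le_eqVlt; apply/orP; left; apply/eqP.
  by congr mean; apply/funext => z; rewrite -rmorphB sqJ -sqN opprB subr_mxE.
apply: AH2_lim; first exact: hM.
move=> e /h [N /(_ N (leqnn N)) hN]; exists (fun z => M_ N z i (rshift n l)).
  by case: (hM_ N).
apply: le_lt_trans hN; have hd := mL2B (colH_mL2 (hM_ N)) hM.
apply: le_trans (nrm2_le_mnrm i (rshift n l) hd); rewrite le_eqVlt; apply/orP; left; apply/eqP.
by congr mean; apply/funext => z; rewrite -sqN opprB subr_mxE.
Qed.

Lemma mmean_cvg p q (M_ : nat -> circle R -> 'M[C]_(p, q)) (M : circle R -> 'M[C]_(p, q)) :
  (forall m, mL2 (M_ m)) -> mL2 M ->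
  (fun m => mnrm (fun z => M_ m z - M z)) @ \oo --> (0 : R) ->
  mcvg (fun m => mmean (M_ m)) (mmean M).
Proof.
move=> hM_ hM h i l; apply: squeeze0 h => m; first exact: sq_ge0.
exact: mmean_sub_le.
Qed.

End Analytic.

Section Layers.
Variables (R : realType) (n : nat) (alpha : bool -> bool).
Local Notation C := R[i].
Local Notation M2n := 'M[C]_(n + n).
Local Notation Y := (@Y R n alpha).
Implicit Types (M N : circle R -> M2n) (F : 'M[C]_n).

(** The space of the theorem without its maximality condition, with the values
    at infinity and at zero written as means. *)
Definition preH M := [/\ mx_measurable M, circle_ae (fun z => SU (M z)), colH M,
  triG (alpha false) (ulsubmx (mmean M)) & triG (alpha true) (drsubmx (mmean M))].

Lemma preH_colH M : preH M -> colH M. Proof. by case. Qed.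

Lemma preH_mL2 M : preH M -> mL2 M. Proof. by move=> /preH_colH; exact: colH_mL2. Qed.

Lemma preH_unitary M : preH M -> circle_ae (fun z => M z \is unitarymx).
Proof. by case=> _ h _ _ _; apply: (circle_aeS h) => z []. Qed.

Lemma preH1 : preH (fun=> 1%:M).
Proof.
have e : mmean (fun _ : circle R => 1%:M : M2n) = 1%:M.
  by apply/matrixP => i j; rewrite mxE cmean_cst.
split.
- exact: mmeas_cst.
- by apply: circle_aeT => z; exact: SU1.
- exact: colH_cst.
- by rewrite e block1 block_mxKul; exact: triG1.
- by rewrite e block1 block_mxKdr; exact: triG1.
Qed.

(** * Layer stripping: adding and removing the first factor *)

Definition unstrip F M (z : circle R) : M2n := Y F *m Zconj z 1 (M z).

Lemma colH_unstrip F M : colH M -> colH (unstrip F M).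
Proof. by move=> hM; apply: colH_mull; exact: colH_Zconj1. Qed.

Lemma mmean_unstrip F M : colH M -> mmean (unstrip F M) =
  Y F *m block_mx (ulsubmx (mmean M)) 0 0 (drsubmx (mmean M)).
Proof.
move=> hM; rewrite -mmean_Zconj1 // -mmean_mull //.
exact/colH_mL2/colH_Zconj1.
Qed.

Lemma ul_unstrip F M : colH M ->
  ulsubmx (mmean (unstrip F M)) = ulsubmx (Y F) *m ulsubmx (mmean M).
Proof.
move=> hM; rewrite mmean_unstrip // -{1}(submxK (Y F)) mulmx_block block_mxKul.
by rewrite mulmx0 addr0.
Qed.

Lemma dr_unstrip F M : colH M ->
  drsubmx (mmean (unstrip F M)) = drsubmx (Y F) *m drsubmx (mmean M).
Proof.
move=> hM; rewrite mmean_unstrip // -{1}(submxK (Y F)) mulmx_block block_mxKdr.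
by rewrite mulmx0 add0r.
Qed.

Lemma ur_unstrip F M : colH M -> contractive F ->
  ursubmx (mmean (unstrip F M)) = F *m drsubmx (mmean M).
Proof.
move=> hM cF; rewrite mmean_unstrip // -{1}(submxK (Y F)) mulmx_block block_mxKur.
by rewrite mulmx0 add0r Y_ur.
Qed.

Lemma SU_Y F : contractive F -> SU (Y F).
Proof. by move=> /(YP alpha) []. Qed.

Lemma preH_unstrip F M : contractive F -> preH M -> preH (unstrip F M).
Proof.
move=> cF [mM sM hM t1 t2]; split.
- by apply: meas_mulmx; [exact: mmeas_cst | exact: meas_Zconj].
- by apply: (circle_aeS sM) => z sz; apply: SU_mul; [exact: SU_Y | exact: SU_Zconj].
- exact: colH_unstrip.
- by rewrite ul_unstrip //; apply: triG_mul => //; exact: Y_ul.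
- by rewrite dr_unstrip //; apply: triG_mul => //; exact: Y_dr.
Qed.

(** [B(0) D(0)^-1] is the coordinate [K] of the first coefficient. *)
Definition coef0 M : 'M[C]_n :=
  Fof alpha (ursubmx (mmean M) *m invmx (drsubmx (mmean M))).

Definition strip M (z : circle R) : M2n :=
  Zconj z (-1) ((Y (coef0 M))^t* *m M z).

Lemma coef0_contractive M : contractive (coef0 M).
Proof. by have [] := FofP alpha (ursubmx (mmean M) *m invmx (drsubmx (mmean M))). Qed.

Lemma coef0_unstrip F M : contractive F -> preH M -> coef0 (unstrip F M) = F.
Proof.
move=> cF [_ _ hM _ t2]; rewrite /coef0 ur_unstrip // dr_unstrip //.
have u1 := triG_unit t2; have u2 := triG_unit (Y_dr alpha cF).
by rewrite invmx_mul // mulmxA -[F *m _ *m _]mulmxA mulmxV // mulmx1 Fof_Kof.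
Qed.

Lemma coef0_ae M N : mx_measurable M -> mx_measurable N -> ae_equal M N ->
  coef0 M = coef0 N.
Proof. by move=> mM mN MN; rewrite /coef0 (mmean_ae mM mN MN). Qed.

Lemma stripK M z : unstrip (coef0 M) (strip M) z = M z.
Proof.
rewrite /unstrip /strip Zconj_add addrN Zconj0 mulmxA unitaryE ?mul1mx //.
exact/Y_unitary/coef0_contractive.
Qed.

Lemma strip_unstrip F M : contractive F -> preH M ->
  forall z, strip (unstrip F M) z = M z.
Proof.
move=> cF hM z; rewrite /strip coef0_unstrip // /unstrip mulmxA unitaryE' ?Y_unitary //.
by rewrite mul1mx Zconj_add addNr Zconj0.
Qed.

Lemma strip_ae M N : mx_measurable M -> mx_measurable N -> ae_equal M N ->
  ae_equal (strip M) (strip N).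
Proof.
move=> mM mN MN; have c := coef0_ae mM mN MN.
by apply: ae_equalS MN _ => z e; rewrite /strip c e.
Qed.

Lemma meas_strip M : mx_measurable M -> mx_measurable (strip M).
Proof.
by move=> mM; apply: meas_Zconj; apply: meas_mulmx => //; exact: mmeas_cst.
Qed.

(** The choice of the first coefficient makes the two off-diagonal blocks of
    the mean of [Y^* M] vanish: the upper right one by definition, the lower
    left one by orthogonality of the columns. *)
Lemma strip_offdiag M : preH M ->
  let P := (Y (coef0 M))^t* *m mmean M in ursubmx P = 0 /\ dlsubmx P = 0.
Proof.
move=> hM; have [_ _ cM t1 t2] := hM.
set F := coef0 M => P; have cF : contractive F := coef0_contractive M.
have FK : Kof alpha F = ursubmx (mmean M) *m invmx (drsubmx (mmean M)).
  by have [] := FofP alpha (ursubmx (mmean M) *m invmx (drsubmx (mmean M))).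
have o := mmean_orth cM (preH_unitary hM).
set a := ulsubmx (mmean M) in o t1; set b := ursubmx (mmean M) in o FK.
set c := dlsubmx (mmean M) in o; set d := drsubmx (mmean M) in o FK t2.
have ud := triG_unit t2.
have bK : b = Kof alpha F *m d by rewrite FK mulmxKV.
have FE := Kof_mul alpha cF; move: (Kof alpha F) FE bK {FK} => K FE bK.
have uH := triG_unit (Y_dr alpha cF).
have YE := is_Y_block (YP alpha cF).
have [_ _ _ e] : [/\ _, _, _ & _] := unitary_block (eq_ind _ (fun A => A \is unitarymx) (Y_unitary alpha cF) _ YE).
have PE : P = block_mx ((ulsubmx (Y F))^t* *m a + (dlsubmx (Y F))^t* *m c)
  ((ulsubmx (Y F))^t* *m b + (dlsubmx (Y F))^t* *m d)
  (F^t* *m a + (drsubmx (Y F))^t* *m c) (F^t* *m b + (drsubmx (Y F))^t* *m d).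
  by rewrite /P {1}YE blockJ -{1}(submxK (mmean M)) mulmx_block.
rewrite PE block_mxKur block_mxKdl {PE}; clearbody a b c d; split.
  rewrite bK mulmxA -mulmxDl.
  have -> : (ulsubmx (Y F))^t* *m K + (dlsubmx (Y F))^t* = 0; last exact: mul0mx.
  apply: (can_inj (mulmxK uH)); rewrite mul0mx mulmxDl -mulmxA -FE.
  exact: e.
have : a^t* *m K + c^t* = 0.
  by apply: (can_inj (mulmxK ud)); rewrite mul0mx mulmxDl -mulmxA -bK.
move=> /(congr1 (fun A : 'M[C]_n => A^t*)).
rewrite linearD /= map_mxD trmxC_mul !trmxCK trmx0 map_mx0 => h.
have -> : F^t* = (drsubmx (Y F))^t* *m K^t* by rewrite -trmxC_mul -FE.
by rewrite -mulmxA -mulmxDr h mulmx0.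
Qed.

(** The off-diagonal blocks of [Y^* M] have mean zero, hence stay analytic after
    division by [z]. *)
Lemma colH_strip M : preH M -> colH (strip M).
Proof.
move=> hM; have [_ _ cM _ _] := hM.
have [z1 z2] := strip_offdiag hM.
set F := coef0 M in z1 z2; set N := fun z => (Y F)^t* *m M z.
have cN : colH N by exact: colH_mull.
have mN : mmean N = (Y F)^t* *m mmean M by apply: mmean_mull; exact: colH_mL2.
rewrite -mN in z1 z2; have [hl hr] := cN.
split; elim/split_ind => i l.
- by rewrite /strip; under eq_fun do rewrite Zconj_ul.
- rewrite /strip; under eq_fun do rewrite Zconj_dl rmorphM /= expz_conj.
  apply: AH2_divz => //.
  have := congr1 (fun A : 'M[C]_n => A i l) z2; rewrite !mxE => e.
  by rewrite -[LHS]conjCK -cmean_conj // e rmorph0.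
- rewrite /strip; under eq_fun do rewrite Zconj_ur.
  apply: AH2_divz => //.
  by have := congr1 (fun A : 'M[C]_n => A i l) z1; rewrite !mxE.
- by rewrite /strip; under eq_fun do rewrite Zconj_dr.
Qed.

Lemma ul_strip M : preH M ->
  ulsubmx (mmean M) = ulsubmx (Y (coef0 M)) *m ulsubmx (mmean (strip M)).
Proof.
move=> hM; rewrite -ul_unstrip; last exact: colH_strip.
by congr (ulsubmx (mmean _)); apply/funext => z; rewrite stripK.
Qed.

Lemma dr_strip M : preH M ->
  drsubmx (mmean M) = drsubmx (Y (coef0 M)) *m drsubmx (mmean (strip M)).
Proof.
move=> hM; rewrite -dr_unstrip; last exact: colH_strip.
by congr (drsubmx (mmean _)); apply/funext => z; rewrite stripK.
Qed.

Lemma triG_cancel b (A B : 'M[C]_n) : triG b A -> triG b (A *m B) -> triG b B.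
Proof.
move=> tA tAB; rewrite -(mulKmx (triG_unit tA) B).
by apply: triG_mul => //; exact: triG_inv.
Qed.

Lemma preH_strip M : preH M -> preH (strip M).
Proof.
move=> hM; have [mM sM cM t1 t2] := hM.
have c0 := coef0_contractive M.
split.
- exact: meas_strip.
- apply: (circle_aeS sM) => z sz; apply: SU_Zconj; apply: SU_mul => //.
  exact/SU_J/SU_Y.
- exact: colH_strip.
- by apply: (triG_cancel (Y_ul alpha c0)); rewrite -ul_strip.
- by apply: (triG_cancel (Y_dr alpha c0)); rewrite -dr_strip.
Qed.

(** * Continuity of adding and removing a factor *)

Lemma trmxCB p q (A B : 'M[C]_(p, q)) : (A - B)^t* = A^t* - B^t*.
Proof. by apply/matrixP => i j; rewrite trmxCE !subr_mxE !trmxCE rmorphB. Qed.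

Lemma hs2B_J p q (A B : 'M[C]_(p, q)) : hs2 (A^t* - B^t*) = hs2 (A - B).
Proof. by rewrite -trmxCB hs2J. Qed.

Lemma mcvg_hs2 p q (A_ : nat -> 'M[C]_(p, q)) (A : 'M[C]_(p, q)) :
  mcvg A_ A -> (fun m => hs2 (A_ m - A)) @ \oo --> (0 : R).
Proof.
move=> h; have -> : (0 : R) = \sum_(i < p) \sum_(j < q) 0 by rewrite big1 // => i _; rewrite big1.
apply: cvg_sumR => i; apply: cvg_sumR => j.
by have := h i j; rewrite /ccvg; under eq_fun do rewrite -subr_mxE.
Qed.

Definition mlim (M_ : nat -> circle R -> M2n) M :=
  (fun m => mnrm (fun z => M_ m z - M z)) @ \oo --> (0 : R).

Lemma cvg_lin2 (x y : nat -> R) : x @ \oo --> (0 : R) -> y @ \oo --> (0 : R) ->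
  (fun m => 2 * x m + 2 * y m) @ \oo --> (0 : R).
Proof.
move=> hx hy; have -> : (0 : R) = 2 * 0 + 2 * 0 by rewrite mulr0 addr0.
by apply: cvgD; apply: cvgM => //; exact: cvg_cst.
Qed.

Lemma unstrip_lim (F_ : nat -> 'M[C]_n) F (M_ : nat -> circle R -> M2n) M : (forall m, contractive (F_ m)) ->
  contractive F -> mcvg F_ F -> (forall m, preH (M_ m)) -> preH M -> mlim M_ M ->
  mlim (fun m => unstrip (F_ m) (M_ m)) (unstrip F M).
Proof.
move=> cF_ cF hF hM_ hM h.
have hY := mcvg_hs2 (Y_cvg alpha cF_ cF hF).
apply: squeeze0 (cvg_lin2 h hY) => m; first exact: mnrm_ge0.
apply: le_trans (mnrm_mull_sub _ _ _ _ _) _.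
- exact: (Y_unitary alpha (cF_ m)).
- exact/mL2_Zconj/preH_mL2.
- exact/mL2_Zconj/preH_mL2.
- have [_ sM _ _ _] := hM; by apply: (circle_aeS sM) => z /(SU_Zconj z 1) [].
rewrite lerD2r ler_wpM2l //; under eq_fun do rewrite -ZconjB.
by rewrite (mnrm_Zconj 1 (fun z => M_ m z - M z)).
Qed.

Lemma coef0_cvg (M_ : nat -> circle R -> M2n) M : (forall m, preH (M_ m)) -> preH M -> mlim M_ M ->
  mcvg (fun m => coef0 (M_ m)) (coef0 M).
Proof.
move=> hM_ hM h.
have hW := mmean_cvg (fun m => preH_mL2 (hM_ m)) (preH_mL2 hM) h.
apply: (@Kof_cvg _ _ alpha); [by move=> m; exact: coef0_contractive | exact: coef0_contractive |].
have e N : Kof alpha (coef0 N) = ursubmx (mmean N) *m invmx (drsubmx (mmean N)).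
  by have [] := FofP alpha (ursubmx (mmean N) *m invmx (drsubmx (mmean N))).
rewrite e (_ : (fun m => _) = fun m => ursubmx (mmean (M_ m)) *m invmx (drsubmx (mmean (M_ m)))); last first.
  by apply/funext => m.
have us N : preH N -> drsubmx (mmean N) \in unitmx by case=> _ _ _ _ /triG_unit.
apply: mcvgM.
  by move=> i j; rewrite !mxE; under eq_fun do rewrite !mxE; have := hW (lshift n i) (rshift n j); rewrite !mxE; under [in X in X -> _]eq_fun do rewrite mxE.
apply: mcvg_inv => //; [by move=> m; exact: us | exact: us |].
by move=> i j; rewrite !mxE; under eq_fun do rewrite !mxE; have := hW (rshift n i) (rshift n j); rewrite !mxE; under [in X in X -> _]eq_fun do rewrite mxE.
Qed.

Lemma strip_lim (M_ : nat -> circle R -> M2n) M : (forall m, preH (M_ m)) -> preH M -> mlim M_ M ->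
  mlim (fun m => strip (M_ m)) (strip M).
Proof.
move=> hM_ hM h; have hc := coef0_cvg hM_ hM h.
have c_ m := coef0_contractive (M_ m); have c := coef0_contractive M.
have hY := mcvg_hs2 (Y_cvg alpha c_ c hc).
apply: squeeze0 (cvg_lin2 h hY) => m; first exact: mnrm_ge0.
have -> : mnrm (fun z => strip (M_ m) z - strip M z) =
    mnrm (fun z => (Y (coef0 (M_ m)))^t* *m M_ m z - (Y (coef0 M))^t* *m M z).
  by rewrite -[RHS](mnrm_Zconj (-1)); congr mean; apply/funext => z; rewrite ZconjB.
apply: le_trans (mnrm_mull_sub _ _ _ _ _) _.
- by rewrite trmxC_unitary (Y_unitary alpha (c_ m)).
- exact: preH_mL2.
- exact: preH_mL2.
- exact: preH_unitary.
by rewrite hs2B_J.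
Qed.

End Layers.

(** * Nonnegative series *)

Section Series.
Variable R : realType.
Implicit Types a : nat -> R.

Definition summable a : Prop := (\sum_(0 <= j <oo) (a j)%:E < +oo)%E.

Definition total a : R := fine (\sum_(0 <= j <oo) (a j)%:E)%E.

Lemma total_fin a : (forall j, 0 <= a j) -> summable a ->
  (\sum_(0 <= j <oo) (a j)%:E)%E = (total a)%:E.
Proof.
by move=> a0 sa; rewrite fineK // ge0_fin_numE //; apply: nneseries_ge0 => j _ _; rewrite lee_fin.
Qed.

Lemma total_cvg a : (forall j, 0 <= a j) -> summable a ->
  (fun m => \sum_(j < m) a j) @ \oo --> total a.
Proof.
move=> a0 sa.
have h : (fun m => (\sum_(0 <= j < m) (a j)%:E)%E) @ \oo --> (total a)%:E.
  by rewrite -(total_fin a0 sa); apply: is_cvg_nneseries => j _ _; rewrite lee_fin.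
have -> : (fun m => \sum_(j < m) a j) = fine \o (fun m => (\sum_(0 <= j < m) (a j)%:E)%E).
  by apply/funext => m; rewrite /= sumEFin big_mkord.
exact: (fine_cvg h).
Qed.

Lemma partial_le_total a m : (forall j, 0 <= a j) -> summable a ->
  \sum_(j < m) a j <= total a.
Proof.
move=> a0 sa; rewrite -lee_fin -(total_fin a0 sa) -sumEFin -(big_mkord xpredT (fun j => (a j)%:E)).
by apply: nneseries_lim_ge => j _ _; rewrite lee_fin.
Qed.

Lemma summable_bound a B : (forall j, 0 <= a j) -> (forall m, \sum_(j < m) a j <= B) ->
  summable a /\ total a <= B.
Proof.
move=> a0 aB.
have h : (\sum_(0 <= j <oo) (a j)%:E <= B%:E)%E.
  apply: lime_le; first by apply: is_cvg_nneseries => j _ _; rewrite lee_fin.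
  by apply: nearW => m; rewrite big_mkord sumEFin lee_fin.
have sa : summable a by exact: le_lt_trans h (ltry _).
by split => //; rewrite -lee_fin -total_fin.
Qed.

Definition rest a k : R := total a - \sum_(j < k) a j.

Lemma rest_ge0 a k : (forall j, 0 <= a j) -> summable a -> 0 <= rest a k.
Proof. by move=> a0 sa; rewrite subr_ge0; exact: partial_le_total. Qed.

Lemma rest_cvg a : (forall j, 0 <= a j) -> summable a -> rest a @ \oo --> (0 : R).
Proof.
move=> a0 sa; rewrite -(subrr (total a)).
by apply: cvgB; [exact: cvg_cst | exact: total_cvg].
Qed.

Lemma sum_shift_le a k m : (forall j, 0 <= a j) -> summable a ->
  \sum_(j < m) a (k + j)%N <= rest a k.
Proof.
move=> a0 sa; rewrite lerBrDl.
apply: le_trans (partial_le_total (k + m) a0 sa).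
by rewrite big_split_ord.
Qed.

Lemma summable_shift a k : (forall j, 0 <= a j) -> summable a ->
  summable (fun j => a (k + j)%N) /\ total (fun j => a (k + j)%N) <= rest a k.
Proof.
by move=> a0 sa; apply: summable_bound => // m; exact: sum_shift_le.
Qed.

End Series.

(** * The nonlinear Fourier transform of square-summable sequences *)

HB.instance Definition _ (S : pzSemiRingType) (p : nat) :=
  Monoid.isLaw.Build 'M[S]_p 1%:M (@mulmx S p p p)
    (@mulmxA S p p p p) (@mul1mx S p p) (@mulmx1 S p p).

Section Transform.
Variables (R : realType) (n : nat) (alpha : bool -> bool).
Local Notation C := R[i].
Local Notation Mn := 'M[C]_n.
Local Notation M2n := 'M[C]_(n + n).
Local Notation Y := (@Y R n alpha).
Implicit Types (F : nat -> Mn) (M N : circle R -> M2n) (z : circle R).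

Definition shift k F : nat -> Mn := fun j => F (k + j)%N.

(** Partial products, built from the left so that the recursion follows the
    first coefficient. *)
Fixpoint MP k F : circle R -> M2n :=
  if k is k'.+1 then unstrip alpha (F 0%N) (MP k' (shift 1 F)) else fun=> 1%:M.

Definition allC F := forall j, contractive (F j).

Lemma allC_shift k F : allC F -> allC (shift k F).
Proof. by move=> cF j; exact: cF. Qed.

Lemma preH_MP k F : allC F -> preH alpha (MP k F).
Proof.
elim: k F => [|k ih] F cF; first exact: preH1.
by apply: preH_unstrip; [exact: cF | apply: ih; exact: allC_shift].
Qed.

Lemma SU_MP k F z : allC F -> SU (MP k F z).
Proof.
elim: k F => [|k ih] F cF; first exact: SU1.
by apply: SU_mul; [exact: SU_Y | apply: SU_Zconj; apply: ih; exact: allC_shift].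
Qed.

Lemma shift_shift k l F : shift k (shift l F) = shift (l + k) F.
Proof. by apply/funext => j; rewrite /shift addnA. Qed.

Lemma MP_add k l F z :
  MP (k + l) F z = MP k F z *m Zconj z k%:Z (MP l (shift k F) z).
Proof.
elim: k F => [|k ih] F; first by rewrite Zconj0 mul1mx.
rewrite addSn /= /unstrip ih Zconj_mul Zconj_add shift_shift mulmxA.
by rewrite -intS.
Qed.

Lemma MP_bigop k F z :
  MP k F z = \big[mulmx/1%:M]_(0 <= j < k) Zconj z j%:Z (Y (F j)).
Proof.
elim: k => [|k ih]; first by rewrite big_geq.
rewrite -addn1 MP_add ih addn1 big_nat_recr //= /unstrip Zconj1 mulmx1.
by rewrite /shift addn0.
Qed.

Lemma mmean_cst p q (A : 'M[C]_(p, q)) : mmean (fun=> A) = A.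
Proof. by apply/matrixP => i j; rewrite mxE cmean_cst. Qed.

(** Means of triangular type multiply, so the diagonal at infinity of a product
    is the product of the diagonals of the factors. *)
Lemma ul_MP k F i : allC F ->
  ulsubmx (mmean (MP k F)) i i = (\prod_(j < k) dE alpha (F j) i)%:C%C.
Proof.
elim: k F => [|k ih] F cF.
  by rewrite big_ord0 (mmean_cst 1%:M) !mxE eqxx.
have cF' := allC_shift 1 cF.
rewrite /= ul_unstrip; last exact/preH_colH/preH_MP.
have [_ _ _ t1 _] := preH_MP k cF'.
rewrite (triG_diag_mul i (Y_ul alpha (cF 0%N)) t1) (ih _ cF') big_ord_recl.
by rewrite rmorphM /= dE_eq.
Qed.

Lemma dr_MP k F i : allC F ->
  drsubmx (mmean (MP k F)) i i = (\prod_(j < k) dH alpha (F j) i)%:C%C.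
Proof.
elim: k F => [|k ih] F cF.
  by rewrite big_ord0 (mmean_cst 1%:M) !mxE eqxx.
have cF' := allC_shift 1 cF.
rewrite /= dr_unstrip; last exact/preH_colH/preH_MP.
have [_ _ _ _ t2] := preH_MP k cF'.
rewrite (triG_diag_mul i (Y_dr alpha (cF 0%N)) t2) (ih _ cF') big_ord_recl.
by rewrite rmorphM /= dH_eq.
Qed.

Lemma prod_ge (x : nat -> R) F k : allC F -> (forall j, 0 < x j <= 1) ->
  (forall j, delta alpha (F j) <= x j) ->
  1 - \sum_(j < k) hs2 (F j) <= \prod_(j < k) x j.
Proof.
move=> cF x01 hx.
have x01' (j : 'I_k) : 0 <= x j <= 1 by have /andP [/ltW -> ->] := x01 j.
have [h _] := prod_ge_sub (index_enum 'I_k) x01'.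
apply: le_trans h; rewrite lerD2l lerN2; apply: ler_sum => j _.
have := delta_ge alpha (cF j); have := hx j; lra.
Qed.

(** [mnrm_sub1] reduces the claim to a lower bound on the diagonal of the mean,
    which is a product of factors [1 - O(hs2 (F j))]. *)
Lemma MP_near1 k F : allC F ->
  mnrm (fun z => MP k F z - 1%:M) <= 4 * n%:R * \sum_(j < k) hs2 (F j).
Proof.
move=> cF; have hM := preH_MP k cF.
rewrite mnrm_sub1; [|exact: preH_mL2 hM|exact: preH_unitary hM].
set S := \sum_(j < k) _.
have -> : complex.Re (\tr (mmean (MP k F))) =
    \sum_i \prod_(j < k) dE alpha (F j) i + \sum_i \prod_(j < k) dH alpha (F j) i.
  rewrite /mxtrace big_split_ord /= ReD !Re_sum; congr (_ + _); apply: eq_bigr => i _.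
    by have := ul_MP k i cF; rewrite [_ i i]mxE [X in X = _]mxE => ->.
  by have := dr_MP k i cF; rewrite [_ i i]mxE [X in X = _]mxE => ->.
have h (x : nat -> 'I_n -> R) : (forall i j, 0 < x j i <= 1) ->
    (forall i j, delta alpha (F j) <= x j i) ->
    n%:R * (1 - S) <= \sum_i \prod_(j < k) x j i.
  move=> x01 hx; apply: le_trans (_ : \sum_(i < n) (1 - S) <= _).
    by rewrite sumr_const card_ord mulr_natl.
  by apply: ler_sum => i _; apply: (@prod_ge (fun j => x j i)).
have h1 := h (fun j => dE alpha (F j)) (fun i j => dE01 alpha i (cF j)) (fun i j => delta_le_dE alpha i (cF j)).
have h2 := h (fun j => dH alpha (F j)) (fun i j => dH01 alpha i (cF j)) (fun i j => delta_le_dH alpha i (cF j)).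
rewrite natrD; lra.
Qed.

(** The two products differ by a unitary left factor times the distance of a tail
    product to the identity. *)
Lemma MP_cauchy k l F : allC F ->
  mnrm (fun z => MP k F z - MP (k + l) F z) <= 4 * n%:R * \sum_(j < l) hs2 (F (k + j)%N).
Proof.
move=> cF; apply: le_trans (MP_near1 l (allC_shift k cF)).
rewrite mnrmC le_eqVlt; apply/orP; left; apply/eqP; congr mean; apply/funext => z.
rewrite MP_add -{2}[MP k F z]mulmx1 -mulmxBr hs2_mull; last by case: (SU_MP k z cF).
by rewrite -{1}(Zconj1 n z k%:Z) -ZconjB hs2_Zconj.
Qed.

(** * Convergence of the partial products *)

Lemma ell2C_E F : ell2C F <-> allC F /\ summable (fun j => hs2 (F j)).
Proof.
rewrite /ell2C /summable.
have -> : (\sum_(0 <= j <oo) (hsnorm (F j) ^+ 2)%:E = \sum_(0 <= j <oo) (hs2 (F j))%:E)%E.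
  by apply: eq_eseriesr => j _; rewrite hsnorm2.
by [].
Qed.

Lemma ell2C_shift k F : ell2C F -> ell2C (shift k F).
Proof.
move=> /ell2C_E [cF sF]; apply/ell2C_E; split; first exact: allC_shift.
by have [] := summable_shift k (fun j => hs2_ge0 (F j)) sF.
Qed.

Definition PhiSpec F M := [/\ mL2 M, circle_ae (fun z => SU (M z)) &
  (fun k => mnrm (fun z => MP k F z - M z)) @ \oo --> (0 : R)].

Lemma mlim_unique (M_ : nat -> circle R -> M2n) M N : (forall m, mL2 (M_ m)) ->
  mL2 M -> mL2 N -> mlim M_ M -> mlim M_ N -> ae_equal M N.
Proof.
move=> hM_ hM hN h1 h2.
have z0 : mnrm (fun z => M z - N z) = 0.
  apply/eqP; rewrite eq_le mnrm_ge0 andbT; apply/ler_addgt0Pr => e e0; rewrite add0r.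
  have e4 : 0 < e / 4 by rewrite divr_gt0.
  have [A hA] := (cvg0P (fun k => mnrm_ge0 _)).1 h1 _ e4.
  have [B hB] := (cvg0P (fun k => mnrm_ge0 _)).1 h2 _ e4.
  have := hA _ (leq_maxl A B); have := hB _ (leq_maxr A B).
  have := mnrmB_le hM (hM_ (maxn A B)) hN; rewrite [X in _ <= 2 * X + _]mnrmC; lra.
apply: ae_equalS (mnrm_eq0 (mL2B hM hN) z0) _ => z /eqP.
by rewrite subr_eq0 => /eqP.
Qed.

(** The partial products form a Cauchy sequence in mean square; the almost
    everywhere convergent subsequence shows that the limit is again in [SU]. *)
Lemma Phi_exists F : ell2C F -> exists M, PhiSpec F M.
Proof.
move=> /ell2C_E [cF sF]; have a0 j := hs2_ge0 (F j).
pose e k := 4 * n%:R * rest (fun j => hs2 (F j)) k.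
have n0 : 0 <= 4 * n%:R :> R by rewrite mulr_ge0.
have ec : e @ \oo --> (0 : R).
  by rewrite -(mulr0 (4 * n%:R)); apply: cvgM; [exact: cvg_cst | exact: rest_cvg].
have [|||||M [hM hl [phi hp]]] := @mL2_complete R _ _ (fun k => MP k F) e.
- by move=> k; have [] := preH_MP k cF.
- by move=> k z i j; apply: sq_unitary_le1; case: (SU_MP k z cF).
- by move=> k; rewrite mulr_ge0 //; exact: rest_ge0.
- exact: ec.
- move=> k l kl; rewrite -(subnKC kl); apply: le_trans (MP_cauchy _ _ cF) _.
  by rewrite ler_wpM2l //; exact: (sum_shift_le _ _ a0 sF).
exists M; split => //.
apply: (circle_aeS hp) => z hz.
have hU : mcvg (fun k => MP (phi k) F z) (M z) by exact: hz.
have uk k : MP (phi k) F z *m (MP (phi k) F z)^t* = 1%:M.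
  by apply: unitaryE; case: (SU_MP (phi k) z cF).
have dk k : \det (MP (phi k) F z) = 1 by case: (SU_MP (phi k) z cF).
split.
  apply/unitarymxP; have h := mcvgM hU (mcvgJ hU).
  apply/matrixP => i j; apply: ccvg_unique (h i j) _.
  by under eq_fun do rewrite uk; exact: ccvg_cst.
apply: ccvg_unique (mcvg_det hU) _.
by under eq_fun do rewrite dk; exact: ccvg_cst.
Qed.

Definition Phi F : circle R -> M2n := xget (fun=> 1%:M) [set M | PhiSpec F M].

Lemma PhiP F : ell2C F -> PhiSpec F (Phi F).
Proof. by move=> /Phi_exists [M hM]; apply: (xgetPex (fun=> 1%:M)); exists M. Qed.

Lemma ell2C_allC F : ell2C F -> allC F.
Proof. by case. Qed.

Lemma Phi_unique F M : ell2C F -> mL2 M -> mlim (fun k => MP k F) M ->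
  ae_equal (Phi F) M.
Proof.
move=> hF hM hl; have [h1 _ h2] := PhiP hF.
apply: (mlim_unique _ h1 hM h2 hl) => k.
exact/preH_mL2/preH_MP/ell2C_allC.
Qed.

Lemma colH_Phi F : ell2C F -> colH (Phi F).
Proof.
move=> hF; have [h1 _ h2] := PhiP hF; have cF := ell2C_allC hF.
by apply: (colH_lim _ h1 h2) => k; exact/preH_colH/preH_MP.
Qed.

Lemma mmean_Phi F : ell2C F -> mcvg (fun k => mmean (MP k F)) (mmean (Phi F)).
Proof.
move=> hF; have [h1 _ h2] := PhiP hF; have cF := ell2C_allC hF.
by apply: mmean_cvg => // k; exact/preH_mL2/preH_MP.
Qed.

(** Beyond an index where the rest of the series is below 1/2, every partial
    product is at least 1/2, and the finitely many earlier factors are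
    positive. *)
Lemma prod_lower (x a : nat -> R) : (forall j, 0 < x j <= 1) ->
  (forall j, 0 <= a j) -> summable a -> (forall j, 1 - a j <= x j) ->
  exists2 c : R, 0 < c & forall k, c <= \prod_(j < k) x j.
Proof.
move=> x01 a0 sa hx.
have e2 : 0 < 2^-1 :> R by rewrite invr_gt0.
have [N hN] := (cvg0P (fun k => rest_ge0 k a0 sa)).1 (rest_cvg a0 sa) _ e2.
have pos (k m : nat) : 0 < \prod_(j < k) x (m + j)%N by apply: prodr_gt0 => j _; have /andP [] := x01 (m + j)%N.
exists (2^-1 * \prod_(j < N) x j).
  by rewrite mulr_gt0 //; exact: (pos N 0%N).
have mono k l : \prod_(j < k + l) x j <= \prod_(j < k) x j.
  rewrite big_split_ord /= ler_piMr ?(ltW (pos k 0%N)) //.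
  by apply: prodr_ile1 => j _; have /andP [/ltW -> ->] := x01 (k + j)%N.
have main l : 2^-1 * \prod_(j < N) x j <= \prod_(j < N + l) x j.
  rewrite big_split_ord /= mulrC ler_wpM2l ?(ltW (pos N 0%N)) //.
  have x01' (j : 'I_l) : 0 <= x (N + j)%N <= 1 by have /andP [/ltW -> ->] := x01 (N + j)%N.
  have [h _] := prod_ge_sub (index_enum 'I_l) x01'.
  apply: le_trans h.
  have h1 : \sum_(j < l) (1 - x (N + j)%N) <= \sum_(j < l) a (N + j)%N.
    by apply: ler_sum => j _; have := hx (N + j)%N; lra.
  have := sum_shift_le N l a0 sa; have := hN N (leqnn N); lra.
move=> k; apply: le_trans (main k) _; rewrite addnC; exact: mono.
Qed.

Lemma ccvg_real_ge (u : nat -> R) (w : C) (c : R) : 0 < c -> (forall k, c <= u k) ->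
  ccvg (fun k => (u k)%:C%C) w -> 0 < w.
Proof.
move=> c0 uc /ccvgP [/= h1 h2]; rewrite pos_complex; apply/andP; split.
  by rewrite (cvg_unique _ h2 (cvg_cst _)) // eqxx.
apply: lt_le_trans c0 _.
have -> : complex.Re w = limn u by apply/esym/cvg_lim.
by apply: limr_ge; [apply/cvg_ex; exists (complex.Re w) | apply: nearW].
Qed.

Lemma triG_lim b (A_ : nat -> Mn) A (u : nat -> 'I_n -> R) (c : 'I_n -> R) :
  (forall k, triG b (A_ k)) -> mcvg A_ A -> (forall k i, A_ k i i = (u k i)%:C%C) ->
  (forall i, 0 < c i) -> (forall k i, c i <= u k i) -> triG b A.
Proof.
move=> tA hA uA c0 cu; apply/triGP; split=> [i j ij|i]; last first.
  apply: (@ccvg_real_ge (u ^~ i) _ (c i)) => //.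
  by have := hA i i; under eq_fun do rewrite uA.
apply: ccvg_unique (hA i j) _.
rewrite (_ : (fun k => A_ k i j) = fun=> 0); first exact: ccvg_cst.
by apply/funext => k; have /triGP [h _] := tA k; exact: h.
Qed.

Lemma mcvg_ul (A_ : nat -> M2n) A : mcvg A_ A ->
  mcvg (fun k => ulsubmx (A_ k)) (ulsubmx A).
Proof.
move=> h i j; rewrite !mxE; have := h (lshift n i) (lshift n j).
by congr ccvg; apply/funext => k; rewrite !mxE.
Qed.

Lemma mcvg_dr (A_ : nat -> M2n) A : mcvg A_ A ->
  mcvg (fun k => drsubmx (A_ k)) (drsubmx A).
Proof.
move=> h i j; rewrite !mxE; have := h (rshift n i) (rshift n j).
by congr ccvg; apply/funext => k; rewrite !mxE.
Qed.

(** Positivity of the diagonals survives the limit because the infinite products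
    do not vanish. *)
Lemma preH_Phi F : ell2C F -> preH alpha (Phi F).
Proof.
move=> hF; have [h1 h2 h3] := PhiP hF.
have /ell2C_E [cF sF] := hF; have a0 j := hs2_ge0 (F j).
have hm := mmean_Phi hF.
have low (x : nat -> 'I_n -> R) : (forall i j, 0 < x j i <= 1) ->
    (forall i j, delta alpha (F j) <= x j i) ->
    exists c : 'I_n -> R, (forall i, 0 < c i) /\ (forall k i, c i <= \prod_(j < k) x j i).
  move=> x01 hx.
  have /choice [c hc] : forall i, exists c : R, 0 < c /\ forall k, c <= \prod_(j < k) x j i.
    move=> i; have [|c c0 hc] := @prod_lower (x ^~ i) _ (x01 i) a0 sF.
      by move=> j; exact: le_trans (delta_ge alpha (cF j)) (hx i j).
    by exists c.
  by exists c; split => [i|k i]; have [] := hc i.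
split => //; first exact: mL2_meas.
- exact: colH_Phi.
- have [c [c0 hc]] := low (fun j => dE alpha (F j)) (fun i j => dE01 alpha i (cF j)) (fun i j => delta_le_dE alpha i (cF j)).
  apply: (@triG_lim _ (fun k => ulsubmx (mmean (MP k F))) _ (fun k i => \prod_(j < k) dE alpha (F j) i) c) => //.
  + by move=> k; have [] := preH_MP k cF.
  + exact: mcvg_ul.
  + by move=> k i; exact: ul_MP.
- have [c [c0 hc]] := low (fun j => dH alpha (F j)) (fun i j => dH01 alpha i (cF j)) (fun i j => delta_le_dH alpha i (cF j)).
  apply: (@triG_lim _ (fun k => drsubmx (mmean (MP k F))) _ (fun k i => \prod_(j < k) dH alpha (F j) i) c) => //.
  + by move=> k; have [] := preH_MP k cF.
  + exact: mcvg_dr.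
  + by move=> k i; exact: dr_MP.
Qed.

Lemma Phi_step F : ell2C F ->
  ae_equal (Phi F) (unstrip alpha (F 0%N) (Phi (shift 1 F))).
Proof.
move=> hF; have cF := ell2C_allC hF; have hS := ell2C_shift 1 hF.
have pS := preH_Phi hS; have [_ _ h3] := PhiP hS.
apply: (Phi_unique hF); first exact/preH_mL2/(preH_unstrip (cF 0%N) pS).
have := @unstrip_lim _ _ alpha (fun=> F 0%N) (F 0%N) (fun k => MP k (shift 1 F)) _
  (fun=> cF 0%N) (cF 0%N) (mcvg_cst _) (fun k => preH_MP k (allC_shift 1 cF)) pS h3.
move=> /(cvg0P (fun k => mnrm_ge0 _)) h; apply/(cvg0P (fun k => mnrm_ge0 _)) => e /h [N hN].
by exists N.+1 => -[//|k] /hN.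
Qed.

(** * Agreement with the finite products *)

Lemma Phi_finite F (N : nat) : allC F -> (forall j, (N <= j)%N -> F j = 0) ->
  ell2C F /\ ae_equal (Phi F) (MP N F).
Proof.
move=> cF F0.
have hF : ell2C F.
  apply/ell2C_E; split => //.
  have bd m : \sum_(j < m) hs2 (F j) <= \sum_(j < N) hs2 (F j).
    case: (leqP m N) => mN.
      by rewrite -(subnKC mN) big_split_ord /= lerDl; apply: sumr_ge0 => j _; exact: hs2_ge0.
    rewrite -(subnKC (ltnW mN)) big_split_ord /= [X in _ + X]big1 ?addr0 // => j _.
    by rewrite F0 ?hs2_0 // leq_addr.
  by have [s _] := summable_bound (fun j => hs2_ge0 (F j)) bd; exact: s.
split => //; apply: Phi_unique => //; first exact/preH_mL2/preH_MP.
have e k : (N <= k)%N -> MP k F = MP N F.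
  move=> Nk; apply/funext => z; rewrite !MP_bigop (big_cat_nat (leq0n N) Nk) /=.
  rewrite [X in _ *m X]big_nat [X in _ *m X]big1 ?mulmx1 // => j /andP [Nj _].
  by rewrite F0 // Y0 Zconj1.
apply/cvg0P => [k|eps e0]; first exact: mnrm_ge0.
exists N => k /e ->; rewrite /mnrm; under eq_fun do rewrite subrr hs2_0.
by rewrite mean_cst.
Qed.

Lemma nlft_MP F (N : nat) : allC F -> (forall j, (N <= j)%N -> F j = 0) ->
  exists K, (forall j, (K <= j)%N -> F j = 0) /\
    nlft alpha (extend0 F) = MP K F.
Proof.
move=> cF F0; rewrite /nlft.
have hN : exists N' : nat, supported_in N' (extend0 F).
  exists N => -[k|k] //= Nk; apply: F0; exact: ltnW.
have := @xgetPex _ 0%N [set N : nat | supported_in N (extend0 F)] hN.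
set K := xget _ _ => /= hK.
exists K.+1; split.
  by move=> j Kj; have := hK (Posz j); apply.
apply/funext => z; rewrite /nlft_window MP_bigop.
have KK : (K <= K.*2.+1)%N by rewrite -addnn leqW // leq_addr.
(* The window starts at [- K]; its first [K] factors are identities. *)
rewrite (big_cat_nat (leq0n K) KK) /= [X in X *m _]big_nat [X in X *m _]big1 ?mul1mx; last first.
  move=> k /andP [_ kK].
  have -> : extend0 F (k%:Z - K%:Z) = 0.
    have : k%:Z - K%:Z < 0 by rewrite subr_lt0 ltz_nat.
    by case: (k%:Z - K%:Z).
  by rewrite Y0 Zconj1.
have -> : K.*2.+1 = (K.+1 + K)%N by rewrite -addnn addSn.
rewrite -{1}(add0n K) big_addn addnK; apply: eq_bigr => j _.
by rewrite PoszD addrK.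
Qed.

End Transform.

(** * The coefficients of a matrix function *)

Section Coefficients.
Variables (R : realType) (n : nat) (alpha : bool -> bool).
Local Notation C := R[i].
Local Notation Mn := 'M[C]_n.
Local Notation M2n := 'M[C]_(n + n).
Implicit Types (F : nat -> Mn) (M : circle R -> M2n).

Definition strips k M : circle R -> M2n := iter k (strip alpha) M.

Definition coef M j : Mn := coef0 alpha (strips j M).

Lemma stripsSr k M : strips k.+1 M = strips k (strip alpha M).
Proof. exact: iterSr. Qed.

Lemma coef_contractive M : allC (coef M).
Proof. by move=> j; exact: coef0_contractive. Qed.

Lemma coef_strip M : coef (strip alpha M) = shift 1 (coef M).
Proof. by apply/funext => j; rewrite /coef -stripsSr. Qed.

Lemma preH_strips k M : preH alpha M -> preH alpha (strips k M).
Proof. by move=> hM; elim: k => //= k ih; exact: preH_strip. Qed.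

Lemma meas_strips k M : mx_measurable M -> mx_measurable (strips k M).
Proof. by move=> hM; elim: k => //= k ih; exact: meas_strip. Qed.

Lemma strips_ae k M (N : circle R -> M2n) : mx_measurable M -> mx_measurable N ->
  ae_equal M N -> ae_equal (strips k M) (strips k N).
Proof.
move=> mM mN MN; elim: k => //= k ih.
by apply: strip_ae => //; exact: meas_strips.
Qed.

Lemma coef_ae M (N : circle R -> M2n) j : mx_measurable M -> mx_measurable N ->
  ae_equal M N -> coef M j = coef N j.
Proof.
move=> mM mN MN; apply: coef0_ae; [exact: meas_strips | exact: meas_strips |].
exact: strips_ae.
Qed.

Lemma MP_strips k M z : M z = MP alpha k (coef M) z *m Zconj z k%:Z (strips k M z).
Proof.
elim: k M => [|k ih] M; first by rewrite Zconj0 mul1mx.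
rewrite stripsSr -[LHS](stripK alpha) /unstrip [strip alpha M z]ih coef_strip.
rewrite [MP _ _ _ _]/= /unstrip Zconj_mul Zconj_add mulmxA -intS.
by [].
Qed.

(** * The product formula for diagonals and determinants *)

Lemma preH_ul M : preH alpha M -> triG (alpha false) (ulsubmx (mmean M)).
Proof. by case. Qed.

Lemma preH_dr M : preH alpha M -> triG (alpha true) (drsubmx (mmean M)).
Proof. by case. Qed.

Lemma Re_mean_le1 p (M : circle R -> 'M[C]_p) i j : mx_measurable M ->
  circle_ae (fun z => M z \is unitarymx) -> complex.Re (mmean M i j) <= 1.
Proof.
move=> mM uM; have hM := mL2_unitary mM uM.
have h : sq (mmean M i j) <= 1.
  rewrite mxE; apply: le_trans (sq_cmean_le (hM i j)) _.
  rewrite -[leRHS](mean_cst (R := R)).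
  have -> : nrm2 (fun z => M z i j) = mean (fun z => Num.min (sq (M z i j)) 1).
    apply: mean_ae; first exact: (integ_rmeas (proj2 (hM i j))).
      by apply: measurable_minr; [exact: rmeas_sq (mM i j) | exact: measurable_cst].
    by apply: (circle_aeS uM) => z uz; apply/esym/min_idPl; exact: sq_unitary_le1.
  apply: le_mean; last by move=> z; rewrite ge_min lexx orbT.
    apply: (@integ_le _ _ (fun z => sq (M z i j))); last by case: (hM i j).
      by apply: measurable_minr; [exact: rmeas_sq (mM i j) | exact: measurable_cst].
    move=> z; rewrite ger0_norm ?le_min ?sq_ge0 ?ler01 //.
    by rewrite ge_min lexx.
  exact: integ_cst.
have {}h := le_trans (Re_le_sq _) h.
by apply: le_trans (ler_norm _) _; rewrite -(expr_le1 (ltn0Sn 1)) // real_normK ?num_real.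
Qed.

Lemma preH_Re_le1 M i j : preH alpha M -> complex.Re (mmean M i j) <= 1.
Proof. by move=> hM; apply: Re_mean_le1; [case: hM | exact: preH_unitary hM]. Qed.

Lemma Re_scale (x : R) (w : C) : complex.Re (x%:C%C * w) = x * complex.Re w.
Proof. by case: w => a b /=; rewrite mul0r subr0. Qed.

Lemma ul_strips k M i : preH alpha M ->
  complex.Re (ulsubmx (mmean M) i i) =
  \prod_(j < k) dE alpha (coef M j) i * complex.Re (ulsubmx (mmean (strips k M)) i i).
Proof.
elim: k M => [|k ih] M hM; first by rewrite big_ord0 mul1r.
have hS := preH_strip hM; have c0 := coef0_contractive alpha M.
rewrite (ul_strip hM) (triG_diag_mul i (Y_ul alpha c0) (preH_ul hS)) dE_eq //.
apply: etrans (Re_scale _ _) _; rewrite big_ord_recl -mulrA stripsSr.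
by congr (_ * _); apply: etrans (ih _ hS) _; rewrite coef_strip.
Qed.

Lemma dr_strips k M i : preH alpha M ->
  complex.Re (drsubmx (mmean M) i i) =
  \prod_(j < k) dH alpha (coef M j) i * complex.Re (drsubmx (mmean (strips k M)) i i).
Proof.
elim: k M => [|k ih] M hM; first by rewrite big_ord0 mul1r.
have hS := preH_strip hM; have c0 := coef0_contractive alpha M.
rewrite (dr_strip hM) (triG_diag_mul i (Y_dr alpha c0) (preH_dr hS)) dH_eq //.
apply: etrans (Re_scale _ _) _; rewrite big_ord_recl -mulrA stripsSr.
by congr (_ * _); apply: etrans (ih _ hS) _; rewrite coef_strip.
Qed.

(** What remains after [k] stripping steps has diagonal entries at most one. *)
Lemma prod_dE_ge k M i : preH alpha M ->
  complex.Re (ulsubmx (mmean M) i i) <= \prod_(j < k) dE alpha (coef M j) i.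
Proof.
move=> hM; rewrite (ul_strips k i hM) ler_piMr //.
  by apply: prodr_ge0 => j _; have /andP [/ltW] := dE01 alpha i (coef_contractive M j).
by rewrite 2!mxE; apply: preH_Re_le1; exact: preH_strips.
Qed.

Lemma prod_dH_ge k M i : preH alpha M ->
  complex.Re (drsubmx (mmean M) i i) <= \prod_(j < k) dH alpha (coef M j) i.
Proof.
move=> hM; rewrite (dr_strips k i hM) ler_piMr //.
  by apply: prodr_ge0 => j _; have /andP [/ltW] := dH01 alpha i (coef_contractive M j).
by rewrite 2!mxE; apply: preH_Re_le1; exact: preH_strips.
Qed.

Definition detA M : R := complex.Re (\det (ulsubmx (mmean M))).

Lemma detA_gt0 M : preH alpha M -> 0 < detA M.
Proof. by move=> /preH_ul /triG_det_gt0; exact: pos_Re. Qed.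

Lemma detA_le1 M : preH alpha M -> detA M <= 1.
Proof.
move=> hM; have t := preH_ul hM; rewrite /detA (triG_det t).
have -> : \prod_i ulsubmx (mmean M) i i = (\prod_i complex.Re (ulsubmx (mmean M) i i))%:C%C.
  by rewrite rmorph_prod; apply: eq_bigr => i _; exact: pos_realE (triG_diag i t).
apply: prodr_ile1 => i _; rewrite (ltW (pos_Re (triG_diag i t))) /=.
by rewrite 2!mxE; exact: preH_Re_le1.
Qed.

Lemma detA_strip M : preH alpha M ->
  detA M = delta alpha (coef0 alpha M) * detA (strip alpha M).
Proof.
move=> hM; rewrite /detA (ul_strip hM) det_mulmx delta_eq; last exact: coef0_contractive.
exact: Re_scale.
Qed.

(** A nonlinear substitute for Bessel's inequality: every stripping step splits
    off a factor [delta] of the determinant at infinity, [-2 ln delta]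
    dominates the coefficient, and the determinant that remains is at most
    one. *)
Lemma coef_sum_le k M : preH alpha M ->
  \sum_(j < k) hs2 (coef M j) <= - 2 * ln (detA M).
Proof.
elim: k M => [|k ih] M hM.
  by have := ln_le0 (detA_le1 hM); rewrite big_ord0; lra.
have hS := preH_strip hM; have c0 := coef0_contractive alpha M.
rewrite big_ord_recl detA_strip // lnM ?posrE ?(delta_gt0 alpha c0) ?(detA_gt0 hS) //.
have := ih _ hS; rewrite coef_strip => h1.
have h2 := hs2_le_ln_delta alpha c0.
rewrite (mulrDr (-2)); exact: (lerD h2 h1).
Qed.

(** * The coefficients of the transform *)

Lemma strip_Phi F : ell2C F -> coef0 alpha (Phi alpha F) = F 0%N /\
  ae_equal (strip alpha (Phi alpha F)) (Phi alpha (shift 1 F)).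
Proof.
move=> hF; have cF := ell2C_allC hF; have hS := ell2C_shift 1 hF.
have pS := preH_Phi alpha hS; have st := Phi_step alpha hF.
have [mP _ _ _ _] := preH_Phi alpha hF.
have [mU _ _ _ _] := preH_unstrip (cF 0%N) pS.
split; first by rewrite (coef0_ae alpha mP mU st) coef0_unstrip.
apply: ae_equalS (strip_ae alpha mP mU st) _ => z ->.
exact: strip_unstrip.
Qed.

Lemma ae_equal_trans (T : Type) (f g h : circle R -> T) :
  ae_equal f g -> ae_equal g h -> ae_equal f h.
Proof. by move=> fg gh; apply: (circle_aeI fg gh) => z -> ->. Qed.

Lemma strips_Phi k F : ell2C F ->
  ae_equal (strips k (Phi alpha F)) (Phi alpha (shift k F)).
Proof.
elim: k F => [|k ih] F hF; first by apply: circle_aeT.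
have hS := ell2C_shift 1 hF; have [_ e] := strip_Phi hF.
have [mP _ _ _ _] := preH_Phi alpha hF; have [mS _ _ _ _] := preH_Phi alpha hS.
rewrite stripsSr; apply: ae_equal_trans (strips_ae k (meas_strip alpha mP) mS e) _.
by have := ih _ hS; rewrite shift_shift.
Qed.

Lemma coef_Phi F j : ell2C F -> coef (Phi alpha F) j = F j.
Proof.
move=> hF; have [mP _ _ _ _] := preH_Phi alpha hF.
have hS := ell2C_shift j hF; have [mS _ _ _ _] := preH_Phi alpha hS.
rewrite /coef (coef0_ae alpha (meas_strips j mP) mS (strips_Phi j hF)).
by have [-> _] := strip_Phi hS; rewrite /shift addn0.
Qed.

(** * Right factors that are block diagonal and inner *)

Definition diagI (I1 I2 : circle R -> Mn) z : M2n := block_mx (I1 z) 0 0 (I2 z).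

Lemma Zconj_diagI I1 I2 z j : Zconj z j (diagI I1 I2 z) = diagI I1 I2 z.
Proof.
by rewrite /Zconj /diagI block_mxKul block_mxKur block_mxKdl block_mxKdr !scaler0.
Qed.

Section InnerFactor.
Variables I1 I2 : circle R -> Mn.
Hypothesis I1H : forall i j, AH2 (fun z => (I1 z i j)^*).
Hypothesis I2H : forall i j, AH2 (fun z => I2 z i j).

Lemma meas_diagI : mx_measurable (diagI I1 I2).
Proof.
have m1 i j : circle_measurable (fun z => I1 z i j).
  have := measJ (AH2_meas (I1H i j)); congr circle_measurable.
  by apply/funext => z; exact: conjCK.
elim/split_ind => i; elim/split_ind => j.
- by under eq_fun do rewrite /diagI block_mxEul.
- by under eq_fun do rewrite /diagI block_mxEur mxE; exact: meas_cst.
- by under eq_fun do rewrite /diagI block_mxEdl mxE; exact: meas_cst.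
- by under eq_fun do rewrite /diagI block_mxEdr; exact: AH2_meas.
Qed.

Lemma mmean_diagI M : colH M -> mmean (fun z => M z *m diagI I1 I2 z) =
  mmean M *m block_mx (mmean I1) 0 0 (mmean I2).
Proof.
move=> [hl hr]; apply/matrixP => i; elim/split_ind => j.
  rewrite mxE [RHS]mxE big_split_ord /= [X in _ = _ + X]big1 => [|k _]; last first.
    by rewrite block_mxEdl [X in _ * X]mxE mulr0.
  rewrite addr0.
  have e : (fun z => (M z *m diagI I1 I2 z) i (lshift n j)) =
      (fun z => \sum_k (((M z i (lshift n k))^* * (I1 z k j)^*) : C)^*).
    apply/funext => z; rewrite mxE big_split_ord /= [X in _ + X]big1 => [|k _]; last first.
      by rewrite /diagI block_mxEdl [X in _ * X]mxE mulr0.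
    rewrite addr0; apply: eq_bigr => k _.
    by rewrite /diagI block_mxEul rmorphM /= !conjCK.
  rewrite e cmean_sum => [|k]; last first.
    by have [h1 h2] := L2M_cinteg (AH2_L2 (hl i k)) (AH2_L2 (I1H k j)); split;
      [under eq_fun do rewrite ReJ | under eq_fun do rewrite ImJ; exact: integN].
  apply: eq_bigr => k _; rewrite block_mxEul !mxE cmeanJ; last first.
    exact: L2M_cinteg (AH2_L2 (hl i k)) (AH2_L2 (I1H k j)).
  rewrite AH2_cmeanM // rmorphM /= -cmean_conj // -cmean_conj //.
rewrite mxE [RHS]mxE big_split_ord /= [X in _ = X + _]big1 => [|k _]; last first.
  by rewrite block_mxEur [X in _ * X]mxE mulr0.
rewrite add0r.
have e : (fun z => (M z *m diagI I1 I2 z) i (rshift n j)) =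
    (fun z => \sum_k M z i (rshift n k) * I2 z k j).
  apply/funext => z; rewrite mxE big_split_ord /= [X in X + _]big1 => [|k _]; last first.
    by rewrite /diagI block_mxEur [X in _ * X]mxE mulr0.
  by rewrite add0r; apply: eq_bigr => k _; rewrite /diagI block_mxEdr.
rewrite e cmean_sum => [|k]; last exact: L2M_cinteg (AH2_L2 (hr i k)) (AH2_L2 (I2H k j)).
by apply: eq_bigr => k _; rewrite block_mxEdr !mxE AH2_cmeanM.
Qed.

Variables M M' : circle R -> M2n.
Hypothesis hM : preH alpha M.
Hypothesis hM' : preH alpha M'.
Hypothesis MM' : ae_equal M (fun z => M' z *m diagI I1 I2 z).

Lemma inner_mean : mmean M = mmean M' *m block_mx (mmean I1) 0 0 (mmean I2).
Proof.
have [mM _ _ _ _] := hM; have [mM' _ cM' _ _] := hM'.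
rewrite -mmean_diagI //; apply: mmean_ae => //.
by apply: meas_mulmx => //; exact: meas_diagI.
Qed.

Lemma inner_ul : ulsubmx (mmean M) = ulsubmx (mmean M') *m mmean I1.
Proof.
rewrite inner_mean -{1}(submxK (mmean M')) mulmx_block block_mxKul.
by rewrite mulmx0 addr0.
Qed.

Lemma inner_dr : drsubmx (mmean M) = drsubmx (mmean M') *m mmean I2.
Proof.
rewrite inner_mean -{1}(submxK (mmean M')) mulmx_block block_mxKdr.
by rewrite mulmx0 add0r.
Qed.

Lemma inner_ur : ursubmx (mmean M) = ursubmx (mmean M') *m mmean I2.
Proof.
rewrite inner_mean -{1}(submxK (mmean M')) mulmx_block block_mxKur.
by rewrite mulmx0 add0r.
Qed.

(** The quotient that determines the first coefficient is insensitive to inner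
    right factors. *)
Lemma inner_coef0 : coef0 alpha M = coef0 alpha M'.
Proof.
rewrite /coef0 inner_ur inner_dr.
have u1 := triG_unit (preH_dr hM); rewrite inner_dr unitmx_mul in u1.
have /andP [u2 u3] := u1.
by rewrite invmx_mul // mulmxA mulmxK.
Qed.

Lemma inner_strip :
  ae_equal (strip alpha M) (fun z => strip alpha M' z *m diagI I1 I2 z).
Proof.
have c := inner_coef0.
by apply: ae_equalS MM' _ => z e; rewrite /strip c e mulmxA Zconj_mul Zconj_diagI.
Qed.

End InnerFactor.

Lemma inner_coef (I1 I2 : circle R -> Mn) M (M' : circle R -> M2n) j :
  (forall i l, AH2 (fun z => (I1 z i l)^*)) -> (forall i l, AH2 (fun z => I2 z i l)) ->
  preH alpha M -> preH alpha M' -> ae_equal M (fun z => M' z *m diagI I1 I2 z) ->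
  coef M j = coef M' j.
Proof.
move=> h1 h2; elim: j M M' => [|j ih] M M' hM hM' MM'; first exact: (inner_coef0 h1 h2).
rewrite /coef !stripsSr; apply: ih; [exact: preH_strip | exact: preH_strip |].
exact: (inner_strip h1 h2).
Qed.

(** The distance to the identity is [2 n] minus twice the real trace of the mean. *)
Lemma unitary_trace_one (I : circle R -> Mn) : mx_measurable I ->
  circle_ae (fun z => I z \is unitarymx) ->
  (forall i, 1 <= complex.Re (mmean I i i)) -> ae_equal I (fun=> 1%:M).
Proof.
move=> mI uI tI; have hI := mL2_unitary mI uI.
have z0 : mnrm (fun z => I z - 1%:M) = 0.
  apply/eqP; rewrite eq_le mnrm_ge0 andbT mnrm_sub1 // Re_sum.
  have : \sum_(i < n) 1 <= \sum_i complex.Re (mmean I i i) by apply: ler_sum.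
  rewrite sumr_const card_ord; lra.
apply: ae_equalS (mnrm_eq0 (mL2B hI (mL2_cst 1%:M)) z0) _ => z /eqP.
by rewrite subr_eq0 => /eqP.
Qed.

(** If [M' diag(I1, I2)] is a transform, then the diagonals at infinity and at
    zero of [M'] are at most those of the transform, by the product formula;
    so the means of [I1] and [I2] have diagonal entries at least one. *)
Lemma Phi_maximal F (I1 I2 : circle R -> Mn) (M' : circle R -> M2n) : ell2C F ->
  (forall i j, AH2 (fun z => (I1 z i j)^*)) -> (forall i j, AH2 (fun z => I2 z i j)) ->
  circle_ae (fun z => I1 z \is unitarymx) -> circle_ae (fun z => I2 z \is unitarymx) ->
  preH alpha M' -> ae_equal (Phi alpha F) (fun z => M' z *m diagI I1 I2 z) ->
  ae_equal I1 (fun=> 1%:M) /\ ae_equal I2 (fun=> 1%:M).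
Proof.
move=> hF h1 h2 u1 u2 hM' e; have hM := preH_Phi alpha hF; have cF := ell2C_allC hF.
have cc j : coef M' j = F j by rewrite -(inner_coef j h1 h2 hM hM' e) coef_Phi.
have hm := mmean_Phi alpha hF.
have m1 : mx_measurable I1.
  move=> i j; have := measJ (AH2_meas (h1 i j)); congr circle_measurable.
  by apply/funext => z; exact: conjCK.
have m2 : mx_measurable I2 by move=> i j; exact: AH2_meas.
have lower (x y t : R) : 0 < y -> x = y * t -> y <= x -> 1 <= t.
  by move=> y0 -> h; rewrite -(ler_pM2l y0) mulr1.
have limge (u : nat -> R) (l : C) (y : R) : ccvg (fun k => (u k)%:C%C) l ->
    (forall k, y <= u k) -> y <= complex.Re l.
  move=> /ccvgP [/= hu _] yu; rewrite -(cvg_lim _ hu) //.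
  by apply: limr_ge; [apply/cvg_ex; exists (complex.Re l) | apply: nearW].
split; apply: unitary_trace_one => // i.
- have t := preH_ul hM; have t' := preH_ul hM'.
  have eu := inner_ul h1 h2 hM hM' e.
  have tI : triG (alpha false) (mmean I1) by apply: (triG_cancel t'); rewrite -eu.
  have d := triG_diag_mul i t' tI; rewrite -eu in d.
  have p' := triG_diag i t'; have pI := triG_diag i tI.
  apply: (lower (complex.Re (ulsubmx (mmean (Phi alpha F)) i i)) _ (complex.Re (mmean I1 i i)) (pos_Re p')).
    by rewrite d {1}(pos_realE p') Re_scale.
  apply: (limge (fun k => \prod_(j < k) dE alpha (F j) i)).
    by have := mcvg_ul hm i i; under eq_fun do rewrite ul_MP //.
  move=> k; apply: le_trans (prod_dE_ge k i hM') _.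
  by under eq_bigr do rewrite cc.
- have t := preH_dr hM; have t' := preH_dr hM'.
  have eu := inner_dr h1 h2 hM hM' e.
  have tI : triG (alpha true) (mmean I2) by apply: (triG_cancel t'); rewrite -eu.
  have d := triG_diag_mul i t' tI; rewrite -eu in d.
  have p' := triG_diag i t'; have pI := triG_diag i tI.
  apply: (lower (complex.Re (drsubmx (mmean (Phi alpha F)) i i)) _ (complex.Re (mmean I2 i i)) (pos_Re p')).
    by rewrite d {1}(pos_realE p') Re_scale.
  apply: (limge (fun k => \prod_(j < k) dH alpha (F j) i)).
    by have := mcvg_dr hm i i; under eq_fun do rewrite dr_MP //.
  move=> k; apply: le_trans (prod_dH_ge k i hM') _.
  by under eq_bigr do rewrite cc.
Qed.

End Coefficients.

(** * The image of the transform *)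

Section Image.
Variables (R : realType) (n : nat) (alpha : bool -> bool).
Local Notation C := R[i].
Local Notation Mn := 'M[C]_n.
Local Notation M2n := 'M[C]_(n + n).
Implicit Types (F : nat -> Mn) (M : circle R -> M2n).

Lemma H2mxP p q (A : circle R -> 'M[C]_(p, q)) :
  H2mx A <-> forall i j, AH2 (fun z => A z i j).
Proof. by split=> h i j; apply/H2P; exact: h. Qed.

Lemma H2mxJP p q (A : circle R -> 'M[C]_(p, q)) :
  H2mx (fun z => (A z)^t*) <-> forall i j, AH2 (fun z => (A z i j)^*).
Proof.
split=> [/H2mxP h i j|h]; last apply/H2mxP => i j.
  by have := h j i; congr AH2; apply/funext => z; rewrite trmxCE.
by have := h j i; congr AH2; apply/funext => z; rewrite trmxCE.
Qed.

Lemma ulE (A : M2n) i j : ulsubmx A i j = A (lshift n i) (lshift n j).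
Proof. by rewrite !mxE. Qed.

Lemma dlE (A : M2n) i j : dlsubmx A i j = A (rshift n i) (lshift n j).
Proof. by rewrite !mxE. Qed.

Lemma urE (A : M2n) i j : ursubmx A i j = A (lshift n i) (rshift n j).
Proof. by rewrite !mxE. Qed.

Lemma drE (A : M2n) i j : drsubmx A i j = A (rshift n i) (rshift n j).
Proof. by rewrite !mxE. Qed.

Lemma Hplus_cond1P M : Hplus_cond1 M <-> colH M.
Proof.
split=> [[/H2mxJP h1 /H2mxJP h2 /H2mxP h3 /H2mxP h4]|[hl hr]].
  split; elim/split_ind => i l.
  - by have := h1 i l; under eq_fun do rewrite ulE.
  - by have := h2 i l; under eq_fun do rewrite dlE.
  - by have := h3 i l; under eq_fun do rewrite urE.
  - by have := h4 i l; under eq_fun do rewrite drE.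
split; [apply/H2mxJP|apply/H2mxJP|apply/H2mxP|apply/H2mxP] => i l.
- by under eq_fun do rewrite ulE.
- by under eq_fun do rewrite dlE.
- by under eq_fun do rewrite urE.
- by under eq_fun do rewrite drE.
Qed.

Lemma A_inftyE M : colH M -> A_infty M = ulsubmx (mmean M).
Proof.
move=> [hl _]; apply/matrixP => i j; rewrite trmxCE mxE ulE [mmean _ _ _]mxE.
rewrite (cmean_conj (hl _ _)) -(h2ext0 (hl _ _)).
have -> : (fun z => ((ulsubmx (M z))^t*) j i) = (fun z => (M z (lshift n i) (lshift n j))^*).
  by apply/funext => z; rewrite trmxCE ulE.
exact: erefl.
Qed.

Lemma D_zeroE M : colH M -> D_zero M = drsubmx (mmean M).
Proof.
move=> [_ hr]; apply/matrixP => i j; rewrite mxE drE [mmean _ _ _]mxE.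
rewrite -(h2ext0 (hr _ _)).
have -> : (fun z => drsubmx (M z) i j) = (fun z => M z (rshift n i) (rshift n j)).
  by apply/funext => z; rewrite drE.
exact: erefl.
Qed.

Lemma HplusP M : Hplus alpha M <-> preH alpha M /\ Hplus_cond3 alpha M.
Proof.
split=> [[mM sM /Hplus_cond1P cM [t1 t2] h]|[[mM sM cM t1 t2] h]].
  by split => //; split => //; [rewrite -A_inftyE | rewrite -D_zeroE].
by split=> //; [exact/Hplus_cond1P | split; [rewrite A_inftyE | rewrite D_zeroE]].
Qed.

Lemma Hplus_Phi F : ell2C F -> Hplus alpha (Phi alpha F).
Proof.
move=> hF; apply/HplusP; split; first exact: preH_Phi.
move=> I1 I2 M' /H2mxJP h1 /H2mxP h2 u1 u2 mM' sM' /Hplus_cond1P cM' [t1 t2] e.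
apply: (Phi_maximal hF h1 h2 u1 u2 _ e).
by split => //; [rewrite -A_inftyE | rewrite -D_zeroE].
Qed.

(** * Surjectivity of the transform *)

(** A limit of functions with zeros of unbounded order at the origin is
    analytic, and each of its Taylor coefficients is a limit of zeros. *)
Lemma lim_exp_zero (f : circle R -> C) : L2 f ->
  (forall (e : R) m, 0 < e -> exists k g, [/\ (m < k)%N, AH2 g &
     nrm2 (fun z => f z - sval z ^+ k * g z) < e]) -> ae_equal f (fun=> 0).
Proof.
move=> hf h; apply: nrm2_eq0 => //.
have Af : AH2 f.
  apply: AH2_lim => // e /(h _ 0%N) [k [g [_ hg hk]]].
  by exists (fun z => sval z ^+ k * g z) => //; exact: AH2M_exp.
have mono m : cmean (fun z => sval z ^+ m * (f z)^*) = 0.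
  apply: sq_eq0; apply/eqP; rewrite eq_le sq_ge0 andbT; apply/ler_addgt0Pr => e e0.
  rewrite add0r; have [k [g [mk hg hk]]] := h e m e0.
  have Lg : L2 (fun z => sval z ^+ k * g z) by exact/AH2_L2/AH2M_exp.
  have g0 : cmean (fun z => sval z ^+ m * (sval z ^+ k * g z)^*) = 0.
    have -> : (fun z => sval z ^+ m * (sval z ^+ k * g z)^*) =
        (fun z : circle R => (sval z ^+ (k - m) * g z)^*).
      apply/funext => z; rewrite !rmorphM /= mulrA; congr (_ * _).
      rewrite !exprnP !expz_conj -expfzDr ?circle_neq0 //; congr (_ ^ _).
      by rewrite -subzn ?(ltnW mk) // opprB.
    rewrite cmeanJ; last exact/AH2_cinteg/AH2M_exp.
    by rewrite cmean_exp_AH2 ?subn_gt0 // rmorph0.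
  have e1 : cmean (fun z => sval z ^+ m * (f z)^*) =
      cmean (fun z => sval z ^ m%:Z * (f z - sval z ^+ k * g z)^*).
    rewrite -[LHS]subr0 -[X in _ - X]g0 -cmeanB.
    - by congr cmean; apply/funext => z; rewrite rmorphB mulrBr.
    - by apply: L2_cinteg; exact/(L2M_exprz m)/L2J.
    - by apply: L2_cinteg; exact/(L2M_exprz m)/L2J.
  rewrite e1; apply: le_trans (sq_cmean_le _) _.
    exact/L2M_exprz/L2J/L2B.
  by rewrite nrm2_exprz nrm2J ltW.
have := @AH2_orth _ (fun z => (f z)^*) f (L2J hf) _ Af.
have -> : (fun z => f z * (f z)^*) = (fun z => (sq (f z))%:C%C).
  by apply/funext => z; rewrite mulcJ.
move=> /(_ _)/(congr1 (@complex.Re R)) /=; apply => p.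
have -> : (fun z : circle R => p.[sval z] * (f z)^*) =
    (fun z => \sum_(i < size p) p`_i * (sval z ^+ i * (f z)^*)).
  by apply/funext => z; rewrite horner_coef mulr_suml; apply: eq_bigr => i _; rewrite mulrA.
have ci (i : nat) : cinteg (fun z : circle R => sval z ^+ i * (f z)^*).
  by apply: L2_cinteg; exact/(L2M_exprz i)/L2J.
rewrite cmean_sum => [|i]; last exact/cintegZ.
by apply: big1 => i _; rewrite cmeanZ // mono mulr0.
Qed.

Lemma circle_ae_forall (I : finType) (P : I -> circle R -> Prop) :
  (forall i, circle_ae (P i)) -> circle_ae (fun z => forall i, P i z).
Proof.
move=> hP; have h (s : seq I) : circle_ae (fun z => forall i, i \in s -> P i z).
  elim: s => [|i s ih]; first exact: circle_aeT.
  apply: (circle_aeI (hP i) ih) => z hi hs l; rewrite inE => /predU1P [->//|].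
  exact: hs.
by apply: (circle_aeS (h (enum I))) => z hz i; apply: hz; rewrite mem_enum.
Qed.

Lemma colH_Zconj k M : colH M -> colH (fun z => Zconj z k%:Z (M z)).
Proof.
move=> hM; elim: k => [|k /colH_Zconj1]; first by under eq_fun do rewrite Zconj0.
by under eq_fun do rewrite Zconj_add -intS.
Qed.

Lemma ell2C_coef M : preH alpha M -> ell2C (coef alpha M).
Proof.
move=> hM; apply/ell2C_E; split; first exact: coef_contractive.
by have [] := summable_bound (fun j => hs2_ge0 (coef alpha M j)) (fun k => coef_sum_le k hM).
Qed.

Section Quotient.
Variable M : circle R -> M2n.
Hypothesis hM : preH alpha M.

Let F := coef alpha M.
Let hF : ell2C F := ell2C_coef hM.

(** The quotient of [M] by the transform of its coefficients; it is the limit of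
    [Z^k M_k Z^-k] where [M_k] is [M] without its first [k] factors. *)
Definition quot (z : circle R) : M2n := (Phi alpha F z)^t* *m M z.

Lemma quot_unitary : circle_ae (fun z => quot z \is unitarymx).
Proof.
have [_ sP _ _ _] := preH_Phi alpha hF; have [_ sM _ _ _] := hM.
by apply: (circle_aeI sP sM) => z s1 s2; have [] := SU_mul (SU_J s1) s2.
Qed.

Lemma quot_mL2 : mL2 quot.
Proof.
apply: mL2_unitary quot_unitary; have [mM _ _ _ _] := hM.
have [mP _ _ _ _] := preH_Phi alpha hF.
by apply: meas_mulmx => //; exact: mmeasJ.
Qed.

Lemma quot_lim : (fun k => mnrm (fun z => Zconj z k%:Z (strips alpha k M z) - quot z))
  @ \oo --> (0 : R).
Proof.
have [_ _ h] := PhiP alpha hF; have cF := ell2C_allC hF.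
have -> // : (fun k => mnrm (fun z => Zconj z k%:Z (strips alpha k M z) - quot z)) =
  (fun k => mnrm (fun z => MP alpha k F z - Phi alpha F z)).
apply/funext => k; apply/esym.
have mS := meas_strips alpha k (mL2_meas (preH_mL2 hM)).
have hP := preH_MP alpha k cF.
apply: mean_ae; [exact: rmeas_hs2 (mL2_meas (mL2B (preH_mL2 hP) (preH_mL2 (preH_Phi alpha hF)))) |
  exact: rmeas_hs2 (mL2_meas (mL2B (mL2_Zconj k (colH_mL2 (preH_colH (preH_strips k hM)))) quot_mL2)) |].
apply: (circle_aeS (preH_unitary hM)) => z uM.
have -> : Zconj z k (strips alpha k M z) = (MP alpha k F z)^t* *m M z.
  have [uP _] := SU_MP alpha k z cF.
  by rewrite -[LHS]mul1mx -(unitaryE' uP) -mulmxA -(MP_strips alpha k M z).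
by rewrite -mulmxBl -trmxCB hs2_mulr // hs2J.
Qed.

Lemma quot_colH : colH quot.
Proof.
apply: colH_lim quot_mL2 quot_lim => k; apply: colH_Zconj.
exact/preH_colH/preH_strips.
Qed.

Lemma quot_lim_entry (e : R) m : 0 < e -> exists2 k, (m < k)%N & forall i l,
  nrm2 (fun z => quot z i l - Zconj z k%:Z (strips alpha k M z) i l) < e.
Proof.
move=> e0; have := quot_lim => /(cvg0P (fun k => mnrm_ge0 _)) /(_ _ e0) [N hN].
exists (maxn N m.+1) => [|i l]; first by rewrite leq_maxr.
apply: le_lt_trans (hN _ (leq_maxl _ _)).
have hk := mL2B (mL2_Zconj (maxn N m.+1) (preH_mL2 (preH_strips (maxn N m.+1) hM))) quot_mL2.
apply: le_trans (nrm2_le_mnrm i l hk); rewrite le_eqVlt; apply/orP; left; apply/eqP.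
by congr mean; apply/funext => z; rewrite -sqN opprB subr_mxE.
Qed.

(** In [Z^k M_k Z^-k] the off-diagonal blocks vanish to order [k]. *)
Lemma quot_ur i l : ae_equal (fun z => quot z (lshift n i) (rshift n l)) (fun=> 0).
Proof.
apply: lim_exp_zero; first exact: quot_mL2.
move=> e m /(quot_lim_entry m) [k mk hk].
exists k, (fun z => strips alpha k M z (lshift n i) (rshift n l)); split => //.
  by have [_] := preH_colH (preH_strips k hM); exact.
by have := hk (lshift n i) (rshift n l); under eq_fun do rewrite Zconj_ur.
Qed.

Lemma quot_dl i l : ae_equal (fun z => quot z (rshift n i) (lshift n l)) (fun=> 0).
Proof.
have h : ae_equal (fun z => (quot z (rshift n i) (lshift n l))^*) (fun=> 0).
  apply: lim_exp_zero; first exact/L2J/quot_mL2.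
  move=> e m /(quot_lim_entry m) [k mk hk].
  exists k, (fun z => (strips alpha k M z (rshift n i) (lshift n l))^*); split => //.
    by have [+ _] := preH_colH (preH_strips k hM); exact.
  have := hk (rshift n i) (lshift n l); rewrite -nrm2J.
  by under eq_fun do rewrite rmorphB /= Zconj_dl rmorphM /= expz_conj opprK.
by apply: ae_equalS h _ => z e; rewrite -[LHS]conjCK e rmorph0.
Qed.

Lemma quot_diag : ae_equal quot (diagI (fun z => ulsubmx (quot z)) (fun z => drsubmx (quot z))).
Proof.
have h1 : circle_ae (fun z => forall i l, quot z (lshift n i) (rshift n l) = 0).
  by apply: circle_ae_forall => i; apply: circle_ae_forall => l; exact: quot_ur.
have h2 : circle_ae (fun z => forall i l, quot z (rshift n i) (lshift n l) = 0).
  by apply: circle_ae_forall => i; apply: circle_ae_forall => l; exact: quot_dl.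
apply: (circle_aeI h1 h2) => z e1 e2; rewrite -[LHS]submxK /diagI.
have -> : ursubmx (quot z) = 0 by apply/matrixP => i l; rewrite urE e1 mxE.
by have -> : dlsubmx (quot z) = 0 by apply/matrixP => i l; rewrite dlE e2 mxE.
Qed.

Lemma quot_inner : circle_ae (fun z => ulsubmx (quot z) \is unitarymx) /\
  circle_ae (fun z => drsubmx (quot z) \is unitarymx).
Proof.
have h z : quot z \is unitarymx ->
    quot z = diagI (fun z => ulsubmx (quot z)) (fun z => drsubmx (quot z)) z ->
    ulsubmx (quot z) \is unitarymx /\ drsubmx (quot z) \is unitarymx.
  move=> + e; rewrite {1}e => /unitary_block [h1 _ h2 _].
  rewrite mul0mx addr0 in h1; rewrite mulmx0 add0r in h2.
  by split; apply/unitarymxP => //; exact: mulmx1C.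
by split; apply: (circle_aeI quot_unitary quot_diag) => z u e; have [] := h z u e.
Qed.

Lemma factor_Phi : ae_equal M (fun z => Phi alpha F z *m
  diagI (fun z => ulsubmx (quot z)) (fun z => drsubmx (quot z)) z).
Proof.
apply: (circle_aeI (preH_unitary (preH_Phi alpha hF)) quot_diag) => z u <-.
by rewrite /quot mulmxA unitaryE // mul1mx.
Qed.

(** The factorisation of [M] through the transform of its coefficients has
    inner factors, and maximality of [M] makes them trivial. *)
Lemma Phi_coef : Hplus_cond3 alpha M -> ae_equal (Phi alpha F) M.
Proof.
move=> h; have [u1 u2] := quot_inner; have hP := preH_Phi alpha hF.
have [mP sP cP t1 t2] := hP; have [ql qr] := quot_colH.
have a1 : H2mx (fun z => (ulsubmx (quot z))^t*).
  by apply/H2mxJP => i l; under eq_fun do rewrite ulE.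
have a2 : H2mx (fun z => drsubmx (quot z)).
  by apply/H2mxP => i l; under eq_fun do rewrite drE.
have a3 : Hplus_cond2 alpha (Phi alpha F) by split; [rewrite A_inftyE | rewrite D_zeroE].
have [e1 e2] := h _ _ _ a1 a2 u1 u2 mP sP ((Hplus_cond1P _).2 cP) a3 factor_Phi.
have e12 := circle_aeI e1 e2 (fun z a b => conj a b).
apply: (circle_aeI factor_Phi e12) => z e [i1 i2].
by rewrite e /diagI i1 i2 -scalar_mx_block mulmx1.
Qed.

End Quotient.

Lemma Phi_surj M : Hplus alpha M -> exists2 F, ell2C F & ae_equal (Phi alpha F) M.
Proof.
move=> /HplusP [hM h3]; exists (coef alpha M); first exact: ell2C_coef.
exact: Phi_coef.
Qed.

Lemma Phi_inj F G : ell2C F -> ell2C G -> ae_equal (Phi alpha F) (Phi alpha G) -> F = G.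
Proof.
move=> hF hG e; apply/funext => j; rewrite -(coef_Phi alpha j hF) -(coef_Phi alpha j hG).
by apply: coef_ae e; apply: mL2_meas; apply: preH_mL2; exact: preH_Phi.
Qed.

End Image.

(** * Sequential continuity *)

Section Sequences.
Variable R : realType.
Implicit Types (a b c y : nat -> R).

(** Both continuity statements interchange a limit with truncation at depth [k]:
    [a] bounds the truncation errors, [b k] the errors at fixed depth. *)
Lemma double_limit y a (b : nat -> nat -> R) : (forall m, 0 <= y m) ->
  (forall k, 0 <= a k) -> (forall k m, 0 <= b k m) ->
  (forall k m, y m <= a k + b k m) -> a @ \oo --> (0 : R) ->
  (forall k, b k @ \oo --> (0 : R)) -> y @ \oo --> (0 : R).
Proof.
move=> y0 a0 b0 h /(cvg0P a0) ha hb; apply/(cvg0P y0) => e e0.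
have e2 : 0 < e / 2 by rewrite divr_gt0.
have [k hk] := ha _ e2; have [N hN] := (cvg0P (b0 k)).1 (hb k) _ e2.
exists N => m /hN bm; apply: le_lt_trans (h k m) _.
by have := hk k (leqnn k); lra.
Qed.

Lemma cvg0Z (t : R) y : y @ \oo --> (0 : R) -> (fun m => t * y m) @ \oo --> (0 : R).
Proof. by move=> hy; rewrite -(mulr0 t); apply: cvgM => //; exact: cvg_cst. Qed.

Lemma cvg0D a b : a @ \oo --> (0 : R) -> b @ \oo --> (0 : R) ->
  (fun m => a m + b m) @ \oo --> (0 : R).
Proof. by move=> ha hb; rewrite -(addr0 0); exact: cvgD. Qed.

Lemma cvg_dist0 y (l : R) : y @ \oo --> l -> (fun m => `|y m - l|) @ \oo --> (0 : R).
Proof.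
move=> hy; rewrite -(normr0 R) -(subrr l).
by apply: cvg_norm; apply: cvgB => //; exact: cvg_cst.
Qed.

Lemma sqrt_cvg0 y : (forall m, 0 <= y m) ->
  (fun m => Num.sqrt (y m)) @ \oo --> (0 : R) <-> y @ \oo --> (0 : R).
Proof.
move=> y0; have s0 m : 0 <= Num.sqrt (y m) by exact: sqrtr_ge0.
split=> [/(cvg0P s0) h|/(cvg0P y0) h]; [apply/(cvg0P y0)|apply/(cvg0P s0)] => e e0.
  have [|N hN] := h (Num.sqrt e); first by rewrite sqrtr_gt0.
  by exists N => m /hN; rewrite ltr_sqrt.
have [|N hN] := h (e ^+ 2); first by rewrite exprn_gt0.
exists N => m /hN; rewrite -(ltr_sqrt _ (exprn_gt0 2 e0)).
by rewrite sqrtr_sqr gtr0_norm.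
Qed.

Lemma rest_bound a k B : (forall j, 0 <= a j) -> summable a ->
  (forall l, \sum_(j < l) a (k + j)%N <= B) -> rest a k <= B.
Proof.
move=> a0 sa hB; rewrite lerBlDl.
have [|_ //] := @summable_bound _ a (\sum_(j < k) a j + B) a0.
move=> m; apply: le_trans (_ : \sum_(j < k + m) a j <= _).
  by rewrite addnC big_split_ord /= lerDl; apply: sumr_ge0.
by rewrite big_split_ord /= lerD2l; exact: hB.
Qed.

Lemma rest_le2 a b c k : (forall j, 0 <= a j) -> (forall j, 0 <= b j) ->
  (forall j, 0 <= c j) -> summable a -> summable b -> summable c ->
  (forall j, a j <= 2 * b j + 2 * c j) -> rest a k <= 2 * rest b k + 2 * rest c k.
Proof.
move=> a0 b0 c0 sa sb sc h; apply: rest_bound => // l.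
apply: le_trans (_ : \sum_(j < l) (2 * b (k + j)%N + 2 * c (k + j)%N) <= _).
  by apply: ler_sum => j _; exact: h.
rewrite big_split /= -!mulr_sumr.
by apply: lerD; rewrite ler_wpM2l //; exact: sum_shift_le.
Qed.

Lemma rest_le_total a k : (forall j, 0 <= a j) -> rest a k <= total a.
Proof. by move=> a0; rewrite gerBl; apply: sumr_ge0. Qed.

Lemma rest_split (T s r1 r2 t1 t2 x : R) : T - s <= 2 * r1 + 2 * r2 -> r2 <= t1 ->
  t1 - t2 <= x -> T <= 2 * r1 + 2 * t2 + (s + 2 * x).
Proof. lra. Qed.

Lemma rate_split (x1 x2 x3 x4 x5 r s d t : R) : 0 <= t -> x1 <= 2 * x2 + 2 * x3 ->
  x3 <= 2 * x4 + 2 * x5 -> x5 <= t * r -> x2 <= t * s -> s <= 2 * r + 2 * d ->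
  x1 <= 8 * t * r + (4 * x4 + 4 * t * d).
Proof. by move=> t0 a1 a2 a3 a4 a5; have := ler_wpM2l t0 a5; lra. Qed.

End Sequences.

Lemma metric_continuous_seq (R : realType) (X Y : Type) (A : set X)
    (dX : X -> X -> R) (dY : Y -> Y -> R) (f : X -> Y) :
  (forall x y, 0 <= dX x y) -> (forall x y, 0 <= dY x y) ->
  (forall x u, A x -> (forall m, A (u m)) -> (fun m => dX x (u m)) @ \oo --> (0 : R) ->
    (fun m => dY (f x) (f (u m))) @ \oo --> (0 : R)) ->
  metric_continuous A dX dY f.
Proof.
move=> dX0 dY0 h x Ax e e0; apply: contrapT => hn.
have /choice [u hu] : forall m : nat, exists x', [/\ A x', dX x x' < m.+1%:R^-1 & e <= dY (f x) (f x')].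
  move=> m; apply: contrapT => hm; apply: hn; exists m.+1%:R^-1.
    by rewrite invr_gt0 ltr0n.
  move=> x' Ax' dx; rewrite ltNge; apply/negP => dy.
  by apply: hm; exists x'.
have hd : (fun m => dX x (u m)) @ \oo --> (0 : R).
  apply: squeeze0 (@cvg_harmonic R) => m //.
  by have [_ /ltW] := hu m.
have := h x u Ax (fun m => let: And3 a _ _ := hu m in a) hd.
move=> /(cvg0P (fun m => dY0 _ _)) /(_ _ e0) [N /(_ N (leqnn N))].
by have [_ _] := hu N; rewrite leNgt => /negP.
Qed.

(** * The two metrics *)

Section Continuity.
Variables (R : realType) (n : nat) (alpha : bool -> bool).
Local Notation C := R[i].
Local Notation Mn := 'M[C]_n.
Local Notation M2n := 'M[C]_(n + n).
Implicit Types (F G : nat -> Mn) (M : circle R -> M2n).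

Definition dif F G (j : nat) : R := hs2 (F j - G j).

Lemma dif_ge0 F G j : 0 <= dif F G j.
Proof. exact: hs2_ge0. Qed.

Lemma hs2_dif F G j : hs2 (G j) <= 2 * hs2 (F j) + 2 * dif F G j.
Proof.
have := hs2B_le 0 (F j) (G j); rewrite !sub0r !hs2N.
by [].
Qed.

Lemma dif_le F G j : dif F G j <= 2 * hs2 (F j) + 2 * hs2 (G j).
Proof. by have := hs2B_le (F j) 0 (G j); rewrite sub0r hs2N subr0. Qed.

Lemma ell2C_summable F : ell2C F -> summable (fun j => hs2 (F j)).
Proof. by move=> /ell2C_E []. Qed.

Lemma summable_dif F G : ell2C F -> ell2C G -> summable (dif F G).
Proof.
move=> /ell2C_summable sF /ell2C_summable sG.
have [|//] := @summable_bound _ (dif F G) (2 * total (fun j => hs2 (F j)) +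
  2 * total (fun j => hs2 (G j))) (dif_ge0 F G).
move=> m; apply: le_trans (_ : \sum_(j < m) (2 * hs2 (F j) + 2 * hs2 (G j)) <= _).
  by apply: ler_sum => j _; exact: dif_le.
rewrite big_split /= -!mulr_sumr; apply: lerD; rewrite ler_wpM2l //.
  by apply: (partial_le_total m (fun j => hs2_ge0 (F j)) sF).
by apply: (partial_le_total m (fun j => hs2_ge0 (G j)) sG).
Qed.

Lemma ell2_distE F G : ell2_dist F G = Num.sqrt (total (dif F G)).
Proof.
congr (Num.sqrt (fine _)); apply: eq_eseriesr => j _.
by rewrite hsnorm2.
Qed.

Lemma Hplus_distE M (N : circle R -> M2n) : colH M -> colH N ->
  Hplus_dist M N = Num.sqrt (mnrm (fun z => M z - N z)) + `|ln (detA M) - ln (detA N)|.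
Proof.
move=> hM hN; rewrite /Hplus_dist (A_inftyE hM) (A_inftyE hN).
congr (Num.sqrt _ + _); rewrite /mnrm /mean.
have -> // : (fun z => hsnorm (M z - N z) ^+ 2) = (fun z => hs2 (M z - N z)).
by apply/funext => z; exact: hsnorm2.
Qed.

Lemma detA_lim (M_ : nat -> circle R -> M2n) M : (forall m, preH alpha (M_ m)) ->
  preH alpha M -> mlim M_ M -> (fun m => ln (detA (M_ m))) @ \oo --> ln (detA M).
Proof.
move=> hM_ hM h.
have hd := mcvg_det (mcvg_ul (mmean_cvg (fun m => preH_mL2 (hM_ m)) (preH_mL2 hM) h)).
have /ccvgP [hr _] := hd.
exact: (continuous_cvg _ (continuous_ln (detA_gt0 hM)) hr).
Qed.

(** The logarithmic term of the metric is controlled by the other one: the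
    determinant at infinity is a continuous function of the mean and has a
    positive limit. *)
Lemma Hplus_dist_lim (M_ : nat -> circle R -> M2n) M : (forall m, preH alpha (M_ m)) ->
  preH alpha M ->
  (fun m => Hplus_dist M (M_ m)) @ \oo --> (0 : R) <-> mlim M_ M.
Proof.
move=> hM_ hM.
have e : (fun m => Hplus_dist M (M_ m)) = (fun m => Num.sqrt (mnrm (fun z => M_ m z - M z)) +
    `|ln (detA (M_ m)) - ln (detA M)|).
  apply/funext => m; rewrite (Hplus_distE (preH_colH hM) (preH_colH (hM_ m))).
  by rewrite [in LHS]mnrmC [in LHS]distrC.
rewrite e; split => h.
  apply/(sqrt_cvg0 (fun m => mnrm_ge0 _)); apply: squeeze0 h => m.
    exact: sqrtr_ge0.
  by rewrite lerDl.
apply: cvg0D; first exact/(sqrt_cvg0 (fun m => mnrm_ge0 _)).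
by apply: cvg_dist0; exact: detA_lim.
Qed.

(** * Continuity of the transform *)

Lemma Phi_rate F k : ell2C F ->
  mnrm (fun z => MP alpha k F z - Phi alpha F z) <= 8 * n%:R * rest (fun j => hs2 (F j)) k.
Proof.
move=> hF; have cF := ell2C_allC hF; have sF := ell2C_summable hF.
have [h1 _ h2] := PhiP alpha hF; have a0 j := hs2_ge0 (F j).
apply/ler_addgt0Pr => e e0; have e2 : 0 < e / 2 by rewrite divr_gt0.
have [N hN] := (cvg0P (fun k => mnrm_ge0 _)).1 h2 _ e2.
have mP l := preH_mL2 (preH_MP alpha l cF).
apply: le_trans (mnrmB_le (mP k) (mP (k + N)%N) h1) _.
have := hN _ (leq_addl k N).
have := MP_cauchy alpha k N cF.
have : 4 * n%:R * (\sum_(j < N) hs2 (F (k + j)%N)) <= 4 * n%:R * rest (fun j => hs2 (F j)) k.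
  by rewrite ler_wpM2l ?mulr_ge0 //; exact: (sum_shift_le k N a0 sF).
lra.
Qed.

Lemma MP_lim k F (F_ : nat -> nat -> Mn) : allC F -> (forall m, allC (F_ m)) ->
  (forall j, mcvg (fun m => F_ m j) (F j)) -> mlim (fun m => MP alpha k (F_ m)) (MP alpha k F).
Proof.
elim: k F F_ => [|k ih] F F_ cF cF_ h /=.
  apply/cvg0P => [m|e e0]; first exact: mnrm_ge0.
  exists 0%N => m _; rewrite /mnrm; under eq_fun do rewrite subrr hs2_0.
  by rewrite mean_cst.
have c0 m : contractive (F_ m 0%N) by exact: cF_.
have pM m := preH_MP alpha k (allC_shift 1 (cF_ m)).
apply: (unstrip_lim c0 (cF 0%N) (h 0%N) pM (preH_MP alpha k (allC_shift 1 cF))).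
exact: (ih (shift 1 F) (fun m => shift 1 (F_ m)) (allC_shift 1 cF) (fun m => allC_shift 1 (cF_ m)) (fun j => h (1 + j)%N)).
Qed.

Lemma mcvgI p q (A_ : nat -> 'M[C]_(p, q)) (A : 'M[C]_(p, q)) :
  (fun m => hs2 (A_ m - A)) @ \oo --> (0 : R) -> mcvg A_ A.
Proof.
move=> h i j; apply: squeeze0 h => m; first exact: sq_ge0.
by rewrite -subr_mxE; exact: sq_le_hs2.
Qed.

(** Up to errors bounded by the rests of the series, the transforms are products
    with a fixed number of factors, which depend continuously on the factors. *)
Lemma Phi_continuous F (F_ : nat -> nat -> Mn) : ell2C F -> (forall m, ell2C (F_ m)) ->
  (fun m => total (dif F (F_ m))) @ \oo --> (0 : R) ->
  mlim (fun m => Phi alpha (F_ m)) (Phi alpha F).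
Proof.
move=> hF hF_ hD; have sF := ell2C_summable hF.
have sD m := summable_dif hF (hF_ m).
have hc j : mcvg (fun m => F_ m j) (F j).
  apply: mcvgI; apply: squeeze0 hD => m; first exact: hs2_ge0.
  rewrite -hs2N opprB; apply: le_trans (partial_le_total j.+1 (dif_ge0 F (F_ m)) (sD m)).
  by rewrite big_ord_recr /= lerDr; apply: sumr_ge0 => i _; exact: dif_ge0.
pose c : R := 8 * n%:R; have c0 : 0 <= c by exact: mulr_ge0.
have MPl k := MP_lim k (ell2C_allC hF) (fun m => ell2C_allC (hF_ m)) hc.
apply: (@double_limit _ _ (fun k => 8 * c * rest (fun j => hs2 (F j)) k)
  (fun k m => 4 * mnrm (fun z => MP alpha k (F_ m) z - MP alpha k F z) +
     4 * c * total (dif F (F_ m)))).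
- by move=> m; exact: mnrm_ge0.
- move=> k; apply: mulr_ge0; first exact: mulr_ge0.
  by apply: rest_ge0 => // j; exact: hs2_ge0.
- move=> k m; apply: addr_ge0; first by rewrite mulr_ge0 ?mnrm_ge0.
  apply: mulr_ge0; first exact: mulr_ge0.
  by have := partial_le_total 0 (dif_ge0 F (F_ m)) (sD m); rewrite big_ord0.
- move=> k m.
  have mP (G : nat -> Mn) (hG : ell2C G) := preH_mL2 (preH_Phi alpha hG).
  have mM (G : nat -> Mn) (hG : ell2C G) := preH_mL2 (preH_MP alpha k (ell2C_allC hG)).
  have i1 := mnrmB_le (mP _ (hF_ m)) (mM _ (hF_ m)) (mP _ hF).
  have i2 := mnrmB_le (mM _ (hF_ m)) (mM _ hF) (mP _ hF).
  have i3 := Phi_rate k hF.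
  have i4 := Phi_rate k (hF_ m); rewrite mnrmC in i4.
  have i5 : rest (fun j => hs2 (F_ m j)) k <= 2 * rest (fun j => hs2 (F j)) k + 2 * rest (dif F (F_ m)) k.
    apply: rest_le2 => //; try by move=> j; exact: hs2_ge0.
      exact: ell2C_summable.
    by move=> j; exact: hs2_dif.
  have i6 := rest_le_total k (dif_ge0 F (F_ m)).
  have i7 := le_trans i5 (lerD (lexx _) (ler_wpM2l (ler0n R 2) i6)).
  exact: (rate_split c0 i1 i2 i3 i4 i7).
- by apply: cvg0Z; apply: rest_cvg => // j; exact: hs2_ge0.
- by move=> k; apply: cvg0D; apply: cvg0Z => //; exact: MPl.
Qed.

(** * Continuity of the inverse *)

Lemma strips_lim j (M_ : nat -> circle R -> M2n) M : (forall m, preH alpha (M_ m)) ->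
  preH alpha M -> mlim M_ M -> mlim (fun m => strips alpha j (M_ m)) (strips alpha j M).
Proof.
move=> hM_ hM h; elim: j => [//|j ih].
exact: (strip_lim (fun m => preH_strips j (hM_ m)) (preH_strips j hM) ih).
Qed.

Lemma coef_lim j (M_ : nat -> circle R -> M2n) M : (forall m, preH alpha (M_ m)) ->
  preH alpha M -> mlim M_ M -> mcvg (fun m => coef alpha (M_ m) j) (coef alpha M j).
Proof.
move=> hM_ hM h; apply: coef0_cvg => [m||]; [exact: preH_strips | exact: preH_strips |].
exact: strips_lim.
Qed.

Lemma coef_strips j M : coef alpha (strips alpha j M) = shift j (coef alpha M).
Proof.
apply/funext => i; rewrite /coef /shift; congr (coef0 alpha _).
by rewrite /strips -iterD addnC.
Qed.

Lemma detA_strips k M : preH alpha M -> detA M =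
  \prod_(j < k) delta alpha (coef alpha M j) * detA (strips alpha k M).
Proof.
move=> hM; elim: k => [|k ih]; first by rewrite big_ord0 mul1r.
rewrite big_ord_recr /= -mulrA -(detA_strip (preH_strips k hM)).
exact: ih.
Qed.

Lemma detA_MP k F : allC F -> detA (MP alpha k F) = \prod_(j < k) delta alpha (F j).
Proof.
elim: k F => [|k ih] F cF.
  rewrite big_ord0 /detA (mmean_cst 1%:M).
  by have -> : ulsubmx (1%:M : M2n) = 1%:M; [rewrite [1%:M]scalar_mx_block block_mxKul | rewrite det1].
have cF' := allC_shift 1 cF.
rewrite /detA ul_unstrip; last exact/preH_colH/preH_MP.
rewrite det_mulmx (delta_eq alpha (cF 0%N)) big_ord_recl.
by apply: etrans (Re_scale _ _) _; congr (_ * _); exact: ih.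
Qed.

(** By the product formula, the determinant of a tail is the determinant of the
    whole divided by a partial product, and the partial products converge to
    the determinant of the whole, which is not zero. *)
Lemma detA_tail F : ell2C F ->
  (fun k => - 2 * ln (detA (strips alpha k (Phi alpha F)))) @ \oo --> (0 : R).
Proof.
move=> hF; have cF := ell2C_allC hF; have hP := preH_Phi alpha hF.
have d0 := detA_gt0 hP.
have [_ _ hl] := PhiP alpha hF.
have h := detA_lim (fun k => preH_MP alpha k cF) hP hl.
have lin (x y : R) : - 2 * x = 2 * (y - (y + x)) by ring.
have e k : - 2 * ln (detA (strips alpha k (Phi alpha F))) =
    2 * (ln (detA (MP alpha k F)) - ln (detA (Phi alpha F))).
  have p0 := detA_gt0 (preH_MP alpha k cF).
  rewrite (detA_strips k hP); under eq_bigr do rewrite coef_Phi //.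
  have s0 := detA_gt0 (preH_strips k hP).
  rewrite -(detA_MP k cF) (lnM p0 s0); exact: lin.
under eq_fun do rewrite e.
apply: cvg0Z; rewrite -(subrr (ln (detA (Phi alpha F)))).
exact: (cvgB h (cvg_cst _)).
Qed.

(** Each single coefficient depends continuously on the function; the rests of
    the series are bounded uniformly by the determinants at infinity of the
    tails, which are continuous and tend to one with the depth. *)
Lemma Phi_inv_continuous F (F_ : nat -> nat -> Mn) : ell2C F -> (forall m, ell2C (F_ m)) ->
  mlim (fun m => Phi alpha (F_ m)) (Phi alpha F) ->
  (fun m => total (dif F (F_ m))) @ \oo --> (0 : R).
Proof.
move=> hF hF_ h; have sF := ell2C_summable hF.
have sD m := summable_dif hF (hF_ m).
have pF := preH_Phi alpha hF; have pF_ m := preH_Phi alpha (hF_ m).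
pose t k M := - 2 * ln (detA (strips alpha k M)).
have t0 k M : preH alpha M -> 0 <= t k M.
  by move=> hM; have := ln_le0 (detA_le1 (preH_strips k hM)); rewrite /t; lra.
have rt k m : rest (fun j => hs2 (F_ m j)) k <= t k (Phi alpha (F_ m)).
  apply: rest_bound => [j||l]; [exact: hs2_ge0 | exact: ell2C_summable |].
  have := coef_sum_le l (preH_strips k (pF_ m)); rewrite coef_strips.
  by under eq_bigr do rewrite /shift coef_Phi //.
have tl k : (fun m => `|t k (Phi alpha (F_ m)) - t k (Phi alpha F)|) @ \oo --> (0 : R).
  apply: cvg_dist0; apply: cvgM; first exact: cvg_cst.
  exact: (detA_lim (fun m => preH_strips k (pF_ m)) (preH_strips k pF) (strips_lim k pF_ pF h)).
have sl k : (fun m => \sum_(j < k) dif F (F_ m) j) @ \oo --> (0 : R).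
  suff : (fun m => \sum_(j < k) dif F (F_ m) j) @ \oo --> \sum_(j < k) (0 : R) by rewrite big1.
  apply: cvg_sumR => j; have := mcvg_hs2 (coef_lim j pF_ pF h).
  have -> // : (fun m => hs2 (coef alpha (Phi alpha (F_ m)) j - coef alpha (Phi alpha F) j)) =
    (fun m => dif F (F_ m) j).
  apply/funext => m.
  rewrite /dif -[RHS]hs2N opprB.
  exact: (congr1 (@hs2 R n n) (congr2 (fun A B => A - B) (coef_Phi alpha j (hF_ m)) (coef_Phi alpha j hF))).
apply: (@double_limit _ _ (fun k => 2 * rest (fun j => hs2 (F j)) k + 2 * t k (Phi alpha F))
  (fun k m => \sum_(j < k) dif F (F_ m) j +
     2 * `|t k (Phi alpha (F_ m)) - t k (Phi alpha F)|)).
- by move=> m; have := partial_le_total 0 (dif_ge0 F (F_ m)) (sD m); rewrite big_ord0.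
- move=> k; rewrite addr_ge0 // mulr_ge0 ?t0 //.
  by apply: rest_ge0 => // j; exact: hs2_ge0.
- move=> k m; rewrite addr_ge0 ?mulr_ge0 //.
  by apply: sumr_ge0 => j _; exact: dif_ge0.
- move=> k m; have i1 : rest (dif F (F_ m)) k <=
      2 * rest (fun j => hs2 (F j)) k + 2 * rest (fun j => hs2 (F_ m j)) k.
    apply: rest_le2 => //; try by move=> j; exact: hs2_ge0.
      exact: ell2C_summable.
    by move=> j; exact: dif_le.
  have i2 := rt k m; have i3 := ler_norm (t k (Phi alpha (F_ m)) - t k (Phi alpha F)).
  exact: (rest_split i1 i2 i3).
- by apply: cvg0D; apply: cvg0Z; [apply: rest_cvg => // j; exact: hs2_ge0 | exact: detA_tail].
- by move=> k; apply: cvg0D; [exact: sl | apply: cvg0Z; exact: tl].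
Qed.

Lemma Phi_homeomorphism : homeomorphism_onto (@ell2C R n) (@ell2_dist R n)
  (Hplus alpha) (@ae_equal R M2n) (@Hplus_dist R n) (Phi alpha).
Proof.
have d1 (F G : nat -> Mn) : 0 <= ell2_dist F G by exact: sqrtr_ge0.
have d2 (M N : circle R -> M2n) : 0 <= Hplus_dist M N by rewrite addr_ge0 // sqrtr_ge0.
have td F G (hF : ell2C F) (hG : ell2C G) : 0 <= total (dif F G).
  by have := partial_le_total 0 (dif_ge0 F G) (summable_dif hF hG); rewrite big_ord0.
split.
- by move=> F; exact: Hplus_Phi.
- by move=> F G; exact: Phi_inj.
- by move=> M; exact: Phi_surj.
- apply: metric_continuous_seq => // F F_ hF hF_ h.
  apply/(Hplus_dist_lim (fun m => preH_Phi alpha (hF_ m)) (preH_Phi alpha hF)).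
  apply: Phi_continuous => //; apply/(sqrt_cvg0 (fun m => td _ _ hF (hF_ m))).
  by under eq_fun do rewrite -ell2_distE.
- apply: (@metric_continuous_seq _ _ _ _ (fun F G => Hplus_dist (Phi alpha F) (Phi alpha G)) _ id) => // F F_ hF hF_ h.
  under eq_fun do rewrite ell2_distE; apply/(sqrt_cvg0 (fun m => td _ _ hF (hF_ m))).
  apply: Phi_inv_continuous => //.
  exact/(Hplus_dist_lim (fun m => preH_Phi alpha (hF_ m)) (preH_Phi alpha hF)).
Qed.

End Continuity.

Theorem theorem1p5 (R : realType) (n : nat) (hn : (1 <= n)%N)
    (alpha : bool -> bool) :
  exists Phi : (nat -> 'M[R[i]]_n) -> (circle R -> 'M[R[i]]_(n + n)),
    (forall F : nat -> 'M[R[i]]_n,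
       (forall j, contractive (F j)) ->
       (exists N : nat, forall j : nat, (N <= j)%N -> F j = 0%R) ->
       ae_equal (Phi F) (nlft alpha (extend0 F))) /\
    homeomorphism_onto (@ell2C R n) (@ell2_dist R n)
      (Hplus alpha) (@ae_equal R 'M[R[i]]_(n + n)) (@Hplus_dist R n) Phi.
Proof.
exists (Phi alpha); split; last exact: Phi_homeomorphism.
move=> F cF [N F0]; have [K [FK ->]] := nlft_MP alpha cF F0.
by have [_] := Phi_finite alpha cF FK.
Qed.
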